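(* Let $q = dd'e$ for some $d,d',e\in\mathbb{Z}_+$ with $d'\mid d$ and $(d,e)=1$, and let $f\le\sqrt{qd}$ be the largest integer with $f^2\mid qd$. Let $C\ge\tfrac12$ and let $\mathcal{I},\mathcal{J}\subset\mathbb{Z}_+$ be intervals of lengths $|\mathcal{I}|=M$, $|\mathcal{J}|=N$, with $1\le N\le M\le C$ and $\max(\mathcal{I}\cup\mathcal{J})\ll C^{O(1)}$. Let $(\alpha_m)_{m\in\mathcal{I}}$, $(\beta_n)_{n\in\mathcal{J}}$ be complex sequences, and for each integer $c$ with $C<c\le2C$, let $(\alpha_m(c))_{m\in\mathcal{I}}$, $(\beta_n(c))_{n\in\mathcal{J}}$ be complex sequences such that $|\alpha_m(c)|\le|\alpha_m|$ and $|\beta_n(c)|\le|\beta_n|$ for all $m\in\mathcal{I}$, $n\in\mathcal{J}$. Then one has $$\sum_{\substack{C<c\le2C \\ q\mid c}}\left|\sum_{\substack{m\in\mathcal{I},\ n\in\mathcal{J} \\ (m,n,q)=1}}\alpha_m(c)\beta_n(c)S(m,n;c)\right| \ll \|\alpha\|\,\|\beta\|\,\frac{C^{2+o(1)}}{q}\min\left\{\left(\frac{dM^3N}{C^3}+\frac{fM^2}{C^2}+\frac{f}{d^2}\right)^{\frac16},\ \left(\frac{dM^3N}{qC^2}+\frac{fM^2}{qC}+\frac{fq}{d^2C}\right)^{\frac16}\right\}.$$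
   Context: $\mathbb{Z}_+$ is the set of positive integers; $e(t) := \exp(2\pi i t)$ when $e(\cdot)$ is applied to a real argument. The Kloosterman sum is $S(m,n;c) := \sum_{x \in (\mathbb{Z}/c\mathbb{Z})^\times} e\left(\frac{mx+n\bar{x}}{c}\right)$, where $x\bar{x}\equiv1\pmod c$. $(\cdot,\cdot)$ and $(\cdot,\cdot,\cdot)$ denote greatest common divisors. An interval is a finite set of consecutive integers, and its length is its cardinality. $\|\alpha\| := (\sum_m|\alpha_m|^2)^{1/2}$ and similarly for $\beta$. The hypothesis $\max(\mathcal{I}\cup\mathcal{J})\ll C^{O(1)}$ means $\max(\mathcal{I}\cup\mathcal{J})\le BC^B$ for some fixed constant $B$. The conclusion $X\ll C^{o(1)}Y$ means: for every $\varepsilon>0$ one has $|X|\le KC^{\varepsilon}Y$ with $K$ depending only on $\varepsilon$ and $B$. *)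

(* Defs.v *)
From HB Require Import structures.
From mathcomp Require Import all_boot all_order all_algebra.
From mathcomp Require Import complex.
From mathcomp Require Import reals exp trigo.

Set Implicit Arguments.
Unset Strict Implicit.
Unset Printing Implicit Defensive.

Import Order.TTheory GRing.Theory Num.Theory.
Local Open Scope ring_scope.
Local Open Scope complex_scope.

Section Defs.
Variable R : realType.

Definition e2pi (t : R) : R[i] := cos (2 * pi * t) +i* sin (2 * pi * t).

(* The norm `|z| of R[i] takes values in R[i]; this modulus takes values in R. *)
Definition cabs (z : R[i]) : R := ComplexField.Normc.normc z.

(* Only meaningful for 0 < c. The type 'Z_1 is 'I_2 with the single unit 1, so
   for c = 1 the sum still has one term, equal to 1, as it should. *)
Definition kloosterman (m n : int) (c : nat) : R[i] :=
  \sum_(x : 'Z_c | x \is a GRing.unit)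
    e2pi ((m%:~R * (x : nat)%:R + n%:~R * (x^-1 : nat)%:R) / c%:R).

Definition l2norm (s : seq nat) (a : nat -> R[i]) : R :=
  Num.sqrt (\sum_(m <- s) cabs (a m) ^+ 2).

End Defs.

(* A finite set of consecutive positive integers, listed in increasing order;
   its cardinality is [size s]. *)
Definition pos_interval (s : seq nat) : Prop :=
  exists2 a : nat, (0 < a)%N & s = iota a (size s).

Definition largest_square_root_divisor (f k : nat) : Prop :=
  (f ^ 2 %| k)%N /\ forall g : nat, (g ^ 2 %| k)%N -> (g <= f)%N.

(* Main.v *)
(** For a vector [(x, y)] over [Z/c] put [A(x, y) = \sum_m alpha_m e(m x / (c y))] when [y] is a
    unit, and let [B] be the function attached in the same way to [beta], with the two coordinates
    exchanged. Then [\sum_v A v * B v] is [totient c] times the bilinear form in the Kloosterman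
    sums [S(m, n; c)]. As [m] and [n] run over short intervals, [A] may be replaced, at bounded
    cost, by its average [T A] over the translates by [u_h l_{-k}], where [u_h], [l_k] are the
    elementary unipotent matrices, [h < H ~ c / M] and [k < K ~ c / N].

    Let [D] divide [c]. Primitive vectors [v] are lifted to pairs [(v, w)] with [D w = 0] and
    [det(v, w) = c / D], and [A] is expanded in the frequencies [a] of the shifts [v -> v + w].
    The torus acts on the pairs by [(v, w) -> (s v, s^-1 w)], and the translates of a single
    frequency component [F] are orthogonal as soon as they are distinct. This amplifies the bound
    given by the operator [T T^* T] and a Boas-Bellman inequality: [|T F|^6 <= |F|^6 * R], where
    [R] counts the solutions of [g z = t z] with [g] a word of length six in unipotents and [t] in
    the torus. Such a [g] is scalar modulo a divisor [i] of [c], and the words that are scalar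
    modulo [i] are counted by the divisor bound. If [b = gcd(a, D)] is large then [R] grows by at
    most [b^3], but the component has only [1 / b] of the energy when every prime of [b] is coprime
    to all [m] or to all [n] in the support.

    Writing [c = q k] and sorting [m], [n] by their gcds with [c], the first term of the minimum
    comes from [D = d] and the second one from [D = d k1], where [k = k1 k2] and [k1] is the part of
    [k] coprime to [gcd(m, n)]; the losses, a power of [k2] and the square divisors of [c / D],
    are small on average over [k]. *)

Require Import Defs.
From HB Require Import structures.
From mathcomp Require Import all_boot all_order all_algebra all_fingroup.
From mathcomp Require Import complex.
From mathcomp Require Import reals sequences exp trigo.
From mathcomp Require Import ring lra zify.

Set Implicit Arguments.
Unset Strict Implicit.
Unset Printing Implicit Defensive.

Import Order.TTheory GRing.Theory Num.Theory.

(** * Divisor bound and averages of multiplicative functions *)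

Definition tau n := size (divisors n).

Lemma tau_pfactor p e m : prime p -> coprime p m -> 0 < m -> tau (m * p ^ e) = tau m * e.+1.
Proof.
move=> pp pm m0; have pe0 : 0 < p ^ e by rewrite expn_gt0 prime_gt0.
have n0 : 0 < m * p ^ e by rewrite muln_gt0 m0.
pose s := [seq d * p ^ j | d <- divisors m, j <- iota 0 e.+1].
have -> : tau (m * p ^ e) = size s; last by rewrite size_allpairs size_iota.
apply: perm_size; apply: uniq_perm; first exact: divisors_uniq.
- apply: allpairs_uniq; rewrite ?divisors_uniq ?iota_uniq // => -[d j] [d' j'].
  move=> /allpairsP[[u v] [ud _ [-> ->]]] /allpairsP[[u' v'] [ud' _ [-> ->]]] /= e1.
  rewrite /= in ud ud'.
  have cop x : x \in divisors m -> coprime p x.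
    by rewrite -dvdn_divisors // => xm; apply: coprime_dvdr xm pm.
  have x0 x : x \in divisors m -> 0 < x by rewrite -dvdn_divisors // => /dvdn_gt0 ->.
  have vE : v = v'.
    have : logn p (u * p ^ v) = logn p (u' * p ^ v') by rewrite e1.
    have [u0 u0'] := (x0 _ ud, x0 _ ud').
    have pX k : 0 < p ^ k by rewrite expn_gt0 prime_gt0.
    rewrite !lognM ?pX // !pfactorK //.
    by rewrite !logn_coprime ?cop //.
  move: e1; rewrite vE => /eqP; rewrite eqn_pmul2r ?expn_gt0 ?prime_gt0 // => /eqP ->.
  by [].
move=> x; rewrite -dvdn_divisors //; apply/idP/allpairsP => [xd|[[d j] [dm +]]]; last first.
  rewrite mem_iota add0n ltnS /= => je ->; rewrite /= -dvdn_divisors // in dm.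
  by rewrite dvdn_mul // dvdn_exp2l.
have x0 : 0 < x by exact: dvdn_gt0 xd.
have [y py yE] := pfactor_coprime pp x0.
exists (y, logn p x); split => //=.
  have : y %| m * p ^ e by apply: dvdn_trans xd; rewrite yE dvdn_mulr.
  by rewrite Gauss_dvdl -?dvdn_divisors // coprimeXr // coprime_sym.
have : p ^ logn p x %| m * p ^ e by apply: dvdn_trans xd; rewrite {2}yE dvdn_mull.
rewrite Gauss_dvdr; last by rewrite coprimeXl.
by rewrite dvdn_Pexp2l ?prime_gt1 // -[0 :: _]/(iota 0 e.+1) mem_iota add0n ltnS.
Qed.

Lemma nat_pfactor_ind (P : nat -> Prop) : P 1 ->
  (forall p e m, prime p -> 0 < e -> coprime p m -> 0 < m -> P m -> P (m * p ^ e)) ->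
  forall n, 0 < n -> P n.
Proof.
move=> P1 PS; elim/ltn_ind => n IH n0.
have [n1|n1] := leqP n 1; first by rewrite (_ : n = 1) //; apply/eqP; rewrite eqn_leq n1 n0.
have pp := pdiv_prime n1; have pn := pdiv_dvd n.
have [m pm nE] := pfactor_coprime pp n0.
have e0 : 0 < logn (pdiv n) n by rewrite logn_gt0 mem_primes pp n0.
have m0 : 0 < m by move: n0; rewrite nE muln_gt0 => /andP[].
rewrite nE; apply: PS => //; apply: IH => //.
rewrite [X in _ < X]nE ltn_Pmulr // -(expn0 (pdiv n)) ltn_exp2l // prime_gt1 //.
Qed.

Lemma leq_totient_tau n : 0 < n -> n <= totient n * tau n.
Proof.
elim/nat_pfactor_ind => [|p e m pp e0 pm m0 IH] //.
rewrite tau_pfactor // totient_coprime; last by rewrite coprime_sym coprimeXl.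
rewrite totient_pfactor // -mulnA [X in _ <= _ * X]mulnCA mulnA; apply: leq_mul => //.
rewrite -{1}(prednK e0) expnS -mulnA [_ * e.+1]mulnC mulnA leq_mul2r; apply/orP; right.
apply: (@leq_trans (p.-1 * 2)); last by rewrite leq_mul2l ltnS e0 orbT.
by move: (prime_gt1 pp); case: (p) => [|[|q]] //= _; lia.
Qed.

Lemma leq_pow2_tau n : 0 < n -> 2 ^ size (primes n) <= tau n.
Proof.
elim/nat_pfactor_ind => [|p e m pp e0 pm m0 IH] //.
have -> : size (primes (m * p ^ e)) = (size (primes m)).+1.
  rewrite -[RHS]/(size (p :: primes m)); apply: perm_size; apply: uniq_perm.
  - exact: primes_uniq.
  - by rewrite /= primes_uniq andbT mem_primes pp m0 /= -prime_coprime.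
  move=> q; have pe : 0 < p ^ e by rewrite expn_gt0 prime_gt0.
  rewrite primesM // primesX // inE.
  by rewrite (primes_prime pp) mem_seq1 orbC.
by rewrite tau_pfactor // expnSr leq_mul.
Qed.

Local Open Scope ring_scope.

Section DivisorBound.
Variable R : realType.

Lemma natS_le_pow2 e : (e.+1 <= 2 ^ e)%N.
Proof. by rewrite ltn_expl. Qed.

Lemma divisor_bound (eps : R) : 0 < eps ->
  exists2 K : R, 1 <= K & forall n, (0 < n)%N -> (tau n)%:R <= K * n%:R `^ eps.
Proof.
move=> e0; have l2 : 0 < ln 2 :> R by rewrite ln_gt0 // ltr1n.
pose C0 : R := 1 + (eps * ln 2)^-1.
have el0 : 0 < eps * ln 2 by rewrite mulr_gt0.
have C01 : 1 <= C0 by rewrite lerDl invr_ge0 ltW.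
pose P0 := (Num.truncn (expR (ln 2 / eps))).+1.
have step p e : prime p -> (e.+1)%:R <= (if (p < P0)%N then C0 else 1) * ((p ^ e)%:R `^ eps) :> R.
  move=> pp; have p0 : (0 : R) < p%:R by rewrite ltr0n prime_gt0.
  have pe0 : (0 : R) < (p ^ e)%:R by rewrite ltr0n expn_gt0 prime_gt0.
  have -> : (p ^ e)%:R `^ eps = expR (e%:R * (eps * ln p%:R)).
    by rewrite /powR gt_eqF // natrX lnXn // -mulr_natl; congr expR; ring.
  have lp : ln 2 <= ln p%:R :> R by rewrite ler_ln ?posrE // ?ler_nat ?prime_gt1 // ltr0n.
  case: ltnP => hp.
    apply: (@le_trans _ _ (C0 * (1 + e%:R * (eps * ln 2)))).
      rewrite -natr1 /C0; move: (eps * ln 2) el0 => x x0.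
      have -> : (1 + x^-1) * (1 + e%:R * x) = e%:R + 1 + (e%:R * x + x^-1) by field; rewrite gt_eqF.
      by rewrite lerDl addr_ge0 ?mulr_ge0 ?invr_ge0 // ltW.
    rewrite ler_wpM2l ?(le_trans ler01) //.
    by apply: le_trans (expR_ge1Dx _) _; rewrite ler_expR ler_wpM2l // ler_wpM2l // ltW.
  rewrite mul1r; apply: (@le_trans _ _ ((2 ^ e)%:R)); first by rewrite ler_nat natS_le_pow2.
  have -> : (2 ^ e)%:R = expR (e%:R * ln 2) :> R.
    by rewrite natrX -[X in X ^+ _ = _]lnK ?posrE // -expRM_natl mulr_natl.
  rewrite ler_expR ler_wpM2l // -ler_pdivrMl // mulrC.
  rewrite -[X in X <= _]expRK ler_ln ?posrE ?expR_gt0 //.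
  apply: ltW; apply: lt_le_trans (truncnS_gt _) _; by rewrite ler_nat.
pose L n : R := \prod_(q < P0 | prime q && (q %| n)%N) C0.
exists (C0 ^+ P0); first exact: exprn_ege1.
have main n : (0 < n)%N -> (tau n)%:R <= L n * n%:R `^ eps.
  elim/nat_pfactor_ind => [|p e m pp ep pm m0 IH].
    rewrite powR1 mulr1 /L big_pred0 // => q.
    by rewrite dvdn1; case: eqP => [->|_]; rewrite ?andbF.
  rewrite tau_pfactor // natrM.
  have -> : (m * p ^ e)%:R `^ eps = m%:R `^ eps * (p ^ e)%:R `^ eps by rewrite natrM powRM.
  have -> : L (m * p ^ e)%N = L m * (if (p < P0)%N then C0 else 1).
    rewrite /L big_mkcond [in RHS]big_mkcond /=.
    have same (q : 'I_P0) : (q : nat) != p ->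
        prime q && (q %| m * p ^ e)%N = prime q && (q %| m)%N.
      move=> qp; case: (boolP (prime q)) => //= pq.
      by rewrite Euclid_dvdM // Euclid_dvdX // ep andbT (dvdn_prime2 pq pp) (negbTE qp) orbF.
    have pNm : (p %| m)%N = false by apply/negbTE; rewrite -prime_coprime.
    case: ltnP => hp; last first.
      rewrite mulr1; apply: eq_bigr => q _; rewrite same //.
      by apply: contraTneq (ltn_ord q) => ->; rewrite -leqNgt.
    rewrite (bigD1 (Ordinal hp)) //= [in RHS](bigD1 (Ordinal hp)) //=.
    rewrite pp pNm /= dvdn_mull ?dvdn_exp // mul1r mulrC; congr (_ * _).
    by apply: eq_bigr => q qp; rewrite same.
  rewrite mulrACA; apply: ler_pM => //; exact: step.
move=> n n0; apply: le_trans (main n n0) _.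
rewrite ler_wpM2r ?powR_ge0 //.
rewrite -[X in _ <= _ ^+ X]card_ord -prodr_const /L big_mkcond /=.
by apply: ler_prod => q _; case: ifP => _; rewrite ?lexx ?ler01 ?andbT ?(le_trans ler01).
Qed.
End DivisorBound.

Section Averages.
Variable R : realType.

Lemma sum_dvdn_le (N j : nat) (g : R) : (0 < j)%N -> 0 <= g ->
  \sum_(1 <= k < N.+1 | (j %| k)%N) g <= N%:R / j%:R * g.
Proof.
move=> j0 g0.
have h : (\sum_(1 <= k < N.+1 | (j %| k)%N) 1 <= N %/ j)%N.
  elim: N => [|N IH]; first by rewrite big_geq.
  rewrite big_mkcond big_nat_recr //= -big_mkcond /=.
  case: ifP => jN; last by rewrite addn0 (leq_trans IH) // leq_div2r.
  rewrite addn1 (leq_ltn_trans IH) //.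
  by move/dvdnP: jN => [t e]; rewrite e mulnK // ltn_divLR // -e.
rewrite big_const_seq iter_addr_0 -[X in X <= _]mulr_natl ler_wpM2r //.
rewrite ler_pdivlMr ?ltr0n // -natrM ler_nat.
apply: leq_trans (leq_divM N j); rewrite leq_mul2r; apply/orP; right.
by apply: leq_trans h; rewrite sum1_count.
Qed.

Lemma sum_inv_sqrt3 (N : nat) :
  \sum_(1 <= x < N.+1) (x%:R * Num.sqrt x%:R)^-1 <= 3 :> R.
Proof.
case: N => [|N]; first by rewrite big_geq.
suff h : \sum_(1 <= x < N.+2) (x%:R * Num.sqrt x%:R)^-1 <= 3 - 2 / Num.sqrt N.+1%:R :> R.
  by apply: le_trans h _; rewrite gerBl divr_ge0 // sqrtr_ge0.
elim: N => [|N IH]; first by rewrite big_nat1 sqrtr1; lra.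
rewrite big_nat_recr //=; apply: le_trans (lerD IH (lexx _)) _.
set a : R := Num.sqrt N.+1%:R; set b : R := Num.sqrt N.+2%:R.
have a0 : 0 < a by rewrite sqrtr_gt0 ltr0n.
have b0 : 0 < b by rewrite sqrtr_gt0 ltr0n.
have aE : a ^+ 2 = N.+1%:R by rewrite sqr_sqrtr.
have bE : b ^+ 2 = N.+2%:R by rewrite sqr_sqrtr.
have ab : b ^+ 2 = a ^+ 2 + 1 by rewrite aE bE natr1.
have aleb : a <= b by rewrite ler_sqrt ?ler_nat // ltr0n.
rewrite -bE; have -> : (b ^+ 2 * b)^-1 = 2 / a - 2 / b - ((2 * b ^+ 2) * (b - a) - a) / (a * b ^+ 3).
  by field; rewrite !gt_eqF.
have h : 0 <= ((2 * b ^+ 2) * (b - a) - a) / (a * b ^+ 3).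
  apply: divr_ge0; last exact: mulr_ge0 (ltW a0) (exprn_ge0 3 (ltW b0)).
  rewrite subr_ge0.
  have bma : (b - a) * (b + a) = 1 by rewrite -subr_sqr ab addrAC subrr add0r.
  have ba0 : 0 < b + a by rewrite addr_gt0.
  rewrite -(ler_pM2r ba0) (_ : 2 * b ^+ 2 * (b - a) * (b + a) = 2 * b ^+ 2); last first.
    by rewrite -[LHS]mulrA bma mulr1.
  have := ler_pM (ltW a0) (ltW a0) aleb aleb.
  have := ler_wpM2r (ltW b0) aleb.
  by rewrite mulrDr expr2; lra.
by lra.
Qed.

Lemma sum_dvdn_reindex (N j : nat) (G : nat -> R) : (0 < j)%N ->
  \sum_(1 <= k < N.+1 | (j %| k)%N) G k = \sum_(1 <= k < (N %/ j).+1) G (j * k)%N.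
Proof.
move=> j0; elim: N => [|N IH]; first by rewrite div0n !big_geq.
rewrite big_mkcond big_nat_recr //= -big_mkcond /= IH divnS //.
case: ifP => jN; last by rewrite addr0.
rewrite add1n [in RHS]big_nat_recr //=; congr (_ + G _).
by have := divnK jN; rewrite divnS // jN add1n mulnC.
Qed.

Lemma partn_cons p (ps : seq nat) k : (0 < k)%N -> prime p -> p \notin ps ->
  (k`_[pred q | q \in p :: ps] = p ^ logn p k * k`_[pred q | q \in ps])%N.
Proof.
move=> k0 pp pps; rewrite -[LHS](partnC p) ?part_gt0 // -!partnI; congr (_ * _)%N.
  rewrite -p_part; apply: eq_partn => q; rewrite !inE /=.
  by case: eqP => [->|_]; rewrite ?andbF.
apply: eq_partn => q; rewrite !inE; case: eqP => [->|_] /=; rewrite ?andbT //.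
by rewrite (negbTE pps).
Qed.

Lemma sum_sqrt_partn (ps : seq nat) (N : nat) : all prime ps -> uniq ps ->
  \sum_(1 <= k < N.+1) Num.sqrt (k`_[pred q | q \in ps])%:R <= 4 ^+ size ps * N%:R :> R.
Proof.
elim: ps N => [|p ps IH] N.
  move=> _ _; rewrite (eq_big_nat _ _ (F2 := fun=> 1)) => [|k /andP[k0 _]].
    by rewrite big_const_nat iter_addr_0 subSS subn0 expr0 mul1r.
  by rewrite part_p'nat ?sqrtr1 //; apply/pnatP => // q _ _; rewrite !inE.
move=> /= /andP[pp aps] /andP[pps ups].
have p0 := prime_gt0 pp; have pv0 v : (0 < p ^ v)%N by rewrite expn_gt0 p0.
apply: (@le_trans _ _ (\sum_(1 <= k < N.+1) \sum_(v < N.+1)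
   (if (p ^ v %| k)%N then Num.sqrt (p ^ v)%:R * Num.sqrt (k`_[pred q | q \in ps])%:R else 0))).
  rewrite big_nat [X in _ <= X]big_nat; apply: ler_sum => k /andP[k0 kN].
  have lk : (logn p k < N.+1)%N by rewrite ltnS (leq_trans (ltnW (ltn_logl _ k0))).
  rewrite (bigD1 (Ordinal lk)) //= pfactor_dvdnn partn_cons // natrM sqrtrM ?ler0n // lerDl.
  by apply: sumr_ge0 => v _; case: ifP => // _; rewrite mulr_ge0 ?sqrtr_ge0.
rewrite exchange_big /=.
apply: (@le_trans _ _ (\sum_(v < N.+1) 4 ^+ size ps * N%:R * (Num.sqrt p%:R)^-1 ^+ v)).
  apply: ler_sum => v _; rewrite -big_mkcond sum_dvdn_reindex //= -mulr_sumr.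
  rewrite (eq_big_nat _ _ (F2 := fun k => Num.sqrt (k`_[pred q | q \in ps])%:R)) => [|k /andP[k0 _]]; last first.
    by rewrite partnM // [X in (X * _)%N]part_p'nat ?mul1n // pnatX pnatE // !inE pps.
  apply: le_trans (ler_wpM2l (sqrtr_ge0 _) (IH _ aps ups)) _.
  have spv : Num.sqrt (p ^ v)%:R = Num.sqrt p%:R ^+ v :> R.
    by rewrite natrX; elim: (v : nat) => [|u IHu]; rewrite ?sqrtr1 // !exprS sqrtrM ?ler0n ?IHu.
  have sp0 : Num.sqrt p%:R != 0 :> R by rewrite gt_eqF // sqrtr_gt0 ltr0n.
  have pvE : (p ^ v)%:R = (Num.sqrt p%:R ^+ v) ^+ 2 :> R by rewrite -exprM mulnC exprM sqr_sqrtr // natrX.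
  have Ndiv : (N %/ p ^ v)%:R <= N%:R / (p ^ v)%:R :> R.
    by rewrite ler_pdivlMr ?ltr0n // -natrM ler_nat leq_divM.
  rewrite spv mulrCA -mulrA ler_wpM2l ?exprn_ge0 //.
  apply: le_trans (ler_wpM2l (exprn_ge0 v (sqrtr_ge0 _)) Ndiv) _.
  rewrite pvE le_eqVlt; apply/orP; left; apply/eqP.
  by rewrite exprVn; field; rewrite expf_neq0.
rewrite -mulr_sumr exprS (_ : 4 * 4 ^+ size ps * N%:R = 4 ^+ size ps * N%:R * 4); last by ring.
rewrite ler_wpM2l ?mulr_ge0 ?exprn_ge0 //.
set x := (Num.sqrt p%:R)^-1.
have sp : 4 / 3 <= Num.sqrt p%:R :> R.
  have -> : 4 / 3 = Num.sqrt ((4 / 3) ^+ 2) :> R by rewrite sqrtr_sqr ger0_norm //; lra.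
  rewrite ler_sqrt ?ler0n //; apply: (@le_trans _ _ 2%:R); first by lra.
  by rewrite ler_nat prime_gt1.
have x0 : 0 <= x by rewrite invr_ge0 sqrtr_ge0.
have x1 : x <= 3 / 4.
  rewrite -[3 / 4]invrK lef_pV2 ?posrE ?invr_gt0; [|lra|lra].
  by apply: le_trans sp; lra.
have g (n : nat) : \sum_(v < n) x ^+ v <= 4 - 4 * x ^+ n.
  elim: n => [|n IHn]; first by rewrite big_ord0 expr0; lra.
  rewrite big_ord_recr /= exprS; apply: le_trans (lerD IHn (lexx _)) _.
  have : 0 <= x ^+ n * (3 - 4 * x) by rewrite mulr_ge0 ?exprn_ge0 //; lra.
  by nra.
by apply: le_trans (g _) _; rewrite gerBl mulr_ge0 // exprn_ge0.
Qed.
End Averages.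

Local Open Scope ring_scope.

(** * Counting words in unipotent matrices modulo [m] *)

Section Counting.
Variable R : realType.

Lemma count_congr (L mu : nat) (P : pred nat) : (0 < mu)%N ->
  (forall x y, (x < L)%N -> (y < L)%N -> P x -> P y -> (mu%:Z %| x%:Z - y%:Z)%Z) ->
  (\sum_(x < L) (P x)%:R : R) <= L%:R / mu%:R + 1.
Proof.
move=> mu0 hP.
apply: (@le_trans _ _ ((L %/ mu).+1%:R)); last first.
  rewrite -natr1 lerD2r ler_pdivlMr ?ltr0n // -natrM ler_nat; exact: leq_divM.
rewrite -natr_sum ler_nat.
have -> : (\sum_(x < L) P x = size (filter P (iota 0 L)))%N.
  by rewrite -(big_mkord xpredT (fun x => nat_of_bool (P x))) size_filter -sum1_count [RHS]big_mkcond /index_iota subn0; apply: eq_bigr => x _; case: (P x).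
rewrite -(size_map (fun x => x %/ mu)%N) -[X in (_ <= X)%N](size_iota 0).
apply: uniq_leq_size => [|_ /mapP[x + ->]]; last first.
  rewrite mem_filter !mem_iota !add0n /= => /andP[_ xL].
  by rewrite ltnS leq_div2r // ltnW.
rewrite map_inj_in_uniq ?filter_uniq ?iota_uniq // => x y.
rewrite !mem_filter !mem_iota !add0n /= => /andP[px xL] /andP[py yL] e.
have := hP _ _ xL yL px py.
have {e} : (x %/ mu = y %/ mu)%N := e.
rewrite -eqz_mod_dvd !modz_nat eqz_nat => e /eqP e'.
by rewrite (divn_eq x mu) (divn_eq y mu) e e'.
Qed.

Lemma count_abs (H s d : nat) : (\sum_(x < H) (`|x%:Z - s%:Z|%N == d)%:R : R) <= 2.
Proof.
have h (P : pred nat) : (forall x y, P x -> P y -> x = y) -> (\sum_(x < H) (P x)%:R : R) <= 1.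
  move=> hP; have [x px|no] := pickP (fun x : 'I_H => P x); last first.
    by rewrite big1 ?ler01 // => x _; rewrite no.
  rewrite (bigD1 x) //= px big1 ?addr0 // => y yx.
  case: (boolP (P y)) => // py; case/eqP: yx; apply: val_inj; exact: hP py px.
apply: (@le_trans _ _ (\sum_(x < H) ((nat_of_ord x == s + d)%N%:R + (x + d == s)%N%:R : R))).
  apply: ler_sum => x _; rewrite -natrD ler_nat.
  by case: eqP => // e; have [|] : (x = s + d :> nat \/ x + d = s)%N; [lia|move=> ->; rewrite eqxx leq_addr|move=> ->; rewrite eqxx leq_addl].
rewrite big_split /= (_ : 2 = 1 + 1 :> R) //; apply: lerD.
  by apply: (h (fun x => x == s + d)%N) => x y /eqP -> /eqP ->.
by apply: (h (fun x => x + d == s)%N) => x y /eqP e /eqP e'; lia.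
Qed.

Lemma count_mul (H K s t : nat) (n : int) (T : R) : n != 0 ->
  (size (divisors `|n|))%:R <= T ->
  (\sum_(x < H) \sum_(y < K) ((x%:Z - s%:Z) * (y%:Z - t%:Z) == n)%:R : R) <= 2 * T.
Proof.
move=> n0 hT; have n0' : (0 < `|n|)%N by rewrite absz_gt0.
apply: (@le_trans _ _ (\sum_(x < H) (`|x%:Z - s%:Z|%N \in divisors `|n|)%:R)).
  apply: ler_sum => x _.
  have [dx|ndx] := boolP (_ \in divisors _); last first.
    rewrite big1 // => y _; case: eqP => // e; case/negP: ndx.
    by rewrite -dvdn_divisors // -e abszM dvdn_mulr.
  have xn0 : x%:Z - s%:Z != 0.
    by move: dx; rewrite -dvdn_divisors //; apply: contraTneq => ->; rewrite dvd0n -lt0n.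
  have [y py|no] := pickP (fun y : 'I_K => (x%:Z - s%:Z) * (y%:Z - t%:Z) == n); last first.
    by rewrite big1 ?ler01 // => y _; rewrite no.
  rewrite (bigD1 y) //= py big1 ?addr0 // => z zy.
  case: eqP => // e; case/eqP: zy; apply: val_inj => /=.
  move: (eqP py); rewrite -e => /(mulfI xn0); lia.
apply: (@le_trans _ _ (\sum_(x < H) \sum_(d <- divisors `|n|) (`|x%:Z - s%:Z|%N == d)%:R)).
  apply: ler_sum => x _; case: (boolP (_ \in _)) => [dx|_]; last exact: sumr_ge0.
  rewrite (bigD1_seq _ dx (divisors_uniq _)) /= eqxx lerDl; exact: sumr_ge0.
rewrite exchange_big /=.
apply: (@le_trans _ _ (\sum_(d <- divisors `|n|) 2)).
  by apply: ler_sum => d _; exact: count_abs.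
have -> : \sum_(d <- divisors `|n|) (2 : R) = 2 * (size (divisors `|n|))%:R.
  by rewrite big_const_seq count_predT iter_addr_0 mulr_natr.
by rewrite ler_wpM2l.
Qed.

Lemma count_mul_congr (H K s t mu : nat) (v : int) (T : R) : (0 < mu)%N -> (s < H)%N -> (t < K)%N ->
  (forall n, (0 < n <= H * K)%N -> (size (divisors n))%:R <= T) ->
  (\sum_(x < H) \sum_(y < K) (((x%:Z - s%:Z) * (y%:Z - t%:Z) != 0) &&
     (mu%:Z %| (x%:Z - s%:Z) * (y%:Z - t%:Z) - v)%Z)%:R : R) <=
  4 * T * (H%:R * K%:R / mu%:R + 1).
Proof.
move=> mu0 sH tK hT.
have HK0 : (0 < H * K)%N by rewrite muln_gt0 (leq_ltn_trans _ sH) ?(leq_ltn_trans _ tK).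
have T0 : 0 <= T by apply: le_trans (hT (H * K)%N _); rewrite ?ler0n // HK0 leqnn.
pose P (j : nat) := (j%:Z - (H * K)%:Z != 0) && (mu%:Z %| j%:Z - (H * K)%:Z - v)%Z.
apply: (@le_trans _ _ (\sum_(x < H) \sum_(y < K) \sum_(j < (H * K).*2)
   (P j)%:R * ((x%:Z - s%:Z) * (y%:Z - t%:Z) == j%:Z - (H * K)%:Z)%:R)).
  apply: ler_sum => x _; apply: ler_sum => y _.
  case: (boolP (_ && _)) => [/andP[h1 h2]|_]; last by apply: sumr_ge0 => j _; rewrite mulr_ge0.
  have hb : (`|((x%:Z - s%:Z) * (y%:Z - t%:Z))%R| < H * K)%N.
    by rewrite abszM; apply: ltn_mul; have := ltn_ord x; have := ltn_ord y; lia.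
  have jP : (absz ((x%:Z - s%:Z) * (y%:Z - t%:Z) + (H * K)%:Z)%R < (H * K).*2)%N.
    by move: hb; move: (_ * _)%R (H * K)%N => w p; lia.
  pose j := Ordinal jP.
  have je : (j : nat)%:Z - (H * K)%:Z = (x%:Z - s%:Z) * (y%:Z - t%:Z).
    by move: hb; rewrite /=; move: (_ * _)%R (H * K)%N => w p; lia.
  rewrite (bigD1 j) //= je eqxx mulr1 /P je h1 h2 lerDl.
  by apply: sumr_ge0 => i _; rewrite mulr_ge0.
under eq_bigr do rewrite exchange_big /=.
rewrite exchange_big /=.
apply: (@le_trans _ _ (\sum_(j < (H * K).*2) (P j)%:R * (2 * T))).
  apply: ler_sum => j _; under eq_bigr do rewrite -mulr_sumr.
  rewrite -mulr_sumr; have [pj|_] := boolP (P j); last by rewrite !mul0r.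
  rewrite !mul1r; apply: count_mul; first by case/andP: pj.
  by apply: hT; have := ltn_ord j; case/andP: pj; lia.
rewrite -mulr_suml.
have hc := @count_congr (H * K).*2 mu P mu0.
apply: le_trans (ler_wpM2r _ (hc _)) _; first by rewrite mulr_ge0.
  move=> i j _ _ /andP[_ h1] /andP[_ h2].
  have -> : i%:Z - j%:Z = (i%:Z - (H * K)%:Z - v) - (j%:Z - (H * K)%:Z - v) by ring.
  exact: rpredB.
have mu0R : (0 : R) < mu%:R by rewrite ltr0n.
rewrite -muln2 !natrM.
have -> : (H%:R * K%:R * 2 / mu%:R + 1) * (2 * T) = 4 * T * (H%:R * K%:R / mu%:R) + 2 * T by ring.
by rewrite [X in _ <= X]mulrDr lerD2l mulr1 ler_wpM2r // ler_nat.
Qed.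

Lemma count_mul_zero (H K s t : nat) : (s < H)%N -> (t < K)%N ->
  (\sum_(x < H) \sum_(y < K) ((x%:Z - s%:Z) * (y%:Z - t%:Z) == 0)%:R : R) <= H%:R + K%:R.
Proof.
move=> sH tK.
apply: (@le_trans _ _ (\sum_(x < H) \sum_(y < K) ((x == Ordinal sH)%:R + (y == Ordinal tK)%:R))).
  apply: ler_sum => x _; apply: ler_sum => y _; rewrite -natrD ler_nat mulf_eq0.
  rewrite -!(inj_eq val_inj) /= !subr_eq0 !eqz_nat.
  by case: eqP; case: eqP.
under eq_bigr do rewrite big_split /=.
rewrite big_split /= addrC; apply: lerD.
  rewrite (eq_bigr (fun=> 1)) ?sumr_const ?card_ord // => x _.
  rewrite (bigD1 (Ordinal tK)) //= eqxx big1 ?addr0 // => y /negPf.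
  by move=> h; rewrite -(inj_eq val_inj) /= in h *; rewrite h.
rewrite exchange_big /= (eq_bigr (fun=> 1)) ?sumr_const ?card_ord // => y _.
rewrite (bigD1 (Ordinal sH)) //= eqxx big1 ?addr0 // => x /negPf.
by move=> h; rewrite h.
Qed.
End Counting.

(* Entrywise form of [u(h1) l(k1) u(h2) = a * (l(k2) u(h3) l(k3))^-1] modulo [m]. *)
Definition word_scalar (m : nat) (a h1 k1 h2 k2 h3 k3 : int) : bool :=
  [&& (m%:Z %| (1 + h1 * k1) - a * (1 + h3 * k2))%Z,
      (m%:Z %| (1 + k1 * h2) - a * (1 + h3 * k3))%Z,
      (m%:Z %| h1 + h2 * (1 + h1 * k1) + a * h3)%Z &
      (m%:Z %| k1 + a * (k2 + k3 * (1 + h3 * k2)))%Z].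

Section CountWords.
Variable R : realType.

Lemma word_poly_bound (h k u : R) : 1 <= h -> h <= k -> 0 < u -> u <= 1 ->
  (k * u + 1) * (h * u + 1) * (32 * (h * k * (h * k * u + 1)) + 4 * k ^+ 2) <=
  300 * (k ^+ 2 + h * k ^+ 3 * u + h ^+ 3 * k ^+ 3 * u ^+ 3).
Proof.
move=> h1 hk u0 u1.
have h0 : 0 <= h by lra. have k0 : 0 <= k by lra. have k1 : 1 <= k by lra.
set X := k ^+ 2 + h * k ^+ 3 * u + h ^+ 3 * k ^+ 3 * u ^+ 3.
have p3 : 0 <= h ^+ 3 * k ^+ 3 * u ^+ 3 by rewrite !mulr_ge0 ?exprn_ge0 // ltW.
have p2 : 0 <= h * k ^+ 3 * u by rewrite !mulr_ge0 ?exprn_ge0 // ltW.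
have p1 : 0 <= k ^+ 2 by rewrite exprn_ge0.
have u0' := ltW u0.
have b1 : k ^+ 3 * u <= h * k ^+ 3 * u.
  rewrite -subr_ge0 (_ : _ - _ = (h - 1) * k ^+ 3 * u); last by ring.
  by rewrite ?mulr_ge0 ?exprn_ge0 ?subr_ge0.
have b2 : h * k ^+ 2 * u <= h * k ^+ 3 * u.
  rewrite -subr_ge0 (_ : _ - _ = h * k ^+ 2 * u * (k - 1)); last by ring.
  by rewrite ?mulr_ge0 ?exprn_ge0 ?subr_ge0.
have b3 : h * k ^+ 3 * u ^+ 2 <= h * k ^+ 3 * u.
  rewrite -subr_ge0 (_ : _ - _ = h * k ^+ 3 * u * (1 - u)); last by ring.
  by rewrite ?mulr_ge0 ?exprn_ge0 ?subr_ge0.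
have b4 : h * k <= k ^+ 2.
  rewrite -subr_ge0 (_ : _ - _ = k * (k - h)); last by ring.
  by rewrite ?mulr_ge0 ?exprn_ge0 ?subr_ge0.
have b5 : h ^+ 2 * k * u <= h * k ^+ 2 * u.
  rewrite -subr_ge0 (_ : _ - _ = h * k * u * (k - h)); last by ring.
  by rewrite ?mulr_ge0 ?exprn_ge0 ?subr_ge0.
have b6 : h ^+ 2 * k ^+ 2 * u <= h * k ^+ 3 * u.
  rewrite -subr_ge0 (_ : _ - _ = h * k ^+ 2 * u * (k - h)); last by ring.
  by rewrite ?mulr_ge0 ?exprn_ge0 ?subr_ge0.
have b7 : h ^+ 2 * k ^+ 2 * u ^+ 2 <= h ^+ 2 * k ^+ 2 * u.
  rewrite -subr_ge0 (_ : _ - _ = h ^+ 2 * k ^+ 2 * u * (1 - u)); last by ring.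
  by rewrite ?mulr_ge0 ?exprn_ge0 ?subr_ge0.
have b8 : h ^+ 2 * k ^+ 3 * u ^+ 2 <= X.
  have : 0 <= h * k ^+ 3 * u * (h * u - 1) ^+ 2 by rewrite mulr_ge0 ?sqr_ge0.
  have -> : h * k ^+ 3 * u * (h * u - 1) ^+ 2 = h ^+ 3 * k ^+ 3 * u ^+ 3 + h * k ^+ 3 * u
     - 2 * (h ^+ 2 * k ^+ 3 * u ^+ 2) by ring.
  by rewrite /X; lra.
have b9 : h ^+ 3 * k ^+ 2 * u ^+ 2 <= h ^+ 2 * k ^+ 3 * u ^+ 2.
  rewrite -subr_ge0 (_ : _ - _ = h ^+ 2 * k ^+ 2 * u ^+ 2 * (k - h)); last by ring.
  by rewrite ?mulr_ge0 ?exprn_ge0 ?subr_ge0.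
have -> : (k * u + 1) * (h * u + 1) * (32 * (h * k * (h * k * u + 1)) + 4 * k ^+ 2) =
  32 * (h ^+ 3 * k ^+ 3 * u ^+ 3 + h ^+ 2 * k ^+ 3 * u ^+ 2 + h ^+ 3 * k ^+ 2 * u ^+ 2
        + h ^+ 2 * k ^+ 2 * u)
  + 32 * (h ^+ 2 * k ^+ 2 * u ^+ 2 + h * k ^+ 2 * u + h ^+ 2 * k * u + h * k)
  + 4 * (h * k ^+ 3 * u ^+ 2 + k ^+ 3 * u + h * k ^+ 2 * u + k ^+ 2) by ring.
by rewrite /X in b8 *; lra.
Qed.

Variables (H K m : nat) (a : int) (T : R).
Hypotheses (HK : (H <= K)%N) (m0 : (0 < m)%N) (am : (m%:Z %| a ^+ 2 - 1)%Z).
Hypothesis hT : forall n, (0 < n <= H * K)%N -> (size (divisors n))%:R <= T.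
Hypothesis hTm : (size (divisors m))%:R <= T.

Let T1 : 1 <= T.
Proof.
apply: le_trans hTm; rewrite ler1n; case: (divisors m) (divisors_id m0) => //.
Qed.

Let T0 : 0 <= T. Proof. exact: le_trans ler01 T1. Qed.

Let mR : (0 : R) < m%:R. Proof. by rewrite ltr0n. Qed.

Let dvd_unit (n : int) : (m%:Z %| a * n)%Z -> (m%:Z %| n)%Z.
Proof.
move=> h; have -> : n = a * (a * n) - (a ^+ 2 - 1) * n by ring.
by apply: rpredB; [exact: dvdz_mull|exact: dvdz_mulr].
Qed.

Let inner_count (s2 t3 : nat) (h1 k1 h3 k2 : int) :
  \sum_(x2 < H) \sum_(y3 < K) (word_scalar m a h1 k1 (x2%:Z - s2%:Z) k2 h3 (y3%:Z - t3%:Z))%:R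
  <= (m%:Z %| (1 + h1 * k1) - a * (1 + h3 * k2))%Z%:R *
     ((H%:R * (gcdn (absz (1 + h1 * k1)%R) m)%:R / m%:R + 1) * (K%:R / m%:R + 1) : R).
Proof.
rewrite /word_scalar; case: (boolP (m%:Z %| _ - a * (1 + h3 * k2))%Z) => [e1|_] /=; last first.
  by rewrite mul0r big1 // => x _; rewrite big1.
rewrite mul1r; set d := gcdn _ m.
have d0 : (0 < d)%N by rewrite gcdn_gt0 m0 orbT.
have dm : (d %| m)%N by exact: dvdn_gcdr.
have md0 : (0 < m %/ d)%N by rewrite divn_gt0 // dvdn_leq.
pose P2 (x2 : nat) := (m%:Z %| h1 + (x2%:Z - s2%:Z) * (1 + h1 * k1) + a * h3)%Z.
apply: (@le_trans _ _ (\sum_(x2 < H) (P2 x2)%:R * (K%:R / m%:R + 1))).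
  apply: ler_sum => x2 _.
  rewrite -/(P2 x2); have [p2|_] := boolP (P2 x2); last first.
    by rewrite mul0r big1 // => y _; rewrite andbF.
  rewrite mul1r; apply: (count_congr _ m0
   (P := fun y3 => (m%:Z %| 1 + k1 * (x2%:Z - s2%:Z) - a * (1 + h3 * (y3%:Z - t3%:Z)))%Z &&
    (m%:Z %| k1 + a * (k2 + (y3%:Z - t3%:Z) * (1 + h3 * k2)))%Z)).
  move=> x y _ _ /andP[ex fx] /andP[ey fy]; apply: dvd_unit.
  have -> : a * (x%:Z - y%:Z) =
    (k1 + a * (k2 + (x%:Z - t3%:Z) * (1 + h3 * k2))) - (k1 + a * (k2 + (y%:Z - t3%:Z) * (1 + h3 * k2)))
    + k2 * ((1 + k1 * (x2%:Z - s2%:Z) - a * (1 + h3 * (x%:Z - t3%:Z)))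
            - (1 + k1 * (x2%:Z - s2%:Z) - a * (1 + h3 * (y%:Z - t3%:Z)))) by ring.
  by apply: rpredD; [exact: rpredB|apply: dvdz_mull; exact: rpredB].
rewrite -mulr_suml ler_wpM2r // ?addr_ge0 ?divr_ge0 //.
have -> : H%:R * d%:R / m%:R = H%:R / (m %/ d)%:R :> R.
  have mE : (m%:R : R) = (m %/ d)%:R * d%:R by rewrite -natrM divnK.
  have dn0 : (d%:R : R) != 0 by rewrite pnatr_eq0 -lt0n.
  have mn0 : ((m %/ d)%:R : R) != 0 by rewrite pnatr_eq0 -lt0n.
  by rewrite mE; field; rewrite dn0 mn0.
apply: count_congr => // x y _ _ px py.
have h : (m%:Z %| (1 + h1 * k1) * (x%:Z - y%:Z))%Z.
  have -> : (1 + h1 * k1) * (x%:Z - y%:Z) = (h1 + (x%:Z - s2%:Z) * (1 + h1 * k1) + a * h3)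
    - (h1 + (y%:Z - s2%:Z) * (1 + h1 * k1) + a * h3) by ring.
  exact: rpredB.
move: h; rewrite !dvdzE abszM /=.
have -> : absz (1 + h1 * k1)%R = (absz (1 + h1 * k1)%R %/ d * d)%N by rewrite divnK // dvdn_gcdl.
rewrite -{1}(divnK dm) mulnAC dvdn_pmul2r // Gauss_dvdr //.
by rewrite coprime_sym /coprime -(eqn_pmul2r d0) muln_gcdl !divnK ?dvdn_gcdl // mul1n.
Qed.

(* The second factor counts solutions with [h3 k2 <> 0] by the divisor bound; when
   [h3 k2 = 0] the first congruence forces [1 + h1 k1] to be a unit modulo [m]. *)
Let outer_count (s3 t2 : nat) (h1 k1 : int) : (s3 < H)%N -> (t2 < K)%N ->
  \sum_(x3 < H) \sum_(y2 < K)
    (m%:Z %| (1 + h1 * k1) - a * (1 + (x3%:Z - s3%:Z) * (y2%:Z - t2%:Z)))%Z%:R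
  <= 4 * T * (H%:R * K%:R / m%:R + 1)
     + (m%:Z %| h1 * k1 - (a - 1))%Z%:R * (H%:R + K%:R) :> R.
Proof.
move=> s3H t2K.
apply: le_trans (lerD (count_mul_congr (a * (1 + h1 * k1) - 1) m0 s3H t2K hT)
   (ler_wpM2l (ler0n R (m%:Z %| h1 * k1 - (a - 1))%Z) (count_mul_zero R s3H t2K))).
rewrite mulr_sumr -big_split /=; apply: ler_sum => x _.
rewrite mulr_sumr -big_split /=; apply: ler_sum => y _.
rewrite -natrM -natrD ler_nat.
case: (boolP (m%:Z %| _ - a * _)%Z) => // h.
have [e|ne] /= := eqVneq ((x%:Z - s3%:Z) * (y%:Z - t2%:Z)) 0.
  move: h; rewrite e addr0 mulr1 => h.
  by rewrite muln1 (_ : h1 * k1 - (a - 1) = 1 + h1 * k1 - a) ?h //; ring.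
suff -> : (m%:Z %| (x%:Z - s3%:Z) * (y%:Z - t2%:Z) - (a * (1 + h1 * k1) - 1))%Z by [].
move: h; move: ((x%:Z - s3%:Z) * (y%:Z - t2%:Z)) => n h.
have -> : n - (a * (1 + h1 * k1) - 1) = - (a * (1 + h1 * k1 - a * (1 + n))) - (a ^+ 2 - 1) * (1 + n) by ring.
by apply: rpredB; [rewrite rpredN; exact: dvdz_mull|exact: dvdz_mulr].
Qed.

Let first_count (s1 t1 : nat) : (s1 < H)%N -> (t1 < K)%N ->
  \sum_(x1 < H) \sum_(y1 < K)
    (H%:R * (gcdn (absz (1 + (x1%:Z - s1%:Z) * (y1%:Z - t1%:Z))%R) m)%:R / m%:R + 1)
  <= 11 * T ^+ 2 * (H%:R * K%:R * (H%:R / m%:R + 1)) :> R.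
Proof.
move=> s1H t1K.
have H1 : (1 : R) <= H%:R by rewrite ler1n (leq_ltn_trans _ s1H).
have K1 : (1 : R) <= K%:R by rewrite ler1n (leq_ltn_trans _ t1K).
pose z (x1 : 'I_H) (y1 : 'I_K) := (x1%:Z - s1%:Z) * (y1%:Z - t1%:Z).
have cnt (d : nat) : d \in divisors m ->
    d%:R * (\sum_(x1 < H) \sum_(y1 < K) (d%:Z %| 1 + z x1 y1)%Z%:R) <=
    4 * T * (H%:R * K%:R + m%:R) + 2 * (H%:R * K%:R) :> R.
  rewrite -dvdn_divisors // => dm; have d0 := dvdn_gt0 m0 dm.
  have dR : (0 : R) < d%:R by rewrite ltr0n.
  have h : \sum_(x1 < H) \sum_(y1 < K) (d%:Z %| 1 + z x1 y1)%Z%:R <=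
     4 * T * (H%:R * K%:R / d%:R + 1) + (d == 1%N)%:R * (H%:R + K%:R) :> R.
    apply: le_trans (lerD (count_mul_congr (- 1) d0 s1H t1K hT)
      (ler_wpM2l (ler0n R (d == 1%N)) (count_mul_zero R s1H t1K))).
    rewrite mulr_sumr -big_split /=; apply: ler_sum => x _.
    rewrite mulr_sumr -big_split /=; apply: ler_sum => y _.
    rewrite -natrM -natrD ler_nat /z opprK.
    have [e|ne] /= := eqVneq ((x%:Z - s1%:Z) * (y%:Z - t1%:Z)) 0.
      by rewrite e addr0 dvdz1 muln1.
    by rewrite [1 + _]addrC leq_addr.
  apply: le_trans (ler_wpM2l (ltW dR) h) _; rewrite mulrDr; apply: lerD.
    have -> : d%:R * (4 * T * (H%:R * K%:R / d%:R + 1)) = 4 * T * (H%:R * K%:R + d%:R).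
      by field; rewrite gt_eqF.
    apply: ler_wpM2l; first by rewrite mulr_ge0.
    by rewrite lerD2l ler_nat dvdn_leq.
  case: eqP => [->|_]; last by rewrite mul0r mulr0; apply: mulr_ge0 => //; apply: mulr_ge0.
  rewrite !mul1r; have := mulr_ge0 (ltW (lt_le_trans ltr01 H1)) (ltW (lt_le_trans ltr01 K1)).
  have : 0 <= (H%:R - 1) * K%:R :> R by rewrite mulr_ge0 ?subr_ge0.
  have : 0 <= (K%:R - 1) * H%:R :> R by rewrite mulr_ge0 ?subr_ge0.
  by lra.
have TT : T <= T ^+ 2 by rewrite expr2 ler_peMl // (le_trans _ T1).
apply: (@le_trans _ _ (\sum_(x1 < H) \sum_(y1 < K) (1 + \sum_(d <- divisors m)
   H%:R / m%:R * (d%:R * (d%:Z %| 1 + z x1 y1)%Z%:R)))).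
  apply: ler_sum => x _; apply: ler_sum => y _; rewrite addrC lerD2l.
  have gm : gcdn (absz (1 + z x y)) m \in divisors m by rewrite -dvdn_divisors // dvdn_gcdr.
  rewrite (bigD1_seq _ gm (divisors_uniq _)) /=.
  have -> : ((gcdn (absz (1 + z x y)) m)%:Z %| 1 + z x y)%Z by rewrite dvdzE /= dvdn_gcdl.
  rewrite mulr1 mulrAC lerDl; apply: sumr_ge0 => d _.
  by rewrite !mulr_ge0 ?invr_ge0.
have -> : \sum_(x1 < H) \sum_(y1 < K) (1 + \sum_(d <- divisors m)
   H%:R / m%:R * (d%:R * (d%:Z %| 1 + z x1 y1)%Z%:R)) =
   H%:R * K%:R + H%:R / m%:R * \sum_(d <- divisors m)
     d%:R * (\sum_(x1 < H) \sum_(y1 < K) (d%:Z %| 1 + z x1 y1)%Z%:R) :> R.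
  under eq_bigr do rewrite big_split /= sumr_const card_ord exchange_big /=.
  rewrite big_split /= sumr_const card_ord -[1 *+ K *+ H]mulrnA -natrM mulnC natrM.
  congr (_ + _); rewrite exchange_big /= mulr_sumr; apply: eq_bigr => d _.
  rewrite !mulr_sumr; apply: eq_bigr => x _; rewrite !mulr_sumr; apply: eq_bigr => y _ //.
have Sd : \sum_(d <- divisors m) d%:R * (\sum_(x1 < H) \sum_(y1 < K) (d%:Z %| 1 + z x1 y1)%Z%:R)
   <= T * (4 * T * (H%:R * K%:R + m%:R) + 2 * (H%:R * K%:R)) :> R.
  apply: (@le_trans _ _ (\sum_(d <- divisors m) (4 * T * (H%:R * K%:R + m%:R) + 2 * (H%:R * K%:R)))).
    by rewrite big_seq [X in _ <= X]big_seq; apply: ler_sum => d; exact: cnt.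
  rewrite big_const_seq count_predT iter_addr_0 -[X in X <= _]mulr_natl ler_wpM2r //.
  by do ![done | apply: addr_ge0 | apply: mulr_ge0].
have hm : 0 <= H%:R / m%:R :> R by rewrite divr_ge0.
apply: le_trans (lerD (lexx _) (ler_wpM2l hm Sd)) _.
have -> : H%:R / m%:R * (T * (4 * T * (H%:R * K%:R + m%:R) + 2 * (H%:R * K%:R))) =
   (4 * T ^+ 2 + 2 * T) * (H%:R * K%:R * (H%:R / m%:R)) + 4 * T ^+ 2 * H%:R :> R.
  by field; rewrite gt_eqF.
set hk := H%:R * K%:R; have hk0 : 0 <= hk by rewrite mulr_ge0.
have Hhk : H%:R <= hk by rewrite /hk ler_peMr.
set w := hk * (H%:R / m%:R); have w0 : 0 <= w by rewrite mulr_ge0.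
rewrite mulrDr mulr1 -/w.
have T21 : 1 <= T ^+ 2 by apply: le_trans T1 TT.
by nra.
Qed.

Let second_count (s1 t1 : nat) : (s1 < H)%N -> (t1 < K)%N ->
  \sum_(x1 < H) \sum_(y1 < K)
    (m%:Z %| (x1%:Z - s1%:Z) * (y1%:Z - t1%:Z) - (a - 1))%Z%:R *
    (H%:R * (gcdn (absz (1 + (x1%:Z - s1%:Z) * (y1%:Z - t1%:Z))%R) m)%:R / m%:R + 1)
  <= (H%:R / m%:R + 1) * (4 * T * (H%:R * K%:R / m%:R + 1) + (H%:R + K%:R)) :> R.
Proof.
move=> s1H t1K.
apply: (@le_trans _ _ ((H%:R / m%:R + 1) * \sum_(x1 < H) \sum_(y1 < K)
    (m%:Z %| (x1%:Z - s1%:Z) * (y1%:Z - t1%:Z) - (a - 1))%Z%:R)).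
  rewrite mulr_sumr; apply: ler_sum => x _; rewrite mulr_sumr; apply: ler_sum => y _.
  move: ((x%:Z - s1%:Z) * (y%:Z - t1%:Z)) => n.
  have [h|_] := boolP (m%:Z %| n - (a - 1))%Z; last by rewrite mul0r mulr0.
  suff -> : gcdn (absz (1 + n)%R) m = 1%N by rewrite mulr1 mul1r mulr1.
  have h1 : (m%:Z %| a * (1 + n) - 1)%Z.
    have -> : a * (1 + n) - 1 = a * (n - (a - 1)) + (a ^+ 2 - 1) by ring.
    by apply: rpredD => //; exact: dvdz_mull.
  apply/eqP; rewrite -dvdn1.
  have -> : (gcdn (absz (1 + n)%R) m %| 1)%N = ((gcdn (absz (1 + n)%R) m)%:Z %| 1)%Z by rewrite dvdzE.
  have -> : 1 = a * (1 + n) - (a * (1 + n) - 1) :> int by ring.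
  apply: rpredB; first by apply: dvdz_mull; rewrite dvdzE /= dvdn_gcdl.
  by apply: dvdz_trans h1; rewrite dvdzE /= dvdn_gcdr.
rewrite ler_wpM2l ?addr_ge0 ?divr_ge0 //.
apply: le_trans (lerD (count_mul_congr (a - 1) m0 s1H t1K hT) (count_mul_zero R s1H t1K)).
rewrite -big_split /=; apply: ler_sum => x _; rewrite -big_split /=; apply: ler_sum => y _.
rewrite -natrD ler_nat.
by case: (m%:Z %| _)%Z; case: (_ == 0).
Qed.

Lemma count_words (s1 t1 s2 t2 s3 t3 : nat) :
  (s1 < H)%N -> (t1 < K)%N -> (s3 < H)%N -> (t2 < K)%N ->
  \sum_(x1 < H) \sum_(y1 < K) \sum_(x3 < H) \sum_(y2 < K) \sum_(x2 < H) \sum_(y3 < K)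
    (word_scalar m a (x1%:Z - s1%:Z) (y1%:Z - t1%:Z) (x2%:Z - s2%:Z) (y2%:Z - t2%:Z)
       (x3%:Z - s3%:Z) (y3%:Z - t3%:Z))%:R
  <= 600 * T ^+ 3 * (K%:R ^+ 2 + H%:R * K%:R ^+ 3 / m%:R + H%:R ^+ 3 * K%:R ^+ 3 / m%:R ^+ 3) :> R.
Proof.
move=> s1H t1K s3H t2K.
have H1 : (1 : R) <= H%:R by rewrite ler1n (leq_ltn_trans _ s1H).
have K1 : (1 : R) <= K%:R by rewrite ler1n (leq_ltn_trans _ t1K).
set G := fun x1 y1 => H%:R * (gcdn (absz (1 + (x1%:Z - s1%:Z) * (y1%:Z - t1%:Z))%R) m)%:R / m%:R + 1 : R.
have G0 x y : 0 <= G x y by rewrite addr_ge0 // divr_ge0 // mulr_ge0.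
set V := 4 * T * (H%:R * K%:R / m%:R + 1).
have km0 : 0 <= K%:R / m%:R + 1 :> R by rewrite addr_ge0 // divr_ge0.
apply: (@le_trans _ _ (\sum_(x1 < H) \sum_(y1 < K) (G x1 y1 * (K%:R / m%:R + 1)) *
   (V + (m%:Z %| (x1%:Z - s1%:Z) * (y1%:Z - t1%:Z) - (a - 1))%Z%:R * (H%:R + K%:R)))).
  apply: ler_sum => x1 _; apply: ler_sum => y1 _.
  apply: le_trans (ler_wpM2l (mulr_ge0 (G0 x1 y1) km0) (outer_count _ _ s3H t2K)).
  rewrite mulr_sumr; apply: ler_sum => x3 _; rewrite mulr_sumr; apply: ler_sum => y2 _.
  by rewrite [X in _ <= X]mulrC; exact: inner_count.
have -> : \sum_(x1 < H) \sum_(y1 < K) (G x1 y1 * (K%:R / m%:R + 1)) *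
   (V + (m%:Z %| (x1%:Z - s1%:Z) * (y1%:Z - t1%:Z) - (a - 1))%Z%:R * (H%:R + K%:R)) =
   (K%:R / m%:R + 1) * (V * (\sum_(x1 < H) \sum_(y1 < K) G x1 y1) +
     (H%:R + K%:R) * \sum_(x1 < H) \sum_(y1 < K)
      (m%:Z %| (x1%:Z - s1%:Z) * (y1%:Z - t1%:Z) - (a - 1))%Z%:R * G x1 y1).
  rewrite 2!mulr_sumr -big_split /= mulr_sumr; apply: eq_bigr => x _.
  rewrite 2!mulr_sumr -big_split /= mulr_sumr; apply: eq_bigr => y _; ring.
have V0 : 0 <= V by rewrite !mulr_ge0 // addr_ge0 // divr_ge0 // mulr_ge0.
have HK0 : 0 <= H%:R + K%:R :> R by rewrite addr_ge0.
apply: le_trans (ler_wpM2l km0 (lerD (ler_wpM2l V0 (first_count s1H t1K))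
   (ler_wpM2l HK0 (second_count s1H t1K)))) _.
have HKR : H%:R <= K%:R :> R by rewrite ler_nat.
have u0 : 0 < m%:R^-1 :> R by rewrite invr_gt0.
have u1 : m%:R^-1 <= 1 :> R by rewrite invf_le1 // ler1n.
have := word_poly_bound H1 HKR u0 u1.
have -> : H%:R ^+ 3 * K%:R ^+ 3 / m%:R ^+ 3 = H%:R ^+ 3 * K%:R ^+ 3 * m%:R^-1 ^+ 3 :> R by rewrite exprVn.
move: H1 K1 HKR u0 u1; rewrite /V; move: (H%:R : R) (K%:R : R) (m%:R^-1 : R) => h k u h1 k1 hk u0 u1.
set P3 := 300 * _; set P1 := (k * u + 1) * _ => hP.
have T3 : T ^+ 3 = T * T ^+ 2 by rewrite exprS.
have TT : T <= T ^+ 2 by rewrite expr2 ler_peMl.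
have T21 : 1 <= T ^+ 2 by apply: le_trans T1 TT.
have T31 : T <= T ^+ 3 by rewrite T3 ler_peMr.
have T32 : 1 <= T ^+ 3 by apply: le_trans T1 T31.
have -> : 600 * T ^+ 3 * (k ^+ 2 + h * k ^+ 3 * u + h ^+ 3 * k ^+ 3 * u ^+ 3) = 2 * T ^+ 3 * P3.
  by rewrite /P3; ring.
apply: le_trans (ler_wpM2l _ hP); last by rewrite mulr_ge0 // (le_trans _ T32).
have h0 : 0 <= h by rewrite (le_trans _ h1).
have k0 : 0 <= k by rewrite (le_trans _ k1).
have hu : 0 <= h * u + 1 by rewrite addr_ge0 // mulr_ge0 // ltW.
have ku : 0 <= k * u + 1 by rewrite addr_ge0 // mulr_ge0 // ltW.
rewrite /P1.
have -> : 2 * T ^+ 3 * ((k * u + 1) * (h * u + 1) * (32 * (h * k * (h * k * u + 1)) + 4 * k ^+ 2))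
  = (k * u + 1) * ((h * u + 1) * (2 * T ^+ 3 * (32 * (h * k * (h * k * u + 1)) + 4 * k ^+ 2))) by ring.
rewrite ler_wpM2l //.
have -> : 4 * T * (h * k * u + 1) * (11 * T ^+ 2 * (h * k * (h * u + 1))) +
  (h + k) * ((h * u + 1) * (4 * T * (h * k * u + 1) + (h + k))) =
  (h * u + 1) * (44 * T ^+ 3 * (h * k * (h * k * u + 1)) + (h + k) * (4 * T * (h * k * u + 1) + (h + k))).
  by rewrite T3; ring.
rewrite ler_wpM2l //.
have w0 : 0 <= h * k * u + 1 by rewrite addr_ge0 // !mulr_ge0 // ltW.
set w := h * k * u + 1 in w0 *.
have e1 : (h + k) * (4 * T * w) <= 2 * k * (4 * T ^+ 3 * w).
  rewrite ler_pM ?addr_ge0 ?mulr_ge0 //; first by lra.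
  by rewrite ler_wpM2r // ler_wpM2l.
have e2 : (h + k) * (h + k) <= 4 * k ^+ 2 * T ^+ 3.
  apply: (@le_trans _ _ (4 * k ^+ 2)); last by rewrite ler_peMr // mulr_ge0 // exprn_ge0.
  by nra.
have e3 : k * (T ^+ 3 * w) <= h * k * (T ^+ 3 * w).
  by rewrite ler_wpM2r ?mulr_ge0 ?(le_trans _ T32) // ler_peMl.
have e4 : 0 <= h * k * (T ^+ 3 * w) by rewrite !mulr_ge0 ?(le_trans _ T32).
by move: e1 e2 e3 e4; rewrite mulrDr; move: (T ^+ 3) => t e1 e2 e3 e4; nra.
Qed.
End CountWords.

Section QuadraticZeros.
Variable R : realType.

Lemma count_congr2 (L mu : nat) (P : pred nat) : (0 < mu)%N -> (mu <= L)%N ->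
  (forall x y, (x < L)%N -> (y < L)%N -> P x -> P y -> (mu%:Z %| x%:Z - y%:Z)%Z) ->
  (\sum_(x < L) (P x)%:R : R) <= 2 * (L%:R / mu%:R).
Proof.
move=> mu0 muL hP; apply: le_trans (count_congr R mu0 hP) _.
have : 1 <= L%:R / mu%:R :> R by rewrite ler_pdivlMr ?ltr0n // mul1r ler_nat.
by move: (L%:R / mu%:R) => x; lra.
Qed.

Lemma gcd_div_sqr u m : (0 < m)%N -> (u %| m)%N -> (gcdn u (m %/ u) ^ 2 %| m)%N.
Proof.
by move=> m0 um; rewrite -{2}(divnK um) mulnC expnS expn1 dvdn_mul ?dvdn_gcdl ?dvdn_gcdr.
Qed.

Lemma count_quadratic_zeros (c e f i : nat) : (0 < c)%N -> i = gcdn (gcdn e f) c ->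
  (\sum_(z < c) \sum_(s < c) (c %| z * (s * e + z * f))%N%:R : R) <=
  4 * (c%:R * i%:R * \sum_(u <- divisors (c %/ i)) (gcdn u (c %/ i %/ u))%:R).
Proof.
move=> c0 iE; have i0 : (0 < i)%N by rewrite iE gcdn_gt0 c0 orbT.
have ic : (i %| c)%N by rewrite iE dvdn_gcdr.
have /dvdnP[e0 eE] : (i %| e)%N by rewrite iE; apply: dvdn_trans (dvdn_gcdl _ _) (dvdn_gcdl _ _).
have /dvdnP[f0 fE] : (i %| f)%N by rewrite iE; apply: dvdn_trans (dvdn_gcdl _ _) (dvdn_gcdr _ _).
set m := (c %/ i)%N; have cE : (c = m * i)%N by rewrite divnK.
have m0 : (0 < m)%N by rewrite divn_gt0 // dvdn_leq.
have cop : gcdn (gcdn e0 f0) m = 1%N.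
  by apply/eqP; rewrite -(eqn_pmul2r i0) !muln_gcdl -eE -fE -cE mul1n iE.
have mc : (m %| c)%N by rewrite cE dvdn_mulr.
have mlec : (m <= c)%N by exact: dvdn_leq.
pose g u := gcdn e0 (m %/ u).
have gm u : (u %| m)%N -> (g u %| m)%N.
  by move=> um; apply: dvdn_trans (dvdn_gcdr _ _) _; rewrite -{2}(divnK um) dvdn_mulr.
have step z : (0 < gcdn z m)%N by rewrite gcdn_gt0 m0 orbT.
have hz (z : 'I_c) : (\sum_(s < c) (c %| z * (s * e + z * f))%N%:R : R) <=
   \sum_(u <- divisors m) (lcmn u (g u) %| z)%N%:R * (2 * (c%:R * (g u)%:R * u%:R / m%:R)).
  set u := gcdn z m; have um : (u %| m)%N by exact: dvdn_gcdr.
  have u0 : (0 < u)%N by exact: step.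
  set m' := (m %/ u)%N; have m'0 : (0 < m')%N by rewrite divn_gt0 // dvdn_leq.
  have mE : (m = m' * u)%N by rewrite divnK.
  have zE : (z = z %/ u * u :> nat)%N by rewrite divnK // dvdn_gcdl.
  have copz : coprime m' (z %/ u).
    by rewrite coprime_sym /coprime -(eqn_pmul2r u0) muln_gcdl -zE -mE mul1n.
  have red s : (c %| z * (s * e + z * f))%N = (m' %| s * e0 + z * f0)%N.
    have -> : (z * (s * e + z * f) = z * (s * e0 + z * f0) * i)%N by rewrite eE fE; ring.
    rewrite {1}cE dvdn_pmul2r // {1}zE mE.
    have -> : (z %/ u * u * (s * e0 + z * f0) = z %/ u * (s * e0 + z * f0) * u)%N by ring.
    by rewrite dvdn_pmul2r // Gauss_dvdr.
  under eq_bigr do rewrite red.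
  rewrite (bigD1_seq u) ?divisors_uniq -?dvdn_divisors //=.
  have rest0 : 0 <= \sum_(v <- divisors m | v != u)
     (lcmn v (g v) %| z)%N%:R * (2 * (c%:R * (g v)%:R * v%:R / m%:R)) :> R.
    by apply: sumr_ge0 => v _; rewrite !mulr_ge0 // invr_ge0.
  apply: le_trans (_ : _ <= (lcmn u (g u) %| z)%N%:R * (2 * (c%:R * (g u)%:R * u%:R / m%:R))) _; last by rewrite lerDl.
  have g0 : (0 < g u)%N by rewrite gcdn_gt0 m'0 orbT.
  have gm' : (g u %| m')%N by exact: dvdn_gcdr.
  have copg : coprime (g u) f0.
    have h1 : (gcdn (g u) f0 %| e0)%N by apply: dvdn_trans (dvdn_gcdl _ _) (dvdn_gcdl _ _).
    have h2 : (gcdn (g u) f0 %| m)%N by apply: dvdn_trans (dvdn_gcdl _ _) (gm _ um).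
    by rewrite /coprime -dvdn1 -cop !dvdn_gcd dvdn_gcdr h1 h2.
  have [gz|ngz] := boolP (g u %| z)%N; last first.
    rewrite big1 ?mulr_ge0 ?invr_ge0 // => s _.
    case: (boolP (m' %| _)%N) => // h; case/negP: ngz.
    have := dvdn_trans gm' h; rewrite dvdn_addr; last by rewrite dvdn_mull // dvdn_gcdl.
    by rewrite Gauss_dvdl.
  rewrite dvdn_lcm dvdn_gcdl gz /= mul1r.
  have -> : c%:R * (g u)%:R * u%:R / m%:R = c%:R / (m' %/ g u)%:R :> R.
    have mR : (m%:R : R) = (m' %/ g u)%:R * (g u)%:R * u%:R by rewrite -!natrM divnK // -mE.
    have h1 : ((m' %/ g u)%:R : R) != 0 by rewrite pnatr_eq0 -lt0n divn_gt0 // dvdn_leq.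
    have h2 : ((g u)%:R : R) != 0 by rewrite pnatr_eq0 -lt0n.
    have h3 : (u%:R : R) != 0 by rewrite pnatr_eq0 -lt0n.
    by rewrite mR; field; rewrite h1 h2 h3.
  apply: (count_congr2 (P := fun s => (m' %| s * e0 + z * f0)%N)).
  - by rewrite divn_gt0 // dvdn_leq.
  - rewrite (leq_trans (leq_div _ _)) // (leq_trans _ mlec) // dvdn_leq //.
    by apply/dvdnP; exists u; rewrite mulnC -mE.
  move=> x y _ _ hx hy.
  have hx' : (m'%:Z %| (x * e0 + z * f0)%:Z)%Z by rewrite dvdzE.
  have hy' : (m'%:Z %| (y * e0 + z * f0)%:Z)%Z by rewrite dvdzE.
  have := rpredB hx' hy'.
  have -> : (x * e0 + z * f0)%:Z - (y * e0 + z * f0)%:Z = e0%:Z * (x%:Z - y%:Z) by rewrite !PoszD !PoszM; ring.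
  rewrite !dvdzE abszM /=.
  have -> : (e0 = e0 %/ g u * g u)%N by rewrite divnK // dvdn_gcdl.
  rewrite -{1}(divnK gm') mulnAC dvdn_pmul2r // Gauss_dvdr //.
  by rewrite coprime_sym /coprime -(eqn_pmul2r g0) muln_gcdl !divnK ?dvdn_gcdl // mul1n.
apply: le_trans (ler_sum _ (fun z _ => hz z)) _.
rewrite exchange_big /= !mulr_sumr big_seq [X in _ <= X]big_seq; apply: ler_sum => u.
rewrite -dvdn_divisors // => um; have u0 : (0 < u)%N by exact: dvdn_gt0 um.
have g0 : (0 < g u)%N by apply: dvdn_gt0 m0 (gm _ um).
rewrite -mulr_suml.
have lm : (lcmn u (g u) %| m)%N by rewrite dvdn_lcm um gm.
have l0 : (0 < lcmn u (g u))%N by rewrite lcmn_gt0 u0.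
have hl : (\sum_(z < c) (lcmn u (g u) %| z)%N%:R : R) <= 2 * (c%:R / (lcmn u (g u))%:R).
  apply: (count_congr2 (P := fun z => (lcmn u (g u) %| z)%N)) => //.
    by rewrite (leq_trans _ mlec) // dvdn_leq.
  by move=> x y _ _ hx hy; apply: rpredB; rewrite dvdzE.
have v0 : 0 <= 2 * (c%:R * (g u)%:R * u%:R / m%:R) :> R by rewrite !mulr_ge0 // invr_ge0.
apply: le_trans (ler_wpM2r v0 hl) _.
have -> : 2 * (c%:R / (lcmn u (g u))%:R) * (2 * (c%:R * (g u)%:R * u%:R / m%:R)) =
   4 * (c%:R * i%:R * (gcdn u (g u))%:R) :> R.
  have h1 : (lcmn u (g u))%:R != 0 :> R by rewrite pnatr_eq0 -lt0n.
  have h2 : m%:R != 0 :> R by rewrite pnatr_eq0 -lt0n.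
  have lg : (lcmn u (g u))%:R * (gcdn u (g u))%:R = u%:R * (g u)%:R :> R by rewrite -!natrM muln_lcm_gcd.
  have cR : (c%:R : R) = m%:R * i%:R by rewrite -natrM -cE.
  have -> : (gcdn u (g u))%:R = u%:R * (g u)%:R / (lcmn u (g u))%:R :> R.
    by apply: (mulIf h1); rewrite divfK // mulrC.
  by rewrite cR; field; rewrite h1 h2.
rewrite ler_wpM2l // ler_wpM2l ?mulr_ge0 // ler_nat dvdn_leq ?gcdn_gt0 ?u0 //.
by rewrite dvdn_gcd dvdn_gcdl (dvdn_trans (dvdn_gcdr _ _)) // dvdn_gcdr.
Qed.
End QuadraticZeros.

Local Open Scope complex_scope.

(** * Almost orthogonality and amplification *)

Section RealSums.
Variable R : realType.

Lemma cauchy_schwarz_sum (I : Type) (r : seq I) (P : pred I) (a b : I -> R) :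
  (\sum_(i <- r | P i) a i * b i) ^+ 2 <=
  (\sum_(i <- r | P i) a i ^+ 2) * (\sum_(i <- r | P i) b i ^+ 2).
Proof.
have : 0 <= \sum_(i <- r | P i) \sum_(j <- r | P j) (a i * b j - a j * b i) ^+ 2.
  by apply: sumr_ge0 => i _; apply: sumr_ge0 => j _; exact: sqr_ge0.
set A := \sum_(i <- r | P i) a i ^+ 2; set B := \sum_(i <- r | P i) b i ^+ 2.
set D := \sum_(i <- r | P i) a i * b i.
have -> : \sum_(i <- r | P i) \sum_(j <- r | P j) (a i * b j - a j * b i) ^+ 2
          = 2 * (A * B - D ^+ 2).
  transitivity (\sum_(i <- r | P i) (a i ^+ 2 * B + A * b i ^+ 2 - 2 * (a i * b i * D))).
    apply: eq_bigr => i _; rewrite /A /B /D !mulr_sumr !mulr_suml -!big_split /=.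
    rewrite -sumrB; apply: eq_bigr => j _; ring.
  by rewrite sumrB big_split /= -mulr_suml -!mulr_sumr -mulr_suml -/A -/B -/D; ring.
by rewrite pmulr_rge0 ?subr_ge0.
Qed.

Lemma cauchy_schwarz_sqrt (I : Type) (r : seq I) (P : pred I) (a b : I -> R) :
  \sum_(i <- r | P i) a i * b i <=
  Num.sqrt (\sum_(i <- r | P i) a i ^+ 2) * Num.sqrt (\sum_(i <- r | P i) b i ^+ 2).
Proof.
rewrite -sqrtrM; last by apply: sumr_ge0 => i _; exact: sqr_ge0.
by rewrite (le_trans (ler_norm _))// -sqrtr_sqr ler_wsqrtr// cauchy_schwarz_sum.
Qed.

Lemma cabs_ge0 (z : R[i]) : 0 <= cabs z.
Proof. by case: z => a b; rewrite /cabs /= sqrtr_ge0. Qed.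

Lemma cabs0 : cabs 0 = 0 :> R. Proof. exact: ComplexField.Normc.normc0. Qed.
Lemma cabsM (x y : R[i]) : cabs (x * y) = cabs x * cabs y.
Proof. exact: ComplexField.Normc.normcM. Qed.
Lemma cabsV (x : R[i]) : cabs x^-1 = (cabs x)^-1.
Proof. exact: ComplexField.Normc.normcV. Qed.
Lemma cabsD (x y : R[i]) : cabs (x + y) <= cabs x + cabs y.
Proof. exact: le_normcD. Qed.
Lemma cabsN (x : R[i]) : cabs (- x) = cabs x.
Proof. exact: normcN. Qed.
Lemma cabs_eq0 (x : R[i]) : cabs x = 0 -> x = 0.
Proof. exact: ComplexField.Normc.eq0_normc. Qed.

Lemma cabsJ (z : R[i]) : cabs (conjc z) = cabs z.
Proof. by case: z => a b; rewrite /cabs /= sqrrN. Qed.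

Lemma cabs_real (x : R) : cabs x%:C = `|x|.
Proof. by rewrite /cabs /= expr0n /= addr0 sqrtr_sqr. Qed.

Lemma conjcM (x y : R[i]) : conjc (x * y) = conjc x * conjc y.
Proof. exact: rmorphM. Qed.
Lemma conjc_sum (I : Type) (r : seq I) (P : pred I) (F : I -> R[i]) :
  conjc (\sum_(i <- r | P i) F i) = \sum_(i <- r | P i) conjc (F i).
Proof. exact: rmorph_sum. Qed.

Lemma sqr_cabs (z : R[i]) : (cabs z ^+ 2)%:C = z * conjc z.
Proof.
case: z => a b; rewrite /cabs /= sqr_sqrtr ?addr_ge0 ?sqr_ge0 //.
by apply/eqP; rewrite eq_complex /=; apply/andP; split; apply/eqP; ring.
Qed.

Lemma cabs_sum (I : Type) (r : seq I) (P : pred I) (F : I -> R[i]) :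
  cabs (\sum_(i <- r | P i) F i) <= \sum_(i <- r | P i) cabs (F i).
Proof.
apply: (big_ind2 (fun x y => cabs x <= y)) => //.
- by rewrite cabs0.
- by move=> x1 x2 y1 y2 h1 h2; exact: le_trans (cabsD _ _) (lerD h1 h2).
Qed.

Lemma Re_le_cabs (z : R[i]) : complex.Re z <= cabs z.
Proof.
case: z => a b /=; rewrite (le_trans (ler_norm _)) // /cabs /= -sqrtr_sqr.
by rewrite ler_wsqrtr // lerDl sqr_ge0.
Qed.

End RealSums.

Section FunctionSpace.
Variables (R : realType) (Z : finType).
Implicit Types F G : Z -> R[i].

Definition ip F G : R[i] := \sum_z F z * conjc (G z).
Definition nsq F : R := \sum_z cabs (F z) ^+ 2.

Lemma nsq_ge0 F : 0 <= nsq F.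
Proof. by apply: sumr_ge0 => z _; exact: sqr_ge0. Qed.

Lemma ip_nsq F : ip F F = (nsq F)%:C.
Proof. by rewrite /ip /nsq rmorph_sum; apply: eq_bigr => z _; rewrite -sqr_cabs. Qed.

Lemma ipC F G : ip G F = conjc (ip F G).
Proof.
rewrite /ip rmorph_sum; apply: eq_bigr => z _.
by rewrite rmorphM /= conjcK mulrC.
Qed.

Lemma cauchy_schwarz_ip F G : cabs (ip F G) ^+ 2 <= nsq F * nsq G.
Proof.
apply: le_trans (cauchy_schwarz_sum _ _ _ _).
rewrite ler_sqr ?nnegrE ?cabs_ge0 //; last first.
  by apply: sumr_ge0 => z _; rewrite mulr_ge0 ?cabs_ge0.
apply: le_trans (cabs_sum _ _ _) _; apply: ler_sum => z _.
by rewrite cabsM cabsJ.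
Qed.

(* Boas-Bellman: almost orthogonality of the family [f] in the sense of Schur's test. *)
Lemma bessel_schur (S : finType) (f : S -> Z -> R[i]) (Lam : R) (Phi : Z -> R[i]) :
  0 <= Lam -> (forall s, \sum_t cabs (ip (f s) (f t)) <= Lam) ->
  \sum_s cabs (\sum_z Phi z * f s z) ^+ 2 <= Lam * nsq Phi.
Proof.
move=> L0 hL; set b := fun s => \sum_z Phi z * f s z.
set X := \sum_s cabs (b s) ^+ 2.
have X0 : 0 <= X by apply: sumr_ge0 => s _; exact: sqr_ge0.
pose G z := \sum_s b s * conjc (f s z).
have e1 : X%:C = \sum_z conjc (Phi z) * G z.
  transitivity (\sum_s conjc (b s) * b s).
    by rewrite /X rmorph_sum; apply: eq_bigr => s _; rewrite /= sqr_cabs mulrC.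
  transitivity (\sum_s \sum_z conjc (Phi z) * (b s * conjc (f s z))).
    apply: eq_bigr => s _; rewrite {1}/b rmorph_sum mulr_suml; apply: eq_bigr => z _.
    by rewrite rmorphM; ring.
  by rewrite exchange_big; apply: eq_bigr => z _; rewrite -mulr_sumr.
have e2 : X ^+ 2 <= nsq Phi * nsq G.
  have -> : X = cabs (ip G Phi).
    rewrite -[LHS]ger0_norm // -cabs_real e1; congr cabs.
    by apply: eq_bigr => z _; rewrite mulrC.
  by rewrite mulrC; exact: cauchy_schwarz_ip.
have e3 : nsq G <= Lam * X.
  have -> : nsq G = cabs (ip G G) by rewrite ip_nsq cabs_real ger0_norm ?nsq_ge0.
  have -> : ip G G = \sum_s \sum_t b s * conjc (b t) * ip (f t) (f s).
    transitivity (\sum_z \sum_s \sum_t b s * conjc (b t) * (f t z * conjc (f s z))).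
      apply: eq_bigr => z _; rewrite {1}/G mulr_suml; apply: eq_bigr => s _.
      rewrite /G rmorph_sum mulr_sumr; apply: eq_bigr => t _.
      by rewrite rmorphM /= conjcK; ring.
    rewrite exchange_big; apply: eq_bigr => s _.
    by rewrite exchange_big; apply: eq_bigr => t _; rewrite -mulr_sumr.
  apply: le_trans (cabs_sum _ _ _) _.
  have h1 : \sum_s cabs (\sum_t b s * conjc (b t) * ip (f t) (f s)) <=
      \sum_s \sum_t (cabs (b s) ^+ 2 * cabs (ip (f s) (f t)) / 2
                    + cabs (b t) ^+ 2 * cabs (ip (f t) (f s)) / 2).
    apply: ler_sum => s _; apply: le_trans (cabs_sum _ _ _) _; apply: ler_sum => t _.
    rewrite !cabsM cabsJ.
    have -> : cabs (ip (f s) (f t)) = cabs (ip (f t) (f s)) by rewrite ipC cabsJ.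
    have : 0 <= cabs (ip (f t) (f s)) * (cabs (b s) - cabs (b t)) ^+ 2.
      by rewrite mulr_ge0 ?cabs_ge0 ?sqr_ge0.
    by nra.
  apply: le_trans h1 _.
  under eq_bigr do rewrite big_split /=.
  rewrite big_split /= [X in _ + X]exchange_big /= -big_split /= /X mulr_sumr.
  apply: ler_sum => s _.
  rewrite -big_split /=; have -> : \sum_(t : S) (cabs (b s) ^+ 2 * cabs (ip (f s) (f t)) / 2 +
      cabs (b s) ^+ 2 * cabs (ip (f s) (f t)) / 2) = cabs (b s) ^+ 2 * \sum_t cabs (ip (f s) (f t)).
    by rewrite mulr_sumr; apply: eq_bigr => t _; rewrite -splitr.
  by rewrite mulrC ler_wpM2r ?sqr_ge0.
have [->|Xp] := eqVneq X 0.
  by rewrite mulr_ge0 ?nsq_ge0.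
have {}Xp : 0 < X by rewrite lt_def Xp.
rewrite -(ler_pM2r Xp) -expr2 (le_trans e2) //.
by rewrite mulrC -mulrA [nsq Phi * X]mulrC mulrA ler_wpM2r ?nsq_ge0.
Qed.

End FunctionSpace.

Section Amplification.
Variables (R : realType) (Z : finType).
Implicit Types F G : Z -> R[i].

Definition psum (I : finType) (c : I -> R[i]) (p : I -> Z -> Z) F z :=
  \sum_i c i * F (p i z).

Lemma ip_psum_adj (I : finType) (c : I -> R[i]) (p p' : I -> Z -> Z) F G :
  (forall i, cancel (p i) (p' i)) -> (forall i, cancel (p' i) (p i)) ->
  ip (psum c p F) G = ip F (psum (fun i => conjc (c i)) p' G).
Proof.
move=> pK p'K; rewrite /ip /psum.
under eq_bigr do rewrite mulr_suml.
rewrite exchange_big /=.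
under [RHS]eq_bigr do rewrite rmorph_sum mulr_sumr.
rewrite [RHS]exchange_big /=; apply: eq_bigr => i _.
rewrite (reindex (p' i)) /=; last by exists (p i) => z _; rewrite ?pK ?p'K.
by apply: eq_bigr => z _; rewrite p'K rmorphM /= conjcK; ring.
Qed.

Lemma nsq_cube_le (I : finType) (c : I -> R[i]) (p p' : I -> Z -> Z) F :
  (forall i, cancel (p i) (p' i)) -> (forall i, cancel (p' i) (p i)) ->
  nsq (psum c p F) ^+ 3 <=
  nsq (psum c p (psum (fun i => conjc (c i)) p' (psum c p F))) * nsq F ^+ 2.
Proof.
move=> pK p'K; set T := psum c p; set T' := psum _ p'.
have cabsip G : cabs (ip G G) = nsq G by rewrite ip_nsq cabs_real ger0_norm ?nsq_ge0.
have h1 : nsq (T F) ^+ 2 <= nsq F * nsq (T' (T F)).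
  by rewrite -cabsip (ip_psum_adj _ _ _ pK p'K) cauchy_schwarz_ip.
have h2 : nsq (T' (T F)) ^+ 2 <= nsq (T F) * nsq (T (T' (T F))).
  rewrite -{1}cabsip ipC cabsJ -(ip_psum_adj _ _ _ pK p'K) mulrC.
  exact: cauchy_schwarz_ip.
have := nsq_ge0 (T F); rewrite le_eqVlt => /predU1P[<-|x0].
  by rewrite expr0n /= mulr_ge0 ?sqr_ge0 ?nsq_ge0.
rewrite -(ler_pM2l x0) -exprS.
have -> : nsq (T F) ^+ 4 = (nsq (T F) ^+ 2) ^+ 2 by rewrite -exprM.
apply: (@le_trans _ _ ((nsq F * nsq (T' (T F))) ^+ 2)).
  by rewrite ler_sqr ?nnegrE ?mulr_ge0 ?nsq_ge0 // exprn_ge0 // nsq_ge0.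
rewrite exprMn [X in _ <= X]mulrA [X in _ <= X]mulrC.
by rewrite ler_wpM2l // exprn_ge0 // nsq_ge0.
Qed.

Variables (S : finGroupType) (act : S -> Z -> Z).
Hypothesis act1 : forall z, act 1%g z = z.
Hypothesis actM : forall s t z, act (s * t)%g z = act s (act t z).
Hypothesis actC : forall s t z, act s (act t z) = act t (act s z).

Let actK s : cancel (act s) (act s^-1%g).
Proof. by move=> z; rewrite -actM mulVg act1. Qed.
Let actVK s : cancel (act s^-1%g) (act s).
Proof. by move=> z; rewrite -actM mulgV act1. Qed.

Definition fstab F : pred S := fun s => [forall z, F (act s z) == F z].

Lemma fstabP F s : reflect (forall z, F (act s z) = F z) (fstab F s).
Proof. by apply: (iffP forallP) => h z; apply/eqP. Qed.

Lemma sum_act (V : nmodType) (f : Z -> V) s : \sum_z f (act s z) = \sum_z f z.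
Proof. by rewrite [RHS](reindex (act s)) //; exists (act s^-1%g) => z _; rewrite ?actK ?actVK. Qed.

Lemma sum_mulg (P : pred S) (V : nmodType) (f : S -> V) t : 
  \sum_(s | P s) f s = \sum_(s | P (t * s)%g) f (t * s)%g.
Proof. by rewrite (reindex (fun s => t * s)%g) //; exists (fun s => t^-1 * s)%g => s _; rewrite ?mulKg ?mulKVg. Qed.

Section Trace.
Variables (W : finType) (nu : W -> R[i]) (q : W -> Z -> Z) (F : Z -> R[i]).
Hypothesis qact : forall w s z, q w (act s z) = act s (q w z).
Hypothesis Forth : forall s, ~~ fstab F s -> ip (fun z => F (act s z)) F = 0.

Lemma fstab_mulr s t : fstab F s -> fstab F (t * s)%g = fstab F t.
Proof.
move=> /fstabP hs; apply/fstabP/fstabP => h z; last by rewrite actM actC hs h.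
by rewrite -(actVK s z) -actM h hs.
Qed.

Let N := psum nu q F.
Let Phi z x := \sum_(w | q w z == x) nu w.
Let Phit z x := \sum_(s | fstab F s) Phi z (act s x).
Let k : R := #|fstab F|%:R.

Lemma fstab1 : fstab F 1%g. Proof. by apply/fstabP => z; rewrite act1. Qed.
Let k_gt0 : 0 < k.
Proof. by rewrite ltr0n; apply/card_gt0P; exists 1%g; exact: fstab1. Qed.

Let sum_Phi z s : \sum_x Phi z x * F (act s x) = N (act s z).
Proof.
rewrite /Phi /N /psum; under eq_bigr do rewrite big_mkcond mulr_suml /=.
rewrite exchange_big /=; apply: eq_bigr => w _.
rewrite (bigD1 (q w z)) //= eqxx big1 ?addr0 ?qact // => x xq.
by rewrite eq_sym (negbTE xq) mul0r.
Qed.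

Let sum_Phit z s : \sum_x Phit z x * F (act s x) = k%:C * N (act s z).
Proof.
rewrite /Phit; under eq_bigr do rewrite mulr_suml.
rewrite exchange_big /= (eq_bigr (fun=> N (act s z))); last first.
  move=> t /fstabP ht; rewrite -sum_Phi -[RHS](sum_act _ t); apply: eq_bigr => x _.
  by rewrite actC ht.
by rewrite sumr_const -[LHS]mulr_natl rmorph_nat.
Qed.

Let gram s : \sum_t cabs (ip (fun z => F (act s z)) (fun z => F (act t z))) <= k * nsq F.
Proof.
rewrite (sum_mulg _ _ s) /= -[X in _ <= X]addr0.
rewrite (bigID (fstab F)) /=; apply: lerD.
  rewrite (eq_bigr (fun=> nsq F)); first by rewrite sumr_const mulr_natl.
  move=> t /fstabP ht; rewrite -[RHS]ger0_norm ?nsq_ge0 // -cabs_real -ip_nsq.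
  congr cabs; rewrite -[RHS](sum_act _ s); apply: eq_bigr => z _.
  by rewrite actM actC ht.
rewrite big1 // => t ht; rewrite ipC cabsJ.
suff -> : ip (fun z => F (act (s * t)%g z)) (fun z => F (act s z)) = 0 by rewrite cabs0.
rewrite -(Forth ht) -[RHS](sum_act _ s); apply: eq_bigr => z _.
by rewrite actM actC.
Qed.

Let nsq_Phit : \sum_z nsq (Phit z) <= k *
  \sum_w \sum_w' cabs (nu w) * cabs (nu w') *
    (\sum_z \sum_(t | fstab F t) (q w z == act t (q w' z)))%:R.
Proof.
have h1 z x : cabs (Phit z x) ^+ 2 <= \sum_(s | fstab F s) \sum_(s' | fstab F s')
    \sum_w \sum_w' cabs (nu w) * cabs (nu w') * ((q w z == act s x) && (q w' z == act s' x))%:R.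
  have h2 : cabs (Phit z x) <= \sum_(s | fstab F s) \sum_w cabs (nu w) * (q w z == act s x)%:R.
    apply: le_trans (cabs_sum _ _ _) _; apply: ler_sum => s _.
    apply: le_trans (cabs_sum _ _ _) _; rewrite big_mkcond; apply: ler_sum => w _.
    by case: eqP; rewrite ?mulr1 ?mulr0.
  rewrite expr2; apply: le_trans (ler_pM (cabs_ge0 _) (cabs_ge0 _) h2 h2) _.
  rewrite mulr_suml; apply: ler_sum => s _; rewrite mulr_sumr; apply: ler_sum => s' _.
  rewrite mulr_suml; apply: ler_sum => w _; rewrite mulr_sumr; apply: ler_sum => w' _.
  by rewrite -mulnb natrM; rewrite [X in X <= _]mulrACA.
apply: (@le_trans _ _ (\sum_z \sum_x \sum_(s | fstab F s) \sum_(s' | fstab F s')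
    \sum_w \sum_w' cabs (nu w) * cabs (nu w') * ((q w z == act s x) && (q w' z == act s' x))%:R)).
  by apply: ler_sum => z _; apply: ler_sum => x _; exact: h1.
have -> : \sum_z \sum_x \sum_(s | fstab F s) \sum_(s' | fstab F s')
    \sum_w \sum_w' cabs (nu w) * cabs (nu w') * ((q w z == act s x) && (q w' z == act s' x))%:R
  = \sum_(s' | fstab F s') \sum_w \sum_w' cabs (nu w) * cabs (nu w') *
      \sum_z \sum_(s | fstab F s) \sum_x ((q w z == act s x) && (q w' z == act s' x))%:R.
  transitivity (\sum_(s' | fstab F s') \sum_z \sum_x \sum_(s | fstab F s)
    \sum_w \sum_w' cabs (nu w) * cabs (nu w') * ((q w z == act s x) && (q w' z == act s' x))%:R).
    under eq_bigr => z _ do under eq_bigr => x _ do rewrite exchange_big /=.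
    under eq_bigr => z _ do rewrite exchange_big /=.
    by rewrite exchange_big.
  apply: eq_bigr => s' _.
  transitivity (\sum_w \sum_z \sum_(s | fstab F s) \sum_x
     \sum_w' cabs (nu w) * cabs (nu w') * ((q w z == act s x) && (q w' z == act s' x))%:R).
    under eq_bigr => z _ do rewrite exchange_big /=.
    under eq_bigr => z _ do under eq_bigr => s _ do rewrite exchange_big /=.
    under eq_bigr => z _ do rewrite exchange_big /=.
    by rewrite exchange_big.
  apply: eq_bigr => w _.
  under eq_bigr => z _ do under eq_bigr => s _ do rewrite exchange_big /=.
  under eq_bigr => z _ do rewrite exchange_big /=.
  rewrite exchange_big; apply: eq_bigr => w' _.
  rewrite mulr_sumr; apply: eq_bigr => z _; rewrite mulr_sumr; apply: eq_bigr => s _.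
  by rewrite mulr_sumr.
have -> : k = \sum_(s | fstab F s) 1 by rewrite sumr_const.
rewrite mulr_suml.
apply: ler_sum => s' hs'; rewrite mul1r.
apply: ler_sum => w _; apply: ler_sum => w' _.
rewrite ler_wpM2l ?mulr_ge0 ?cabs_ge0 // natr_sum; apply: ler_sum => z _.
rewrite natr_sum (reindex (fun s => s * s')%g) /=; last first.
  by exists (fun s => s * s'^-1)%g => s _; rewrite ?mulgK ?mulgKV.
rewrite (eq_bigl (fstab F)); last by move=> s; rewrite fstab_mulr.
apply: ler_sum => s _.
rewrite (bigD1 (act s'^-1%g (q w' z))) //= big1 => [|x hx]; last first.
  case: (q w' z =P _) => [e|]; last by rewrite andbF.
  by case/eqP: hx; rewrite e actK.
by rewrite addr0 ler_nat actM actVK eqxx andbT.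
Qed.

Lemma amplification_trace :
  #|S|%:R * nsq N <= nsq F *
  \sum_w \sum_w' cabs (nu w) * cabs (nu w') *
    (\sum_z \sum_(t | fstab F t) (q w z == act t (q w' z)))%:R.
Proof.
set Tr := \sum_w _; rewrite -(ler_pM2l (exprn_gt0 2 k_gt0)).
have -> : k ^+ 2 * (#|S|%:R * nsq N) = \sum_z \sum_s cabs (\sum_x Phit z x * F (act s x)) ^+ 2.
  transitivity (\sum_(s : S) k ^+ 2 * nsq N).
    by rewrite sumr_const -[RHS]mulr_natl; ring.
  rewrite exchange_big; apply: eq_bigr => s _.
  rewrite /nsq -(sum_act _ s) mulr_sumr; apply: eq_bigr => z _.
  by rewrite sum_Phit cabsM cabs_real ger0_norm ?ler0n // exprMn.
apply: (@le_trans _ _ (\sum_z (k * nsq F) * nsq (Phit z))).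
  apply: ler_sum => z _.
  apply: (@bessel_schur _ _ _ (fun s x => F (act s x))) => [|s]; last exact: gram.
  by rewrite mulr_ge0 ?nsq_ge0 ?ltW.
rewrite -mulr_sumr.
apply: le_trans (ler_wpM2l _ nsq_Phit) _; first by rewrite mulr_ge0 ?nsq_ge0 ?ltW.
by rewrite -/Tr le_eqVlt; apply/orP; left; apply/eqP; ring.
Qed.

End Trace.

Lemma amplification (I : finType) (c : I -> R[i]) (p p' : I -> Z -> Z) (F : Z -> R[i]) (kap : R) :
  (forall i, cancel (p i) (p' i)) -> (forall i, cancel (p' i) (p i)) ->
  (forall i s z, p i (act s z) = act s (p i z)) ->
  (forall s, ~~ fstab F s -> ip (fun z => F (act s z)) F = 0) ->
  (forall i, cabs (c i) = kap) ->
  #|S|%:R * nsq (psum c p F) ^+ 3 <= nsq F ^+ 3 * kap ^+ 6 *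
  (\sum_(w : I * I * I) \sum_(w' : I * I * I) \sum_z \sum_(t | fstab F t)
     (p w.2 (p' w.1.2 (p w.1.1 z)) == act t (p w'.2 (p' w'.1.2 (p w'.1.1 z)))))%:R.
Proof.
move=> pK p'K pact Forth ckap.
have p'act i s z : p' i (act s z) = act s (p' i z).
  by apply: (can_inj (pK i)); rewrite p'K pact p'K.
pose nu (w : I * I * I) := c w.1.1 * conjc (c w.1.2) * c w.2.
pose q (w : I * I * I) z := p w.2 (p' w.1.2 (p w.1.1 z)).
have qact w s z : q w (act s z) = act s (q w z) by rewrite /q pact p'act pact.
have := nsq_cube_le c F pK p'K.
have -> : nsq (psum c p (psum (fun i => conjc (c i)) p' (psum c p F))) = nsq (psum nu q F).
  apply: eq_bigr => z _; congr (cabs _ ^+ 2); rewrite /psum.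
  rewrite -(pair_bigA _ (fun ij k => nu (ij, k) * F (q (ij, k) z))) /=.
  rewrite -(pair_bigA _ (fun i j => \sum_k nu (i, j, k) * F (q (i, j, k) z))) /=.
  apply: eq_bigr => i _; rewrite mulr_sumr; apply: eq_bigr => j _.
  by rewrite !mulr_sumr; apply: eq_bigr => k _; rewrite /nu /q /=; ring.
move=> h; have := amplification_trace nu qact Forth.
set Tr := \sum_w _ => h'.
have -> : nsq F ^+ 3 * kap ^+ 6 * (\sum_(w : I * I * I) \sum_(w' : I * I * I) \sum_z
   \sum_(t | fstab F t) (q w z == act t (q w' z)))%:R = nsq F ^+ 2 * (nsq F * Tr).
  suff -> : Tr = kap ^+ 6 * (\sum_(w : I * I * I) \sum_(w' : I * I * I) \sum_z
     \sum_(t | fstab F t) (q w z == act t (q w' z)))%:R by ring.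
  rewrite natr_sum mulr_sumr; apply: eq_bigr => w _.
  rewrite natr_sum mulr_sumr; apply: eq_bigr => w' _.
  by congr (_ * _); rewrite /nu !cabsM !cabsJ !ckap; ring.
apply: le_trans (ler_wpM2l (ler0n _ _) h) _.
have {}h' := ler_wpM2l (exprn_ge0 2 (nsq_ge0 F)) h'.
apply: le_trans h'; rewrite le_eqVlt; apply/orP; left; apply/eqP; ring.
Qed.
End Amplification.

(** * Additive characters modulo [c] *)

Section E2pi.
Variable R : realType.
Implicit Types s t : R.

Lemma e2piD s t : e2pi (s + t) = e2pi s * e2pi t.
Proof.
rewrite /e2pi mulrDr cosD sinD; apply/eqP; rewrite eq_complex /=.
by rewrite eqxx /= addrC [X in X + _]mulrC eqxx.
Qed.

Lemma e2pi0 : e2pi 0 = 1 :> R[i].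
Proof. by rewrite /e2pi mulr0 cos0 sin0. Qed.

Lemma cabs_e2pi t : cabs (e2pi t) = 1.
Proof. by rewrite /e2pi /cabs /= cos2Dsin2 sqrtr1. Qed.

Lemma e2pi1 : e2pi 1 = 1 :> R[i].
Proof. by rewrite /e2pi mulr1 mulr_natl cos2pi sin2pi. Qed.

Lemma e2pi_nat n : e2pi n%:R = 1 :> R[i].
Proof. by elim: n => [|n IH]; rewrite ?e2pi0 // -natr1 e2piD IH e2pi1 mulr1. Qed.

Lemma e2pi_eq1 t : 0 <= t < 1 -> e2pi t = 1 -> t = 0.
Proof.
move=> /andP[t0 t1] [] + _.
have -> : 2 * pi * t = (pi * t) *+ 2 by rewrite mulr2n; ring.
rewrite cos_mulr2n => h.
have hs : sin (pi * t) ^+ 2 = 0 by have := cos2Dsin2 (pi * t); move: h; rewrite mulr2n; lra.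
apply/eqP; case: eqVneq => // tn0.
have : 0 < sin (pi * t).
  have tp : 0 < t by rewrite lt_def tn0.
  by have p0 := pi_gt0 R; apply: sin_gt0_pi; apply/andP; split; nra.
by move/eqP: hs; rewrite sqrf_eq0 => /eqP ->; rewrite ltxx.
Qed.

Lemma Re_e2pi_ge t : 0 <= t -> 8 * t <= 1 -> 1 / 2 <= complex.Re (e2pi t).
Proof.
move=> t0 t8; rewrite /e2pi /=.
have p0 := pi_gt0 R; have p1 := mulr_ge0 (ltW p0) t0.
have p2 : 0 <= pi * (1 - 8 * t) :> R by rewrite mulr_ge0 ?subr_ge0 // ltW.
rewrite -mulrA; set u := pi * t in p1 *.
have {}p2 : 8 * u <= pi by move: p2; rewrite /u; nra.
have h1 : 0 <= cos (2 * u).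
  by apply: cos_ge0_pihalf; apply/andP; split; lra.
have h2 : 0 <= cos ((2 * u) *+ 2).
  have -> : (2 * u) *+ 2 = 4 * u by ring.
  by apply: cos_ge0_pihalf; apply/andP; split; lra.
rewrite cos_mulr2n in h2.
have h3 : 1 <= 2 * cos (2 * u) ^+ 2 by move: h2; lra.
by nra.
Qed.
End E2pi.

Section Zc.
Variables (R : realType) (c : nat).
Hypothesis c_gt1 : (1 < c)%N.
Local Notation Zc := 'Z_c.
Implicit Types x y : Zc.

Lemma Zc_natr_eq0 n : ((n%:R : Zc) == 0) = (c %| n)%N.
Proof. by rewrite -val_eqE /= val_Zp_nat. Qed.

Lemma Zc_valK x : (x : nat)%:R = x.
Proof. exact: natr_Zp. Qed.

Lemma Zc_ltc x : (x < c)%N.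
Proof. by case: x => x /=; rewrite Zp_cast. Qed.

Lemma Zc_mul_eq0 n x : (n%:R * x == 0) = (c %| n * x)%N.
Proof. by rewrite -[x in LHS]Zc_valK -natrM Zc_natr_eq0. Qed.

Lemma Zc_unitE x : (x \is a GRing.unit) = coprime c x.
Proof. by rewrite -[x in LHS]Zc_valK unitZpE. Qed.

Lemma Zc_card : #|Zc| = c.
Proof. by rewrite card_ord Zp_cast. Qed.

Lemma card_unit_Zc : #|{: {unit Zc}}| = totient c.
Proof. by rewrite -card_units_Zp ?cardsT // ltnW. Qed.

Lemma sum_Zc (V : nmodType) (F : nat -> V) : \sum_(x : Zc) F x = \sum_(0 <= k < c) F k.
Proof.
by rewrite -[in RHS](Zp_cast c_gt1) big_mkord.
Qed.

Lemma sum_dvdn_nat k n : (0 < k)%N -> (\sum_(0 <= x < n * k) (k %| x) = n)%N.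
Proof.
move=> k0; elim: n => [|n IH]; first by rewrite mul0n big_geq.
rewrite mulSnr (@big_cat_nat _ _ _ (n * k)) ?leq_addr //= IH.
rewrite -{1}[(n * k)%N]add0n big_addn addKn.
case: k k0 {IH} => // k _; rewrite big_nat_recl // add0n dvdn_mull //=.
rewrite big_nat_cond big1 ?addn1 // => i /andP[/andP[_ ik] _].
by rewrite dvdn_addl ?dvdn_mull // gtnNdvd.
Qed.

Lemma card_ann n : (n %| c)%N -> #|[pred x : Zc | n%:R * x == 0]| = n.
Proof.
move=> /dvdnP[k ck]; have c0 : (0 < c)%N by exact: ltnW.
have k0 : (0 < k)%N by move: c0; rewrite ck muln_gt0 => /andP[].
have n0 : (0 < n)%N by move: c0; rewrite ck muln_gt0 => /andP[].
have h m : (c %| n * m)%N = (k %| m)%N by rewrite ck mulnC dvdn_pmul2l.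
rewrite -sum1_card big_mkcond /=.
transitivity (\sum_(x : Zc) (k %| x)%N : nat).
  by apply: eq_bigr => x _; rewrite inE Zc_mul_eq0 h; case: (_ %| _)%N.
by rewrite (sum_Zc (fun x : nat => nat_of_bool (k %| x)%N)) ck mulnC sum_dvdn_nat.
Qed.

Lemma ann_mul n x y : (n %| c)%N -> n%:R * x = 0 -> (c %/ n)%:R * y = 0 -> x * y = 0.
Proof.
move=> nc; have n0 : (0 < n)%N by case: n nc => //; rewrite dvd0n => /eqP h; move: c_gt1; rewrite h.
have k0 : (0 < c %/ n)%N by rewrite divn_gt0 // dvdn_leq // ltnW.
have ce : (c = c %/ n * n)%N by rewrite divnK.
have h1 m : (c %| n * m)%N = (c %/ n %| m)%N by rewrite {1}ce mulnC dvdn_pmul2l.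
have h2 m : (c %| c %/ n * m)%N = (n %| m)%N by rewrite {1}ce dvdn_pmul2l.
move=> /eqP; rewrite Zc_mul_eq0 h1 => hx /eqP; rewrite Zc_mul_eq0 h2 => hy.
by apply/eqP; rewrite -[x]Zc_valK Zc_mul_eq0; move: (dvdn_mul hx hy); rewrite -ce.
Qed.

Lemma annP n x : (n %| c)%N -> n%:R * x = 0 -> exists y, x = (c %/ n)%:R * y.
Proof.
move=> nc; have n0 : (0 < n)%N by case: n nc => //; rewrite dvd0n => /eqP h; move: c_gt1; rewrite h.
have ce : (c = c %/ n * n)%N by rewrite divnK.
have h1 m : (c %| n * m)%N = (c %/ n %| m)%N by rewrite {1}ce mulnC dvdn_pmul2l.
move=> /eqP; rewrite Zc_mul_eq0 h1 => /dvdnP[t xt].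
by exists t%:R; rewrite -natrM mulnC -xt Zc_valK.
Qed.

Definition psi x : R[i] := e2pi ((x : nat)%:R / c%:R).

Lemma c_neq0 : (c%:R : R) != 0.
Proof. by rewrite pnatr_eq0 -lt0n ltnW. Qed.

Lemma psi_nat n : psi n%:R = e2pi (n%:R / c%:R).
Proof.
rewrite /psi val_Zp_nat // [in RHS](divn_eq n c) natrD mulrDl natrM.
by rewrite mulfK ?c_neq0 // e2piD e2pi_nat mul1r.
Qed.

Lemma psiD x y : psi (x + y) = psi x * psi y.
Proof. by rewrite -[x]Zc_valK -[y]Zc_valK -natrD !psi_nat natrD mulrDl e2piD. Qed.

Lemma psi0 : psi 0 = 1.
Proof. by rewrite /psi mul0r e2pi0. Qed.

Lemma cabs_psi x : cabs (psi x) = 1.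
Proof. exact: cabs_e2pi. Qed.

Lemma psi_mulJ x : psi x * conjc (psi x) = 1.
Proof. by rewrite -sqr_cabs cabs_psi expr1n. Qed.

Lemma psiN x : psi (- x) = conjc (psi x).
Proof. by rewrite -[LHS]mul1r -(psi_mulJ x) mulrAC -psiD subrr psi0 mul1r. Qed.

Lemma psi_eq1 x : psi x = 1 -> x = 0.
Proof.
move=> /e2pi_eq1 h; apply/eqP; rewrite -val_eqE /=.
have c0 : (0 : R) < c%:R by rewrite ltr0n ltnW.
have /h/eqP : 0 <= ((x : nat)%:R / c%:R : R) < 1.
  by rewrite divr_ge0 ?ler0n //= ltr_pdivrMr // mul1r ltr_nat Zc_ltc.
by rewrite mulf_eq0 invr_eq0 (negbTE c_neq0) orbF pnatr_eq0.
Qed.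

Lemma sum_psi x : \sum_y psi (x * y) = (x == 0)%:R * c%:R.
Proof.
have [->|x0] := eqVneq x 0.
  by rewrite mul1r (eq_bigr (fun=> 1)) ?sumr_const ?Zc_card // => y _; rewrite mul0r psi0.
rewrite mul0r; set S := \sum_y _.
have : psi x * S = S.
  rewrite mulr_sumr [RHS](reindex (fun y => 1 + y)) /=; last first.
    by exists (fun y => -1 + y) => y _; rewrite ?addKr ?addNKr.
  by apply: eq_bigr => y _; rewrite -psiD mulrDr mulr1.
move=> /eqP; rewrite -subr_eq0 -[X in _ - X]mul1r -mulrBl mulf_eq0 => /orP[|/eqP //].
by rewrite subr_eq0 => /eqP/psi_eq1 h; rewrite h eqxx in x0.
Qed.
End Zc.

Section CoprimeSum.
Variable R : realType.

Lemma sum_nat_mul (V : nmodType) (F : nat -> V) m n :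
  \sum_(0 <= t < m * n) F t = \sum_(0 <= s < n) \sum_(0 <= k < m) F (s + n * k)%N.
Proof.
elim: m => [|m IH].
  rewrite mul0n big_geq // big1 // => s _; by rewrite big_geq.
rewrite mulSnr (@big_cat_nat _ _ _ (m * n)) ?leq_addr //= IH.
rewrite -{1}[(m * n)%N]add0n big_addn addKn -big_split /=.
by apply: eq_bigr => s _; rewrite big_nat_recr //= mulnC.
Qed.

Lemma sum_e2pi_nat (p : nat) (mu : nat) : (0 < p)%N -> ~~ (p %| mu)%N ->
  \sum_(0 <= k < p) e2pi ((mu * k)%:R / p%:R : R) = 0.
Proof.
move=> p0 hp; have p1 : (1 < p)%N by case: p p0 hp => [|[|p]] //; rewrite dvd1n.
rewrite -(@sum_Zc p p1 _ (fun k => e2pi ((mu * k)%:R / p%:R : R))).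
rewrite (eq_bigr (fun y : 'Z_p => psi R (mu%:R * y))); last first.
  by move=> y _; rewrite -[y in RHS]Zc_valK -natrM psi_nat.
by rewrite sum_psi // Zc_natr_eq0 // (negbTE hp) mul0r.
Qed.

Definition cop_sum (b mu A0 A1 : nat) : R[i] :=
  \sum_(0 <= t < b) (coprime b (A0 + A1 * t))%:R * e2pi ((mu * t)%:R / b%:R : R).

Lemma periodic_sum_eq0 (p b' mu : nat) (g : nat -> R[i]) :
  (0 < p)%N -> (0 < b')%N -> ~~ (p %| mu)%N -> (forall s k, g (s + b' * k)%N = g s) ->
  \sum_(0 <= t < p * b') g t * e2pi ((mu * t)%:R / (p * b')%:R : R) = 0.
Proof.
move=> p0 b0 pmu gper; rewrite sum_nat_mul big1 // => s _.
have pn0 : (p%:R : R) != 0 by rewrite pnatr_eq0 -lt0n.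
have bn0 : (b'%:R : R) != 0 by rewrite pnatr_eq0 -lt0n.
rewrite (eq_bigr (fun k => g s * e2pi ((mu * s)%:R / (p * b')%:R) * e2pi ((mu * k)%:R / p%:R : R))).
  by rewrite -mulr_sumr sum_e2pi_nat // mulr0.
move=> k _; rewrite gper -mulrA -e2piD; congr (_ * e2pi _).
rewrite mulnDr natrD mulrDl; congr (_ + _).
by rewrite !natrM; field; rewrite pn0 bn0.
Qed.

(* A Ramanujan-type sum along an arithmetic progression: removing a prime [p] from the
   modulus either kills the sum or reproduces a sum of the same shape. *)
Lemma cabs_cop_sum_le1 b mu A0 A1 : (0 < b)%N -> coprime b mu -> cabs (cop_sum b mu A0 A1) <= 1.
Proof.
elim/ltn_ind: b mu A0 A1 => b IH mu A0 A1 b0 bmu.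
have [b1|b1] := leqP b 1.
  have {b1}-> : b = 1%N by apply/eqP; rewrite eqn_leq b1 b0.
  by rewrite /cop_sum big_nat1 coprime1n mul1r cabs_e2pi.
have pr := pdiv_prime b1; set p := pdiv b in pr; have p0 := prime_gt0 pr.
have /dvdnP[b' bE] : (p %| b)%N by exact: pdiv_dvd.
have b'0 : (0 < b')%N by move: b0; rewrite bE muln_gt0 => /andP[].
have b'b : (b' < b)%N by rewrite bE ltn_Pmulr // prime_gt1.
rewrite mulnC in bE.
have pmu : ~~ (p %| mu)%N.
  by rewrite -prime_coprime //; apply: coprime_dvdl bmu; rewrite bE dvdn_mulr.
have b'mu : coprime b' mu by apply: coprime_dvdl bmu; rewrite bE dvdn_mull.
have gper s k : coprime b' (A0 + A1 * (s + b' * k)) = coprime b' (A0 + A1 * s).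
  rewrite mulnDr addnA mulnCA addnC -[LHS]coprime_modr.
  by rewrite [(b' * _)%N]mulnC modnMDl coprime_modr.
have zero : \sum_(0 <= t < b) (coprime b' (A0 + A1 * t))%:R * e2pi ((mu * t)%:R / b%:R : R) = 0.
  by rewrite bE periodic_sum_eq0 // => s k; rewrite gper.
have [pb'|pb'] := boolP (p %| b')%N.
  suff -> : cop_sum b mu A0 A1 = 0 by rewrite cabs0 ler01.
  rewrite -[RHS]zero; apply: eq_bigr => t _; congr (_%:R * _).
  rewrite bE coprimeMl andbC; case: (boolP (coprime b' _)) => //= h.
  by rewrite (coprime_dvdl pb' h).
have split : cop_sum b mu A0 A1 = - \sum_(0 <= t < b | (p %| A0 + A1 * t)%N)
    (coprime b' (A0 + A1 * t))%:R * e2pi ((mu * t)%:R / b%:R : R).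
  rewrite -[LHS](subr0) -[X in _ - X]zero -sumrB [in RHS]big_mkcond -sumrN.
  apply: eq_bigr => t _; rewrite bE coprimeMl prime_coprime // -bE.
  by case: (p %| _)%N => /=; rewrite ?mul0r ?sub0r ?subrr ?oppr0.
rewrite split cabsN.
have [pA1|pA1] := boolP (p %| A1)%N.
  case: (boolP (p %| A0)%N) => pA0.
    rewrite (eq_bigl predT) ?zero ?cabs0 ?ler01 // => t.
    by rewrite dvdn_addr // dvdn_mulr.
  rewrite big1_seq ?cabs0 ?ler01 // => t /andP[h _]; move: h.
  by rewrite dvdn_addl ?(negbTE pA0) // dvdn_mulr.
have cA1 : coprime A1 p by rewrite coprime_sym prime_coprime.
have [t0 t0p ht0] : exists2 t0, (t0 < p)%N & (p %| A0 + A1 * t0)%N.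
  have A10 : (0 < A1)%N by case: (A1) pA1 => //; rewrite dvdn0.
  have [u v uv _] := egcdnP p A10.
  exists ((u * (p - 1) * A0) %% p)%N; first by rewrite ltn_mod.
  rewrite /dvdn -modnDmr modnMmr modnDmr.
  move: cA1 uv; rewrite /coprime => /eqP -> uv.
  have -> : (A0 + A1 * (u * (p - 1) * A0) = (v * (p - 1) * A0 + A0) * p)%N.
    have -> : (A1 * (u * (p - 1) * A0) = (u * A1) * ((p - 1) * A0))%N by ring.
    rewrite uv; have [p' ->] : exists p', p = p'.+1 by exists p.-1; rewrite prednK.
    by rewrite subn1 /=; ring.
  by rewrite modnMl.
rewrite big_mkcond bE mulnC sum_nat_mul (bigD1_seq t0) /= ?iota_uniq ?mem_index_iota //.
rewrite [X in _ + X]big1_seq ?addr0; last first.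
  move=> s; rewrite mem_index_iota /= => /andP[st0 sp]; apply: big1 => k _.
  case: ifP => // h; case/eqP: st0.
  have hs : (p %| A0 + A1 * s)%N.
    by move: h; rewrite mulnDr addnA dvdn_addl // mulnCA dvdn_mulr.
  apply/eqP; rewrite -(modn_small sp) -(modn_small t0p).
  have : (A1 * s == A1 * t0 %[mod p])%N.
    by rewrite -(eqn_modDl A0) (eqP hs) (eqP ht0).
  have cpA1 : coprime p A1 by rewrite coprime_sym.
  wlog le : s t0 {sp t0p ht0 h hs} / (t0 <= s)%N => [hw|].
    by case/orP: (leq_total s t0) => le e; [rewrite eq_sym; apply: hw => //; rewrite eq_sym|apply: hw].
  by rewrite !eqn_mod_dvd ?leq_mul2l ?le ?orbT // -mulnBr Gauss_dvdr.
have bn0 : (b'%:R : R) != 0 by rewrite pnatr_eq0 -lt0n.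
have pn0 : (p%:R : R) != 0 by rewrite pnatr_eq0 -lt0n.
rewrite (eq_bigr (fun k => e2pi ((mu * t0)%:R / (b' * p)%:R : R) *
   ((coprime b' ((A0 + A1 * t0) + (A1 * p) * k))%:R * e2pi ((mu * k)%:R / b'%:R)))); last first.
  move=> k _.
  have -> : (A0 + A1 * (t0 + p * k) = A0 + A1 * t0 + A1 * p * k)%N by ring.
  rewrite dvdn_addl ?ht0; last by rewrite -mulnA dvdn_mull // dvdn_mulr.
  rewrite mulrCA -e2piD; congr (_ * e2pi _).
  by rewrite mulnDr natrD mulrDl; congr (_ + _); rewrite !natrM; field; rewrite pn0 bn0.
rewrite -mulr_sumr cabsM cabs_e2pi mul1r; exact: IH.
Qed.
End CoprimeSum.

(** * Framed vectors and their Fourier components *)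

Section Vectors.
Variable A : finComUnitRingType.
Local Notation vec := (A * A)%type.
Implicit Types (v w : vec) (x y : A).

Definition vdet v w := v.1 * w.2 - v.2 * w.1.
Definition vlc x v y w : vec := (x * v.1 + y * w.1, x * v.2 + y * w.2).
Definition primv v := [exists w, vdet v w == 1].

Lemma primvP v : reflect (exists w, vdet v w = 1) (primv v).
Proof. by apply: (iffP existsP) => -[w h]; exists w; apply/eqP. Qed.

Lemma vdetvv v : vdet v v = 0. Proof. by rewrite /vdet mulrC subrr. Qed.

Lemma vdet_lcl x v y w u : vdet (vlc x v y w) u = x * vdet v u + y * vdet w u.
Proof. by rewrite /vdet /=; ring. Qed.

Lemma vdet_lcr x v y w u : vdet u (vlc x v y w) = x * vdet u v + y * vdet u w.
Proof. by rewrite /vdet /=; ring. Qed.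

Lemma vec_basis v w0 w : vdet v w0 = 1 -> vlc (vdet w w0) v (vdet v w) w0 = w.
Proof.
case: v w0 w => [v1 v2] [w1 w2] [u1 u2]; rewrite /vlc /vdet /= => h.
by congr pair; [rewrite -[RHS]mul1r -h|rewrite -[RHS]mul1r -h]; ring.
Qed.

Lemma sum_basis (V : nmodType) (H : vec -> V) v w0 : vdet v w0 = 1 ->
  \sum_w H w = \sum_x \sum_y H (vlc x v y w0).
Proof.
move=> h; rewrite pair_big /=.
rewrite (reindex (fun p : vec => vlc p.1 v p.2 w0)) //=.
exists (fun w => (vdet w w0, vdet v w)) => [[x y] _|w _] /=; last exact: vec_basis.
by rewrite vdet_lcl vdet_lcr !vdetvv h; congr pair; ring.
Qed.

Lemma primv_eq0 v x : primv v -> x * v.1 = 0 -> x * v.2 = 0 -> x = 0.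
Proof.
move=> /primvP[w h] h1 h2; rewrite -[x]mulr1 -h /vdet mulrBr !mulrA h1 h2.
by ring.
Qed.

Lemma primv_unit2 v : v.2 \is a GRing.unit -> primv v.
Proof. by move=> u; apply/primvP; exists (- v.2^-1, 0); rewrite /vdet /= mulr0 mulrN mulrV // sub0r opprK. Qed.

End Vectors.

Section Framed.
Variables (R : realType) (c D : nat).
Hypotheses (c_gt1 : (1 < c)%N) (Dc : (D %| c)%N).
Local Notation Zc := 'Z_c.
Local Notation vec := (Zc * Zc)%type.
Implicit Types (v w : vec) (x y a : Zc) (z : vec * vec).

Let k0 : Zc := (c %/ D)%:R.
Let c0 : (0 < c)%N. Proof. exact: ltnW. Qed.
Let D0 : (0 < D)%N. Proof. exact: dvdn_gt0 Dc. Qed.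
Let kD : (c %/ D * D = c)%N. Proof. by rewrite divnK. Qed.
Let kc : (c %/ D %| c)%N. Proof. by rewrite -{2}kD dvdn_mulr. Qed.
Definition inY z := [&& primv z.1, D%:R * z.2.1 == 0, D%:R * z.2.2 == 0
  & vdet z.1 z.2 == (c %/ D)%:R].

Lemma D_k0 : D%:R * k0 = 0.
Proof. by apply/eqP; rewrite -natrM Zc_natr_eq0 // mulnC kD. Qed.

Lemma inY_basis v w : inY (v, w) -> exists2 w1, vdet v w1 = 1 & w = (k0 * w1.1, k0 * w1.2).
Proof.
move=> /and4P[/primvP[w0 h] /= /eqP d1 /eqP d2 /eqP dt].
have : D%:R * vdet w w0 = 0 by rewrite /vdet mulrBr !mulrA d1 d2 !mul0r subrr.
move=> /(annP c_gt1 Dc) [x hx].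
exists (vlc x v 1 w0); first by rewrite vdet_lcr vdetvv h; ring.
by rewrite -{1}(vec_basis w h) hx dt /vlc /= /k0; congr pair; ring.
Qed.

Definition shiftY (j : Zc) z : vec * vec := (vlc 1 z.1 j z.2, z.2).

Lemma shiftYD i j z : shiftY i (shiftY j z) = shiftY (i + j) z.
Proof. by rewrite /shiftY /vlc /=; congr (_, _); congr (_, _); ring. Qed.

Lemma shiftY0 z : shiftY 0 z = z.
Proof. by case: z => [[a b] w]; rewrite /shiftY /vlc /= !mul1r !mul0r !addr0. Qed.

Lemma inY_shift j z : inY z -> inY (shiftY j z).
Proof.
case: z => v w h; have /and4P[_ /= d1 d2 /eqP dt] := h.
have [w1 hw1 we] := inY_basis h.
rewrite /inY /= d1 d2 vdet_lcl vdetvv dt mul1r mulr0 addr0 eqxx !andbT.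
apply/primvP; exists w1; rewrite vdet_lcl hw1.
have -> : vdet w w1 = 0 by rewrite we /vdet /=; ring.
by ring.
Qed.

Lemma sum_shiftY (V : nmodType) (G : vec * vec -> V) j :
  \sum_(z | inY z) G (shiftY j z) = \sum_(z | inY z) G z.
Proof.
rewrite [RHS](reindex (shiftY j)) /=; last first.
  by exists (shiftY (- j)) => z _; rewrite shiftYD ?addNr ?addrN shiftY0.
apply: eq_bigl => z; apply/idP/idP => [|h]; first exact: inY_shift.
by rewrite -[z]shiftY0 -(addNr j) -shiftYD inY_shift.
Qed.

Lemma sum_fiberY (V : nmodType) (H : vec -> V) v w0 : vdet v w0 = 1 ->
  \sum_(w | inY (v, w)) H w = \sum_(x | D%:R * x == 0) H (vlc x v k0 w0).
Proof.
move=> h; have pv : primv v by apply/primvP; exists w0.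
rewrite big_mkcond (sum_basis _ h) [RHS]big_mkcond; apply: eq_bigr => x _.
rewrite (bigD1 k0) //= big1 ?addr0 => [|y yk].
  rewrite /inY pv /= !mulrDr ![D%:R * (k0 * _)]mulrA D_k0 !mul0r !addr0.
  rewrite vdet_lcr vdetvv h mulr0 add0r mulr1 eqxx andbT.
  have -> // : (D%:R * (x * v.1) == 0) && (D%:R * (x * v.2) == 0) = (D%:R * x == 0).
  rewrite !mulrA; apply/andP/eqP => [[/eqP h1 /eqP h2]|->]; last by rewrite !mul0r.
  exact: primv_eq0 pv h1 h2.
by rewrite /inY /= vdet_lcr vdetvv h mulr0 add0r mulr1 (negbTE yk) !andbF.
Qed.

Lemma sum_inY_fst (V : nzRingType) (G : vec -> V) : (forall v, ~~ primv v -> G v = 0) ->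
  \sum_(z | inY z) G z.1 = D%:R * \sum_v G v.
Proof.
move=> G0.
transitivity (\sum_v \sum_(w | inY (v, w)) G v).
  by rewrite pair_big_dep /=; apply: eq_big => [[v w]|[v w]].
rewrite mulr_sumr; apply: eq_bigr => v _.
have [/primvP[w0 h]|npv] := boolP (primv v); last by rewrite big1 ?G0 ?mulr0.
by rewrite (sum_fiberY (fun=> G v) h) sumr_const card_ann // mulr_natl.
Qed.

Definition Fhat (a : Zc) (A : vec -> R[i]) z : R[i] :=
  \sum_(j : Zc) psi R (k0 * a * j) * A (vlc 1 z.1 j z.2).

Lemma Fhat_shift a A j z : Fhat a A (shiftY j z) = psi R (- (k0 * a * j)) * Fhat a A z.
Proof.
rewrite /Fhat mulr_sumr [RHS](reindex (fun i => i + j)) /=; last first.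
  by exists (fun i => i - j) => i _; rewrite ?addrK ?subrK.
apply: eq_bigr => i _; rewrite mulrA -psiD //; congr (psi R _ * A _); first by ring.
by rewrite /vlc /=; congr pair; ring.
Qed.

Lemma eq_Fhat a a' A : k0 * a = k0 * a' -> Fhat a A =1 Fhat a' A.
Proof. by move=> h z; rewrite /Fhat h. Qed.

Lemma Fhat_orth a a' A B : k0 * a != k0 * a' ->
  \sum_(z | inY z) Fhat a A z * conjc (Fhat a' B z) = 0.
Proof.
move=> ne; set S := \sum_(z | _) _.
have : psi R (k0 * (a' - a)) * S = S.
  rewrite -[RHS](sum_shiftY (fun z => Fhat a A z * conjc (Fhat a' B z)) 1) mulr_sumr.
  apply: eq_bigr => z _.
  rewrite !Fhat_shift conjcM -psiN // opprK mulrACA -psiD //; congr (psi R _ * _); ring.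
move=> /eqP; rewrite -subr_eq0 -[X in _ - X]mul1r -mulrBl mulf_eq0 => /orP[|/eqP //].
rewrite subr_eq0 => /eqP/(psi_eq1 c_gt1)/eqP.
by rewrite mulrBr subr_eq0 eq_sym (negbTE ne).
Qed.

Lemma Fhat_parseval (b : nat) A B :
  \sum_(a : Zc) \sum_(z | inY z) Fhat (b%:R * a) A z * conjc (Fhat (b%:R * a) B z) =
  (c * c)%:R * \sum_(z | inY z) A z.1 *
     conjc (\sum_(r | (c %/ D * b)%:R * r == 0) B (vlc 1 z.1 r z.2)).
Proof.
rewrite exchange_big /=.
have h z : \sum_(a : Zc) Fhat (b%:R * a) A z * conjc (Fhat (b%:R * a) B z) =
   c%:R * \sum_j A (shiftY j z).1 *
     conjc (\sum_(r | (c %/ D * b)%:R * r == 0) B (vlc 1 (shiftY j z).1 r z.2)).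
  transitivity (\sum_(i : Zc) \sum_(j : Zc) A (vlc 1 z.1 i z.2) * conjc (B (vlc 1 z.1 j z.2)) *
     \sum_(a : Zc) psi R ((c %/ D * b)%:R * (i - j) * a)).
    under eq_bigr do rewrite /Fhat mulr_suml.
    rewrite exchange_big /=; apply: eq_bigr => i _.
    under eq_bigr do rewrite conjc_sum mulr_sumr.
    rewrite exchange_big /=; apply: eq_bigr => j _.
    rewrite mulr_sumr; apply: eq_bigr => a _.
    rewrite conjcM -psiN //.
    have -> : psi R ((c %/ D * b)%:R * (i - j) * a) =
       psi R (k0 * (b%:R * a) * i) * psi R (- (k0 * (b%:R * a) * j)).
      by rewrite -psiD //; congr (psi R _); rewrite natrM /k0; ring.
    by ring.
  rewrite mulr_sumr; apply: eq_bigr => i _.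
  rewrite conjc_sum !mulr_sumr [RHS]big_mkcond (reindex (fun r => i + r)) /=; last first.
    by exists (fun r => - i + r) => r _; rewrite ?addKr ?addNKr.
  apply: eq_bigr => r _; rewrite sum_psi //.
  have -> : (c %/ D * b)%:R * (i - (i + r)) = - ((c %/ D * b)%:R * r) :> Zc by ring.
  rewrite oppr_eq0; case: eqP => _; last by rewrite mul0r mulr0.
  rewrite mul1r mulrC; congr (_ * (_ * conjc (B _))).
  by rewrite /shiftY /vlc /=; congr pair; ring.
under eq_bigr do rewrite h.
rewrite -mulr_sumr exchange_big /= [(c * c)%:R]natrM -mulrA; congr (_ * _).
rewrite (eq_bigr (fun=> \sum_(z | inY z) A z.1 *
     conjc (\sum_(r | (c %/ D * b)%:R * r == 0) B (vlc 1 z.1 r z.2)))).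
  by rewrite sumr_const Zc_card // mulr_natl.
move=> j _; rewrite -[RHS](sum_shiftY _ j); by apply: eq_bigr.
Qed.

Lemma inY_ann z r : inY z -> k0 * r = 0 -> vlc 1 z.1 r z.2 = z.1.
Proof.
case: z => [[v1 v2] [w1 w2]] /and4P[_ /eqP d1 /eqP d2 _] kr; rewrite /vlc /=.
have h (x : Zc) : D%:R * x = 0 -> r * x = 0 by move=> dw; rewrite mulrC; apply: (ann_mul c_gt1 Dc dw).
by rewrite !mul1r !h // !addr0.
Qed.

Lemma Fhat_plancherel A B : (forall v, ~~ primv v -> A v = 0) ->
  \sum_(a : Zc) \sum_(z | inY z) Fhat a A z * conjc (Fhat a B z) =
  (c ^ 3)%:R * \sum_v A v * conjc (B v).
Proof.
move=> A0; have := Fhat_parseval 1 A B.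
under eq_bigr do under eq_bigr do rewrite !mul1r.
move=> ->; rewrite (eq_bigr (fun z => (c %/ D)%:R * (A z.1 * conjc (B z.1)))).
  rewrite -mulr_sumr (@sum_inY_fst _ (fun v => A v * conjc (B v))); last first.
    by move=> v /A0 ->; rewrite mul0r.
  by rewrite !mulrA -!natrM -mulnA kD !expnS expn0 muln1 mulnA.
move=> z Yz; rewrite muln1 (eq_bigr (fun=> B z.1)); last first.
  by move=> r /eqP kr; rewrite inY_ann.
rewrite sumr_const card_ann // -[in LHS]mulr_natl conjcM conjc_nat; ring.
Qed.

End Framed.

Section Energy.
Variables (R : realType) (c D : nat).
Hypotheses (c_gt1 : (1 < c)%N) (Dc : (D %| c)%N).
Local Notation Zc := 'Z_c.
Local Notation vec := (Zc * Zc)%type.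
Implicit Types (v w : vec) (x y a : Zc) (z : vec * vec).

Let k0 : Zc := (c %/ D)%:R.
Let c0 : (0 < c)%N. Proof. exact: ltnW. Qed.
Let D0 : (0 < D)%N. Proof. exact: dvdn_gt0 Dc. Qed.
Let kD : (c %/ D * D = c)%N. Proof. by rewrite divnK. Qed.

Definition Afun (I : seq nat) (al : nat -> R[i]) (f : nat -> Zc) v : R[i] :=
  if v.2 \is a GRing.unit then \sum_(m <- I) al m * psi R (f m * (v.1 / v.2)) else 0.

Lemma sum_psi_freq (I : seq nat) (be : nat -> R[i]) (f : nat -> Zc) : uniq I ->
  {in I &, injective f} ->
  \sum_(x : Zc) cabs (\sum_(m <- I) be m * psi R (f m * x)) ^+ 2 =
  c%:R * \sum_(m <- I) cabs (be m) ^+ 2.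
Proof.
move=> uI finj; apply: (fmorph_inj (real_complex R)).
rewrite rmorph_sum rmorphM rmorph_nat rmorph_sum /=.
transitivity (\sum_(m <- I) \sum_(n <- I) be m * conjc (be n) * \sum_(x : Zc) psi R ((f m - f n) * x)).
  under eq_bigr do rewrite sqr_cabs conjc_sum mulr_suml.
  rewrite exchange_big; apply: eq_bigr => m _ /=.
  under eq_bigr do rewrite mulr_sumr.
  rewrite exchange_big; apply: eq_bigr => n _ /=.
  rewrite mulr_sumr; apply: eq_bigr => x _.
  by rewrite conjcM -psiN // mulrBl psiD //; ring.
rewrite mulr_sumr big_seq [RHS]big_seq; apply: eq_bigr => m mI.
rewrite (bigD1_seq m) //= [X in _ + X]big_seq_cond [X in _ + X]big1 ?addr0 => [|n /andP[nI nm]].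
  by rewrite sum_psi // subrr eqxx mul1r sqr_cabs mulrC.
rewrite sum_psi // subr_eq0; case: eqP => [/finj e|_]; last by rewrite mul0r mulr0.
by rewrite e ?eqxx in nm.
Qed.

Lemma sum_multiples (V : numDomainType) (b : nat) (g : Zc -> V) : (b %| c)%N ->
  \sum_(x : Zc) g (b%:R * x) = b%:R * \sum_(x : Zc | (b %| x)%N) g x.
Proof.
move=> bc.
transitivity (\sum_(y : Zc) \sum_(x : Zc | b%:R * x == y) g y).
  rewrite (exchange_big_dep predT) //=; apply: eq_bigr => x _.
  by rewrite (eq_bigl (pred1 (b%:R * x))) ?big_pred1_eq // => y; rewrite eq_sym.
rewrite mulr_sumr [RHS]big_mkcond; apply: eq_bigr => y _; rewrite sumr_const.
have [/dvdnP[t yt]|nby] := boolP (b %| y)%N.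
  rewrite -[LHS]mulr_natl; congr (_%:R * _).
  rewrite -[RHS](card_ann c_gt1 bc) -[RHS](card_imset _ (addrI t%:R)).
  apply: eq_card => x; apply/idP/idP => [hx|/imsetP[u hu ->]].
    have /eqP e : b%:R * x == y by exact: hx.
    apply/imsetP; exists (x - t%:R); last by rewrite addrC subrK.
    by rewrite inE mulrBr e -natrM mulnC -yt Zc_valK subrr.
  have /eqP e : b%:R * u == 0 by exact: hu.
  suff : b%:R * (t%:R + u) == y by [].
  by rewrite mulrDr e addr0 -natrM mulnC -yt Zc_valK.
rewrite (eq_card0 (A := fun x => b%:R * x == y)) // => x; apply/negP; rewrite inE => /eqP e.
case/negP: nby; rewrite -e -[x]Zc_valK -natrM val_Zp_nat //.
by rewrite /dvdn modn_dvdm // modnMr.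
Qed.

Section Frequencies.
Variables (b : nat).
Hypothesis bD : (b %| D)%N.
Let d1 := (D %/ b)%N.
Let b0 : (0 < b)%N. Proof. exact: dvdn_gt0 bD. Qed.
Let bd1 : (b * d1 = D)%N. Proof. by rewrite mulnC divnK. Qed.
Let bc : (b %| c)%N. Proof. exact: dvdn_trans Dc. Qed.
Let cbE : (c %/ b = c %/ D * d1)%N.
Proof. by rewrite -{1}kD -bd1 [(b * _)%N]mulnC mulnA mulnK. Qed.

Definition annB : pred Zc := fun r => (c %/ D * b)%:R * r == 0.

Let annBE (r : Zc) : annB r = (d1 %| r)%N.
Proof.
rewrite /annB Zc_mul_eq0 //.
have -> : (c %| c %/ D * b * r)%N = (c %/ D * b * d1 %| c %/ D * b * r)%N by rewrite -[(c %/ D * b * d1)%N]mulnA bd1 kD.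
by rewrite dvdn_pmul2l // muln_gt0 b0 divn_gt0 // dvdn_leq.
Qed.

Lemma card_annB : #|annB| = (c %/ D * b)%N.
Proof.
have kbc : (c %/ D * b %| c)%N by rewrite -{2}kD -bd1 mulnA dvdn_mulr.
by rewrite -[RHS](card_ann c_gt1 kbc); apply: eq_card => r; rewrite inE.
Qed.

Lemma annBD r s : annB r -> annB s -> annB (r + s).
Proof. by rewrite /annB mulrDr => /eqP-> /eqP->; rewrite addr0. Qed.

Lemma annBN r : annB r -> annB (- r).
Proof. by rewrite /annB mulrN => /eqP->; rewrite oppr0. Qed.

Lemma annBM r s : annB r -> annB (r * s).
Proof. by rewrite /annB mulrA => /eqP->; rewrite mul0r. Qed.

Lemma annB_sum (V : nmodType) (F : Zc -> V) :
  \sum_(r | annB r) F r = \sum_(0 <= k < c %/ D * b) F (d1 * k)%:R.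
Proof.
rewrite big_mkcond (eq_bigr (fun r : Zc => (fun n : nat => if (d1 %| n)%N then F n%:R else 0) r)); last first.
  by move=> r _; rewrite annBE Zc_valK.
rewrite (sum_Zc c_gt1 (fun n : nat => if (d1 %| n)%N then F n%:R else 0)).
have d10 : (0 < d1)%N by move: D0; rewrite -bd1 muln_gt0 => /andP[].
have cE : (c %/ D * b * d1 = c)%N by rewrite -mulnA bd1 kD.
rewrite (_ : \sum_(0 <= k < c) _ = \sum_(0 <= k < c %/ D * b * d1) if (d1 %| k)%N then F k%:R else 0); last by rewrite cE.
rewrite sum_nat_mul.
rewrite big_ltn // [X in _ + X]big_nat_cond [X in _ + X]big1 ?addr0 => [|s].
  by apply: eq_bigr => k _; rewrite add0n dvdn_mulr.
rewrite andbT => /andP[s0 sd]; apply: big1 => k _.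
by rewrite dvdn_addl ?dvdn_mulr // gtnNdvd.
Qed.

Lemma cabs_ann_psi_sum (t mu : Zc) : D%:R * t = 0 -> coprime b mu ->
  cabs (\sum_(r | annB r && (1 + r * t \is a GRing.unit)) psi R (mu * k0 * r)) <= (c %/ D)%:R.
Proof.
move=> Dt bmu; have [tau tE] := annP c_gt1 Dc Dt.
rewrite big_mkcondr annB_sum sum_nat_mul.
set A1 := (c %/ b * (tau : nat))%N.
have -> : \sum_(0 <= s < b) \sum_(0 <= k < c %/ D)
    (if 1 + (d1 * (s + b * k))%:R * t \is a GRing.unit then psi R (mu * k0 * (d1 * (s + b * k))%:R) else 0)
  = (c %/ D)%:R * cop_sum R b mu 1 A1.
  rewrite mulr_sumr; apply: eq_bigr => s _.
  rewrite (eq_bigr (fun=> (coprime b (1 + A1 * s))%:R * e2pi ((mu * s)%:R / b%:R : R))); last first.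
    move=> k _.
    have -> : (d1 * (s + b * k))%:R * t = (d1 * s)%:R * t :> Zc.
      have -> : (d1 * (s + b * k) = d1 * s + k * D)%N by rewrite -bd1; ring.
      by rewrite natrD mulrDl [(k * D)%:R]natrM -mulrA Dt mulr0 addr0.
    have -> : mu * k0 * (d1 * (s + b * k))%:R = ((mu : nat) * (c %/ b) * s)%:R.
      have -> : (d1 * (s + b * k) = d1 * s + k * D)%N by rewrite -bd1; ring.
      rewrite natrD mulrDr [(k * D)%:R]natrM.
      have -> : mu * k0 * (k%:R * D%:R) = mu * k%:R * (D%:R * k0) by ring.
      by rewrite (D_k0 c_gt1 Dc) mulr0 addr0 cbE !natrM Zc_valK /k0; ring.
    rewrite tE.
    have -> : 1 + (d1 * s)%:R * ((c %/ D)%:R * tau) = (1 + A1 * s)%:R.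
      by rewrite /A1 cbE natrD !natrM Zc_valK; ring.
    rewrite unitZpE // -{1}(divnK bc) coprimeMl [X in X && _](_ : _ = true) /=; last first.
      by rewrite /A1 -mulnA addnC -coprime_modr mulnC modnMDl coprime_modr coprimen1.
    case: ifP => _; rewrite ?mul0r // mul1r psi_nat //; congr e2pi.
    have cR : (c%:R : R) = (c %/ b)%:R * b%:R by rewrite -natrM divnK.
    rewrite !natrM cR.
    have cb0 : ((c %/ b)%:R : R) != 0 by rewrite pnatr_eq0 -lt0n divn_gt0 // dvdn_leq.
    have bn0 : (b%:R : R) != 0 by rewrite pnatr_eq0 -lt0n.
    by field; rewrite cb0 bn0.
  by rewrite sumr_const_nat subn0 -[LHS]mulr_natl.
rewrite cabsM -(@rmorph_nat _ _ (real_complex R)) cabs_real ger0_norm ?ler0n // -[X in _ <= X]mulr1.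
by rewrite ler_wpM2l ?ler0n // cabs_cop_sum_le1.
Qed.

(* The Moebius substitution [r -> r / (1 + r t)] makes the phase linear. *)
Lemma cabs_ann_psi_moebius (t mu : Zc) : D%:R * t = 0 -> coprime b mu ->
  cabs (\sum_(r | annB r && (1 + r * t \is a GRing.unit)) psi R (mu * k0 * (r / (1 + r * t))))
   <= (c %/ D)%:R.
Proof.
move=> Dt bmu.
have Dt' : D%:R * (- t) = 0 by rewrite mulrN Dt oppr0.
have key (r u : Zc) : 1 + r * u \is a GRing.unit -> (1 + r * u) * (1 + (r / (1 + r * u)) * - u) = 1.
  by move=> ur; rewrite mulrDr mulr1 mulrN mulrN mulrA mulrCA divrr // mulr1; ring.
have inv (r u : Zc) : 1 + r * u \is a GRing.unit ->
   1 + (r / (1 + r * u)) * - u \is a GRing.unit /\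
   r / (1 + r * u) / (1 + (r / (1 + r * u)) * - u) = r.
  move=> ur; have k := key r u ur.
  have u2 : 1 + (r / (1 + r * u)) * - u \is a GRing.unit.
    by apply/unitrP; exists (1 + r * u); split; [exact: k|rewrite mulrC k].
  split=> //; apply: (mulIr u2); rewrite divrK //; apply: (mulIr ur).
  by rewrite divrK // -mulrA [X in _ * X]mulrC k mulr1.
have := cabs_ann_psi_sum Dt' bmu; congr (cabs _ <= _).
have inv' (r u : Zc) : 1 + r * - u \is a GRing.unit ->
   1 + (r / (1 + r * - u)) * u \is a GRing.unit /\ r / (1 + r * - u) / (1 + (r / (1 + r * - u)) * u) = r.
  by move=> ur; have := inv r (- u) ur; rewrite opprK.
pose P1 := [set r | annB r && (1 + r * t \is a GRing.unit)].
transitivity (\sum_(r in [set r / (1 + r * t) | r in P1]) psi R (mu * k0 * r)).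
  apply: eq_bigl => r; apply/andP/imsetP => [[ar ur]|[s + ->]].
    have [u1 e1] := inv' r t ur.
    by exists (r / (1 + r * - t)); rewrite ?inE ?annBM.
  by rewrite inE => /andP[as_ us]; have [u1 _] := inv s t us; rewrite annBM.
rewrite big_imset /=; first by apply: eq_bigl => r; rewrite inE.
move=> r s; rewrite !inE => /andP[_ ur] /andP[_ us] e.
by have [_ <-] := inv r t ur; have [_ <-] := inv s t us; rewrite e.
Qed.
End Frequencies.
End Energy.

Section EnergyBound.
Variables (R : realType) (c D b : nat).
Hypotheses (c_gt1 : (1 < c)%N) (Dc : (D %| c)%N) (bD : (b %| D)%N).
Local Notation Zc := 'Z_c.
Local Notation vec := (Zc * Zc)%type.
Implicit Types (v w : vec) (x y a : Zc) (z : vec * vec).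

Let k0 : Zc := (c %/ D)%:R.
Let c0 : (0 < c)%N. Proof. exact: ltnW. Qed.
Let D0 : (0 < D)%N. Proof. exact: dvdn_gt0 Dc. Qed.
Let kD : (c %/ D * D = c)%N. Proof. by rewrite divnK. Qed.
Let kc : (c %/ D %| c)%N. Proof. by rewrite -{2}kD dvdn_mulr. Qed.
Let b0 : (0 < b)%N. Proof. exact: dvdn_gt0 bD. Qed.
Let bc : (b %| c)%N. Proof. exact: dvdn_trans Dc. Qed.

Lemma coprime_ZcM x y : coprime b (x * y)%R = coprime b x && coprime b y.
Proof.
have -> : (x * y : Zc) = ((x : nat) * (y : nat) %% c)%N :> nat.
  by rewrite -{1}[x]Zc_valK -{1}[y]Zc_valK -natrM val_Zp_nat.
by rewrite -coprime_modr modn_dvdm // coprime_modr coprimeMr.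
Qed.

Lemma coprime_Zc_unit x : x \is a GRing.unit -> coprime b x.
Proof. by rewrite Zc_unitE // => h; apply: coprime_dvdl h. Qed.

Variables (I : seq nat) (al : nat -> R[i]) (f : nat -> Zc).
Hypotheses (uI : uniq I) (finj : {in I &, injective f}).
Hypothesis fb : forall m, m \in I -> al m != 0 -> coprime b (f m).

Let A := Afun I al f.
Let S z := \sum_(r | @annB c D b r) A (vlc 1 z.1 r z.2).
Let N2 : R := \sum_(m <- I) cabs (al m) ^+ 2.
Let N2_ge0 : 0 <= N2. Proof. by apply: sumr_ge0 => m _; exact: sqr_ge0. Qed.

Let S_fiber (y t : Zc) : y \is a GRing.unit -> D%:R * t = 0 ->
  \sum_(x : Zc) cabs (S ((x, y), vlc t (x, y) k0 (- y^-1, 0))) ^+ 2 <= c%:R * (c %/ D)%:R ^+ 2 * N2.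
Proof.
move=> uy Dt.
pose g m := \sum_(r | @annB c D b r && (1 + r * t \is a GRing.unit))
   psi R (- (f m / y ^+ 2) * k0 * (r / (1 + r * t))).
have e x : S ((x, y), vlc t (x, y) k0 (- y^-1, 0)) = \sum_(m <- I) (al m * g m) * psi R (f m * (x / y)).
  rewrite /S.
  have h r : @annB c D b r -> A (vlc 1 (x, y) r (vlc t (x, y) k0 (- y^-1, 0))) =
     if 1 + r * t \is a GRing.unit then
       \sum_(m <- I) al m * psi R (f m * (x / y)) * psi R (- (f m / y ^+ 2) * k0 * (r / (1 + r * t))) else 0.
    move=> _; rewrite /A /Afun /=.
    have -> : 1 * y + r * (t * y + k0 * 0) = y * (1 + r * t) by ring.
    rewrite unitrM uy /=; case: ifP => // ur; apply: eq_bigr => m _.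
    rewrite -[RHS]mulrA -psiD //; congr (_ * psi R _).
    have -> : 1 * x + r * (t * x + k0 * - y^-1) = x * (1 + r * t) - r * k0 / y by ring.
    rewrite expr2 !invrM //; have := divrr ur.
    move: (1 + r * t) (y^-1) => u iy e.
    transitivity (f m * (x * (u / u) * iy) - f m * (iy * iy) * k0 * (r * u^-1)); first by ring.
    by rewrite e; ring.
  rewrite (eq_bigr _ h) -big_mkcondr exchange_big /=; apply: eq_bigr => m _.
  by rewrite -mulr_sumr /g; ring.
under eq_bigr do rewrite e.
rewrite [X in X <= _](reindex (fun x => x * y)) /=; last first.
  by exists (fun x => x / y) => x _; rewrite ?mulrK ?mulrVK.
under eq_bigr do under eq_bigr do rewrite mulrK //.
rewrite (sum_psi_freq c_gt1 _ uI finj) -mulrA ler_wpM2l ?ler0n // mulr_sumr.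
rewrite big_seq [X in _ <= X]big_seq; apply: ler_sum => m mI.
rewrite cabsM exprMn mulrC.
have [->|am] := eqVneq (al m) 0; first by rewrite cabs0 expr0n /= !mulr0.
rewrite ler_wpM2r ?sqr_ge0 // ler_sqr ?nnegrE ?cabs_ge0 ?ler0n //.
apply: (cabs_ann_psi_moebius R c_gt1 Dc bD Dt).
by rewrite -mulN1r !coprime_ZcM fb // !coprime_Zc_unit ?unitrV ?unitrX ?unitrN ?unitr1.
Qed.

Let S_unit : \sum_(z | inY D z && (z.1.2 \is a GRing.unit)) cabs (S z) ^+ 2 <=
  (D * totient c * c)%:R * (c %/ D)%:R ^+ 2 * N2.
Proof.
have -> : \sum_(z | inY D z && (z.1.2 \is a GRing.unit)) cabs (S z) ^+ 2 =
  \sum_(y : Zc | y \is a GRing.unit) \sum_(t : Zc | D%:R * t == 0) \sum_(x : Zc)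
    cabs (S ((x, y), vlc t (x, y) k0 (- y^-1, 0))) ^+ 2.
  transitivity (\sum_(v : vec | v.2 \is a GRing.unit) \sum_(w | inY D (v, w)) cabs (S (v, w)) ^+ 2).
    rewrite pair_big_dep /=; apply: eq_big => [[v w]|[v w] _] //=; exact: andbC.
  transitivity (\sum_(v : vec | v.2 \is a GRing.unit)
     \sum_(t : Zc | D%:R * t == 0) cabs (S (v, vlc t v k0 (- v.2^-1, 0))) ^+ 2).
    apply: eq_bigr => v uv; apply: (@sum_fiberY c D c_gt1 Dc R (fun w => cabs (S (v, w)) ^+ 2)).
    by rewrite /vdet /= mulr0 mulrN mulrV // sub0r opprK.
  rewrite -(@pair_big_dep _ _ _ _ _ xpredT (fun x (y : Zc) => y \is a GRing.unit)
    (fun x y => \sum_(t : Zc | D%:R * t == 0) cabs (S ((x, y), vlc t (x, y) k0 (- y^-1, 0))) ^+ 2)) /=.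
  rewrite exchange_big /=; apply: eq_bigr => y _; exact: exchange_big.
have -> : (D * totient c * c)%:R * (c %/ D)%:R ^+ 2 * N2 =
   \sum_(y : Zc | y \is a GRing.unit) \sum_(t : Zc | D%:R * t == 0) (c%:R * (c %/ D)%:R ^+ 2 * N2).
  rewrite !sumr_const card_ann // -mulrnA -[RHS]mulr_natl.
  have -> : #|[pred y : Zc | y \is a GRing.unit]| = totient c.
    rewrite -card_unit_Zc // -(card_image val_inj); apply: eq_card => x.
    rewrite inE; apply/idP/imageP => [ux|[u _ ->]]; last exact: (valP u).
    by exists (FinRing.Unit ux).
  by rewrite !natrM; ring.
apply: ler_sum => y uy; apply: ler_sum => t /eqP Dt; exact: S_fiber.
Qed.

Let S_shift r z : @annB c D b r -> S (shiftY r z) = S z.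
Proof.
move=> hr; rewrite /S [RHS](reindex (fun s => s + r)) /=; last first.
  by exists (fun s => s - r) => s _; rewrite ?addrK ?subrK.
apply: eq_big => [s|s _]; last by congr A; rewrite /vlc /=; congr pair; ring.
apply/idP/idP => h; first exact: annBD.
by rewrite -[s](addrK r) annBD // annBN.
Qed.

Let S_total : \sum_(z | inY D z) cabs (S z) ^+ 2 <=
  b%:R * \sum_(z | inY D z && (z.1.2 \is a GRing.unit)) cabs (S z) ^+ 2.
Proof.
have k00 : (0 : R) < (c %/ D)%:R by rewrite ltr0n divn_gt0 // dvdn_leq.
rewrite -(ler_pM2l k00) mulrA -natrM -(card_annB c_gt1 Dc bD).
have -> : #|@annB c D b|%:R * \sum_(z | inY D z && (z.1.2 \is a GRing.unit)) cabs (S z) ^+ 2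
  = \sum_(z | inY D z) \sum_(r | @annB c D b r && ((shiftY r z).1.2 \is a GRing.unit)) cabs (S z) ^+ 2.
  transitivity (\sum_(r | @annB c D b r) \sum_(z | inY D z)
      (if (shiftY r z).1.2 \is a GRing.unit then cabs (S (shiftY r z)) ^+ 2 else 0)).
    rewrite [RHS](eq_bigr (fun=> \sum_(z | inY D z && (z.1.2 \is a GRing.unit)) cabs (S z) ^+ 2)); last first.
      move=> r _; rewrite [RHS]big_mkcondr.
      exact: (sum_shiftY c_gt1 Dc (fun z => if z.1.2 \is a GRing.unit then cabs (S z) ^+ 2 else 0)).
    by rewrite sumr_const mulr_natl.
  rewrite exchange_big /=; apply: eq_bigr => z _; rewrite [RHS]big_mkcondr.
  by apply: eq_bigr => r hr; rewrite S_shift.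
rewrite mulr_sumr; apply: ler_sum => z Yz.
have [/eqP S0|] := eqVneq (S z) 0.
  by rewrite (eqP S0) cabs0 expr0n /= mulr0 sumr_ge0.
move=> Sn0.
have [r0 /andP[ar0 ur0]] : exists r, @annB c D b r && ((shiftY r z).1.2 \is a GRing.unit).
  apply/existsP; apply: contraNT Sn0; rewrite negb_exists => /forallP h.
  apply/eqP; apply: big1 => r ar; rewrite /A /Afun; case: ifP => // u.
  by have := h r; rewrite ar /= u.
rewrite sumr_const -[X in _ <= X]mulr_natl ler_wpM2r ?sqr_ge0 // ler_nat.
apply: (@leq_trans #|[set r0 + r | r in [pred r : Zc | (c %/ D)%:R * r == 0]]|).
  by rewrite card_imset ?card_ann //; exact: addrI.
apply: subset_leq_card; apply/subsetP => _ /imsetP[r hr ->].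
have {}hr : (c %/ D)%:R * r = 0 by apply/eqP.
have ar : @annB c D b r by rewrite /annB natrM mulrAC hr mul0r.
suff : @annB c D b (r0 + r) && ((shiftY (r0 + r) z).1.2 \is a GRing.unit) by [].
rewrite annBD // andTb.
have -> // : (shiftY (r0 + r) z) = shiftY r0 z.
rewrite addrC -shiftYD [in LHS]/shiftY.
by rewrite (inY_ann c_gt1 Dc (inY_shift c_gt1 Dc r0 Yz) hr).
Qed.

Lemma Fhat_energy :
  \sum_(a : Zc | (b %| a)%N) \sum_(z | inY D z) cabs (Fhat D a A z) ^+ 2 <=
  b%:R^-1 * ((c ^ 4 * totient c)%:R * N2).
Proof.
set E := \sum_(a | _) _; set Q := \sum_(z | inY D z) cabs (S z) ^+ 2.
have b0R : (0 : R) < b%:R by rewrite ltr0n.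
have k00 : (0 : R) < (c %/ D)%:R by rewrite ltr0n divn_gt0 // dvdn_leq.
have e1 : b%:R * E = \sum_(a : Zc) \sum_(z | inY D z) cabs (Fhat D (b%:R * a) A z) ^+ 2.
  by rewrite (@sum_multiples c c_gt1 R b (fun a => \sum_(z | inY D z) cabs (Fhat D a A z) ^+ 2)).
have e2 : (b%:R * E)%:C = (c * c)%:R * \sum_(z | inY D z) A z.1 * conjc (S z).
  rewrite e1 -(Fhat_parseval c_gt1 Dc b A A) rmorph_sum; apply: eq_bigr => a _.
  by rewrite rmorph_sum; apply: eq_bigr => z _; rewrite /= -sqr_cabs.
have e3 : Q%:C = (c %/ D * b)%:R * \sum_(z | inY D z) A z.1 * conjc (S z).
  rewrite /Q rmorph_sum -(card_annB c_gt1 Dc bD) mulr_natl -sumr_const.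
  transitivity (\sum_(z | inY D z) \sum_(r | @annB c D b r) A (shiftY r z).1 * conjc (S (shiftY r z))).
    apply: eq_bigr => z _; rewrite /= sqr_cabs {1}/S mulr_suml; apply: eq_bigr => r hr.
    by rewrite S_shift.
  rewrite exchange_big; apply: eq_bigr => r _.
  exact: (sum_shiftY c_gt1 Dc (fun z => A z.1 * conjc (S z))).
have e4 : (c %/ D * b)%:R * (b%:R * E) = (c * c)%:R * Q.
  apply: (fmorph_inj (real_complex R)); rewrite rmorphM rmorph_nat /= e2.
  by rewrite [RHS]rmorphM rmorph_nat /= e3 mulrCA.
have Qle : Q <= b%:R * ((D * totient c * c)%:R * (c %/ D)%:R ^+ 2 * N2).
  by apply: le_trans S_total _; rewrite ler_wpM2l ?ler0n.
rewrite mulrC ler_pdivlMr // -(ler_pM2l b0R) -(ler_pM2l k00).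
have -> : (c %/ D)%:R * (b%:R * (E * b%:R)) = (c * c)%:R * Q by rewrite -e4 natrM; ring.
apply: le_trans (ler_wpM2l (ler0n _ _) Qle) _.
rewrite le_eqVlt; apply/orP; left; apply/eqP.
have cR : (c%:R : R) = (c %/ D)%:R * D%:R by rewrite -natrM divnK.
by rewrite !(natrM, natrX) cR; ring.
Qed.
End EnergyBound.

(** * The trace of the amplified operator *)

Definition sqd (n : nat) : nat := \max_(h < n.+1 | (h ^ 2 %| n)%N) h.

Lemma sqd_dvd n : (0 < n)%N -> (sqd n ^ 2 %| n)%N.
Proof.
move=> n0; pose P := [pred h : 'I_n.+1 | (h ^ 2 %| n)%N].
have -> : sqd n = \max_(h in P) (h : nat) by apply: eq_bigl => h; rewrite inE.
have [|h hn ->] := @eq_bigmax_cond _ P (fun h => h : nat); last by rewrite inE in hn.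
by apply/card_gt0P; exists (Ordinal (n0 : (1 < n.+1)%N)); rewrite inE /= dvd1n.
Qed.

Lemma leq_sqd n h : (0 < n)%N -> (h ^ 2 %| n)%N -> (h <= sqd n)%N.
Proof.
move=> n0 hn; have hle : (h < n.+1)%N.
  rewrite ltnS; apply: leq_trans (dvdn_leq n0 hn).
  by case: h {hn} => // h; rewrite -mulnn leq_pmulr.
exact: (@leq_bigmax_cond _ (fun h : 'I_n.+1 => (h ^ 2 %| n)%N) (fun h => nat_of_ord h) (Ordinal hle) hn).
Qed.

Lemma leq_sqd_dvd m n : (0 < n)%N -> (m %| n)%N -> (sqd m <= sqd n)%N.
Proof.
move=> n0 mn; apply: leq_sqd => //; apply: dvdn_trans (mn).
by apply: sqd_dvd; exact: dvdn_gt0 mn.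
Qed.

Section Unipotents.
Variable A : finComUnitRingType.
Local Notation vec := (A * A)%type.
Implicit Types (v w : vec) (x y h k s : A).

Definition vu h v : vec := (v.1 + h * v.2, v.2).
Definition vl k v : vec := (v.1, v.2 + k * v.1).
Definition vscale s v : vec := (s * v.1, s * v.2).

Definition word h1 k1 h2 k2 h3 k3 v := vu h1 (vl k1 (vu h2 (vl k2 (vu h3 (vl k3 v))))).

Lemma vuD h h' v : vu h (vu h' v) = vu (h + h') v.
Proof. by rewrite /vu /=; congr pair; ring. Qed.
Lemma vlD k k' v : vl k (vl k' v) = vl (k + k') v.
Proof. by rewrite /vl /=; congr pair; ring. Qed.
Lemma vu0 v : vu 0 v = v. Proof. by case: v => a b; rewrite /vu /= mul0r addr0. Qed.
Lemma vl0 v : vl 0 v = v. Proof. by case: v => a b; rewrite /vl /= mul0r addr0. Qed.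
Lemma vlK k : cancel (vl k) (vl (- k)). Proof. by move=> v; rewrite vlD addNr vl0. Qed.
Lemma vuNK h : cancel (vu (- h)) (vu h). Proof. by move=> v; rewrite vuD addrN vu0. Qed.
Lemma vlNK k : cancel (vl (- k)) (vl k). Proof. by move=> v; rewrite vlD addrN vl0. Qed.

Lemma vu_lc h x v y w : vu h (vlc x v y w) = vlc x (vu h v) y (vu h w).
Proof. by rewrite /vu /vlc /=; congr pair; ring. Qed.
Lemma vl_lc k x v y w : vl k (vlc x v y w) = vlc x (vl k v) y (vl k w).
Proof. by rewrite /vl /vlc /=; congr pair; ring. Qed.
Lemma word_lc h1 k1 h2 k2 h3 k3 x v y w :
  word h1 k1 h2 k2 h3 k3 (vlc x v y w) = vlc x (word h1 k1 h2 k2 h3 k3 v) y (word h1 k1 h2 k2 h3 k3 w).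
Proof. by rewrite /word !(vu_lc, vl_lc). Qed.

Lemma vu_scale h s v : vu h (vscale s v) = vscale s (vu h v).
Proof. by rewrite /vu /vscale /=; congr pair; ring. Qed.
Lemma vl_scale k s v : vl k (vscale s v) = vscale s (vl k v).
Proof. by rewrite /vl /vscale /=; congr pair; ring. Qed.

Lemma vdet_u h v w : vdet (vu h v) (vu h w) = vdet v w.
Proof. by rewrite /vdet /vu /=; ring. Qed.
Lemma vdet_l k v w : vdet (vl k v) (vl k w) = vdet v w.
Proof. by rewrite /vdet /vl /=; ring. Qed.
Lemma vdet_word h1 k1 h2 k2 h3 k3 v w :
  vdet (word h1 k1 h2 k2 h3 k3 v) (word h1 k1 h2 k2 h3 k3 w) = vdet v w.
Proof. by rewrite /word !(vdet_u, vdet_l). Qed.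

Lemma primv_u h v : primv (vu h v) = primv v.
Proof.
apply/primvP/primvP => [[w e]|[w e]]; last by exists (vu h w); rewrite vdet_u.
by exists (vu (- h) w); rewrite -(vdet_u h) vuNK.
Qed.
Lemma primv_l k v : primv (vl k v) = primv v.
Proof.
apply/primvP/primvP => [[w e]|[w e]]; last by exists (vl k w); rewrite vdet_l.
by exists (vl (- k) w); rewrite -(vdet_l k) vlNK.
Qed.
Lemma primv_scale s v : s \is a GRing.unit -> primv (vscale s v) = primv v.
Proof.
move=> us; apply/primvP/primvP => [[w e]|[w e]].
  by exists (vscale s w); rewrite -e /vdet /vscale /=; ring.
exists (vscale s^-1 w); have -> : vdet (vscale s v) (vscale s^-1 w) = (s * s^-1) * vdet v w.
  by rewrite /vdet /vscale /=; ring.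
by rewrite divrr // mul1r.
Qed.
Lemma word_scalar_eqs kap t h1 k1 h2 k2 h3 k3 :
  (forall v, vscale kap (word h1 k1 h2 k2 h3 k3 v) = vscale kap (vscale t v)) ->
  [/\ kap * (1 + h1 * k1 - t * (1 + h3 * k2)) = 0,
      kap * (1 + k1 * h2 - t * (1 + h3 * k3)) = 0,
      kap * (h1 + h2 * (1 + h1 * k1) + t * h3) = 0 &
      kap * (k1 + t * (k2 + k3 * (1 + h3 * k2))) = 0].
Proof.
move=> hv; pose Rinv v := vl (- k3) (vu (- h3) (vl (- k2) v)).
have hP v : vscale kap (vu h1 (vl k1 (vu h2 v))) = vscale kap (vscale t (Rinv v)).
  by rewrite -hv /word /Rinv vlNK vuNK vlNK.
have e11 := congr1 fst (hP (1, 0)); have e12 := congr1 snd (hP (1, 0)).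
have e21 := congr1 fst (hP (0, 1)); have e22 := congr1 snd (hP (0, 1)).
have fin x y z : x = y -> z = x - y -> z = 0 by move=> -> ->; rewrite subrr.
by split; [apply: fin e11 _|apply: fin e22 _|apply: fin e21 _|apply: fin e12 _];
  rewrite /vscale /vu /vl /=; ring.
Qed.
End Unipotents.

Section WordCount.
Variables (R : realType) (c D : nat) (T : R).
Hypotheses (c_gt1 : (1 < c)%N) (Dc : (D %| c)%N).
Hypothesis hT : forall n, (0 < n <= c)%N -> (tau n)%:R <= T.
Local Notation Zc := 'Z_c.
Local Notation vec := (Zc * Zc)%type.
Implicit Types (v w : vec) (x y a s t : Zc) (z : vec * vec).

Let k0 : Zc := (c %/ D)%:R.
Let c0 : (0 < c)%N. Proof. exact: ltnW. Qed.
Let D0 : (0 < D)%N. Proof. exact: dvdn_gt0 Dc. Qed.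
Let kD : (c %/ D * D = c)%N. Proof. by rewrite divnK. Qed.

Lemma k0_mul_eq0 a x : (k0 * a * x == 0) = (D %/ gcdn a D %| x)%N.
Proof.
have b0 : (0 < gcdn a D)%N by rewrite gcdn_gt0 D0 orbT.
have -> : (k0 * a * x == 0) = (c %| c %/ D * (a * x))%N.
  by rewrite -mulrA -{1}[a]Zc_valK -{1}[x]Zc_valK -!natrM Zc_natr_eq0.
rewrite -{1}kD dvdn_pmul2l; last by rewrite divn_gt0 // dvdn_leq.
have aE : (a = a %/ gcdn a D * gcdn a D :> nat)%N by rewrite divnK // dvdn_gcdl.
have DE : (D = D %/ gcdn a D * gcdn a D)%N by rewrite divnK // dvdn_gcdr.
rewrite {1}DE {3}aE mulnAC dvdn_pmul2r // Gauss_dvdr //.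
by rewrite coprime_sym /coprime -(eqn_pmul2r b0) muln_gcdl -aE -DE mul1n.
Qed.

Lemma ann_dvd (i : nat) (n : int) : (i %| c)%N ->
  (((c %/ i)%:R * (n%:~R : Zc)) == 0) = (i%:Z %| n)%Z.
Proof.
move=> ic; have i0 := dvdn_gt0 c0 ic.
have ci0 : (0 < c %/ i)%N by rewrite divn_gt0 // dvdn_leq.
have cE : (c = c %/ i * i)%N by rewrite divnK.
have h (m : nat) : ((c %/ i)%:R * m%:R == 0 :> Zc) = (i %| m)%N.
  by rewrite -natrM Zc_natr_eq0 // {1}cE dvdn_pmul2l.
case: n => m; first by rewrite -pmulrn h dvdzE.
by rewrite NegzE mulrNz mulrN oppr_eq0 -pmulrn h dvdzE abszN.
Qed.

Definition wordZ (h1 k1 h2 k2 h3 k3 : int) : vec -> vec :=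
  word (h1%:~R : Zc) k1%:~R h2%:~R k2%:~R h3%:~R k3%:~R.

Lemma word_scalar_ann (i : nat) (tau : nat) h1 k1 h2 k2 h3 k3 : (i %| c)%N ->
  (forall v, vscale (c %/ i)%:R (wordZ h1 k1 h2 k2 h3 k3 v) = vscale (c %/ i)%:R (vscale tau%:R v)) ->
  word_scalar i tau%:Z h1 k1 h2 k2 h3 k3.
Proof.
move=> ic hv.
have [e1 e2 e3 e4] := word_scalar_eqs hv.
have tz : (tau%:Z)%:~R = tau%:R :> Zc by [].
by apply/and4P; split; rewrite -(ann_dvd _ ic); apply/eqP; [rewrite -[RHS]e1|rewrite -[RHS]e2|rewrite -[RHS]e3|rewrite -[RHS]e4];
  congr (_ * _); rewrite -tz; ring.
Qed.

(* Both [v] and [w] are framed by [z]; the action of [g] on them forces [g] to be scalar modulo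
   the content of its fixed-point form. *)
Lemma word_eigen_content z t a h1 k1 h2 k2 h3 k3 :
  let g := wordZ h1 k1 h2 k2 h3 k3 in
  inY D z -> t \is a GRing.unit -> k0 * a * t ^+ 2 = k0 * a ->
  g z.1 = vscale t z.1 -> g z.2 = vscale t^-1 z.2 ->
  exists i : nat, [/\ (i %| c)%N, (D %/ gcdn a D %| i)%N,
    (i%:Z %| (t : nat)%:Z ^+ 2 - 1)%Z, word_scalar i (t : nat)%:Z h1 k1 h2 k2 h3 k3 &
    (\sum_(v : vec) (vdet v (g v) == 0)%:R : R) <= 4 * T * (c * (i * sqd (c %/ i)))%:R].
Proof.
case: z => v w /= Yz ut ta gv gw; set g := wordZ h1 k1 h2 k2 h3 k3 in gv gw *.
have [w1 dvw1 wE] := inY_basis c_gt1 Dc Yz.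
have gdet u u' : vdet (g u) (g u') = vdet u u' by exact: vdet_word.
have glc x u y u' : g (vlc x u y u') = vlc x (g u) y (g u') by exact: word_lc.
set be := vdet (g w1) w1; set e1 := t^-1 - t.
have gw1 : g w1 = vlc be v t^-1 w1.
  rewrite -(vec_basis (g w1) dvw1) -/be; congr (vlc _ _ _ _).
  have := gdet v w1; rewrite gv dvw1.
  have -> : vdet (vscale t v) (g w1) = t * vdet v (g w1) by rewrite /vdet /vscale /=; ring.
  by move=> e; apply: (mulrI ut); rewrite e divrr.
have gw2 : g w = vlc (k0 * be) v (k0 * t^-1) w1.
  have -> : w = vlc 0 v k0 w1 by rewrite wE /vlc /=; congr pair; ring.
  rewrite glc gw1 gv; rewrite /vlc /vscale /=; congr pair; ring.
have kbe : k0 * be = 0.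
  have := congr1 (fun u => vdet u w1) gw; rewrite gw2 vdet_lcl vdetvv mulr0 addr0 dvw1 mulr1.
  by move=> ->; rewrite wE /vdet /vscale /=; ring.
pose i := gcdn (gcdn e1 (- be : Zc)) c.
have ic : (i %| c)%N by exact: dvdn_gcdr.
have ie : (i %| e1)%N by apply: dvdn_trans (dvdn_gcdl _ _) (dvdn_gcdl _ _).
have ib : (i %| (- be : Zc))%N by apply: dvdn_trans (dvdn_gcdl _ _) (dvdn_gcdr _ _).
have Db : (D %/ gcdn a D %| i)%N.
  rewrite !dvdn_gcd -!k0_mul_eq0; apply/andP; split; last first.
    by apply: dvdn_trans Dc; apply/dvdnP; exists (gcdn a D); rewrite mulnC divnK ?dvdn_gcdr.
  apply/andP; split; last by rewrite mulrN mulrAC kbe mul0r oppr0.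
  rewrite /e1 mulrBr -{1}ta expr2 mulrA.
  by rewrite -[_ * t * t * t^-1]mulrA divrr // mulr1 subrr.
have annx (x : Zc) : (i %| x)%N -> (c %/ i)%:R * x = 0.
  by move=> ix; apply/eqP; rewrite -[x]Zc_valK -[(x : nat)%:R]/((x : nat)%:Z%:~R) ann_dvd.
have ae := annx _ ie; have ab : (c %/ i)%:R * be = 0.
  by have := annx _ ib; rewrite mulrN => /eqP; rewrite oppr_eq0 => /eqP.
exists i; split => //.
- rewrite -(ann_dvd _ ic) rmorphB rmorphXn rmorph1 /= -pmulrn Zc_valK.
  have -> : (c %/ i)%:R * (t ^+ 2 - 1) = - (t * ((c %/ i)%:R * e1)).
    by rewrite /e1 expr2; transitivity ((c %/ i)%:R * (t * t - t / t)); [rewrite divrr|ring].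
  by rewrite ae mulr0 oppr0.
- apply: word_scalar_ann => // u; rewrite -/g Zc_valK -(vec_basis u dvw1) glc gv gw1.
  move: (vdet u w1) (vdet v u) => x y.
  have ti : (c %/ i)%:R * t^-1 = (c %/ i)%:R * t by apply/eqP; rewrite -subr_eq0 -mulrBr ae.
  rewrite /vlc /vscale /=; congr pair.
    transitivity (x * t * v.1 * (c %/ i)%:R + y * v.1 * ((c %/ i)%:R * be) + y * w1.1 * ((c %/ i)%:R * t^-1)); first by ring.
    by rewrite ab ti; ring.
  transitivity (x * t * v.2 * (c %/ i)%:R + y * v.2 * ((c %/ i)%:R * be) + y * w1.2 * ((c %/ i)%:R * t^-1)); first by ring.
  by rewrite ab ti; ring.
rewrite (sum_basis _ dvw1).
have -> : \sum_x \sum_y (vdet (vlc x v y w1) (g (vlc x v y w1)) == 0)%:R =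
  \sum_(y < c) \sum_(x < c) (c %| y * (x * e1 + y * (- be : Zc)))%N%:R :> R.
  rewrite exchange_big /= -!(big_mkord xpredT (fun y : nat => \sum_(x < c) (c %| y * (x * e1 + y * (- be : Zc)))%N%:R)).
  rewrite -(@sum_Zc c c_gt1 R (fun y : nat => \sum_(x < c) (c %| y * (x * e1 + y * (- be : Zc)))%N%:R)).
  apply: eq_bigr => y _.
  rewrite -!(big_mkord xpredT (fun x : nat => (c %| y * (x * e1 + y * (- be : Zc)))%N%:R)).
  rewrite -(@sum_Zc c c_gt1 R (fun x : nat => (c %| y * (x * e1 + y * (- be : Zc)))%N%:R)).
  apply: eq_bigr => x _; congr (_%:R); congr nat_of_bool.
  rewrite glc gv gw1.
  have -> : vdet (vlc x v y w1) (vlc x (vscale t v) y (vlc be v t^-1 w1)) = y * (x * e1 - y * be) * vdet v w1.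
    by rewrite /e1 /vdet /vlc /vscale /=; ring.
  rewrite dvw1 mulr1 -Zc_natr_eq0 // natrM natrD !natrM !Zc_valK; congr (_ == 0); ring.
apply: le_trans (@count_quadratic_zeros R c e1 (- be : Zc) i c0 erefl) _.
have i0 := dvdn_gt0 c0 ic; have ci0 : (0 < c %/ i)%N by rewrite divn_gt0 // dvdn_leq.
have hS : \sum_(u <- divisors (c %/ i)) (gcdn u (c %/ i %/ u))%:R <= T * (sqd (c %/ i))%:R.
  apply: (@le_trans _ _ (\sum_(u <- divisors (c %/ i)) (sqd (c %/ i))%:R)).
    rewrite big_seq [X in _ <= X]big_seq; apply: ler_sum => u; rewrite -dvdn_divisors // => um.
    by rewrite ler_nat leq_sqd // gcd_div_sqr.
  rewrite big_const_seq count_predT iter_addr_0 -[X in X <= _]mulr_natl ler_wpM2r //.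
  by apply: hT; rewrite ci0 leq_div.
have -> : 4 * T * (c * (i * sqd (c %/ i)))%:R = 4 * (c%:R * i%:R * (T * (sqd (c %/ i))%:R)).
  by rewrite !natrM; ring.
by rewrite ler_wpM2l // ler_wpM2l ?mulr_ge0.
Qed.
End WordCount.

Lemma sqd_gt0 n : (0 < n)%N -> (0 < sqd n)%N.
Proof. by move=> n0; apply: leq_sqd => //; rewrite dvd1n. Qed.

Lemma sqd_leq n : (0 < n)%N -> (sqd n <= n)%N.
Proof.
move=> n0; apply: leq_trans (dvdn_leq n0 (sqd_dvd n0)).
by rewrite -mulnn leq_pmulr // sqd_gt0.
Qed.

Lemma sqd_mul_leq n b : (0 < n)%N -> (0 < b)%N -> (sqd (n * b) <= b * sqd n)%N.
Proof.
move=> n0 b0; set h := sqd (n * b).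
have nb0 : (0 < n * b)%N by rewrite muln_gt0 n0.
have h0 : (0 < h)%N by exact: sqd_gt0.
have hd : (h ^ 2 %| n * b)%N by exact: sqd_dvd.
pose g := gcdn h b; have g0 : (0 < g)%N by rewrite gcdn_gt0 h0.
have gh : (g %| h)%N by exact: dvdn_gcdl.
have gb : (g %| b)%N by exact: dvdn_gcdr.
have cop : coprime (h %/ g) (b %/ g).
  by rewrite /coprime -(eqn_pmul2r g0) muln_gcdl !divnK // mul1n.
have : ((h %/ g) ^ 2 %| n)%N.
  rewrite -(@Gauss_dvdl _ n (b %/ g)) ?coprimeXl //.
  rewrite -(dvdn_pmul2r g0) -mulnA divnK //; apply: dvdn_trans hd.
  by rewrite -{2}(divnK gh) expnMn dvdn_mul // dvdn_exp.
move=> /(leq_sqd n0) hs; rewrite -[h](divnK gh) mulnC leq_mul //.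
by rewrite dvdn_leq.
Qed.

Section Count.
Variable R : realType.

Lemma count_sqr1 (i : nat) : (0 < i)%N ->
  \sum_(x < i) (i%:Z %| (x : nat)%:Z ^+ 2 - 1)%Z%:R <= 3 * (tau i)%:R :> R.
Proof.
move=> i0.
pose gx (x : nat) := gcdn (absz (x%:Z - 1)) i.
have gi x : (gx x %| i)%N by exact: dvdn_gcdr.
have gpos x : (0 < gx x)%N by apply: dvdn_gt0 (gi x).
pose P (x : nat) := (i%:Z %| x%:Z ^+ 2 - 1)%Z.
have hP x : P x -> (i %/ gx x %| absz (x%:Z + 1)%R)%N.
  rewrite /P (_ : _ - 1 = (x%:Z - 1) * (x%:Z + 1)); last by ring.
  rewrite dvdzE abszM /= => h; move: h.
  rewrite -{1}(divnK (gi x)) -{1}(divnK (dvdn_gcdl (absz (x%:Z - 1)) i)) -/(gx x) mulnAC dvdn_pmul2r // Gauss_dvdr //.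
  by rewrite coprime_sym /coprime -(eqn_pmul2r (gpos x)) muln_gcdl mul1n !divnK ?dvdn_gcdl.
apply: (@le_trans _ _ (\sum_(u <- divisors i) \sum_(x < i) (P x && (gx x == u))%:R)).
  rewrite exchange_big /=; apply: ler_sum => x _; rewrite -/(P x).
  case: (P x); last by rewrite sumr_ge0.
  rewrite (bigD1_seq (gx x)) ?divisors_uniq -?dvdn_divisors //= eqxx lerDl.
  exact: sumr_ge0.
apply: (@le_trans _ _ (\sum_(u <- divisors i) 3)); last first.
  by rewrite big_const_seq count_predT iter_addr_0 mulr_natr.
rewrite big_seq [X in _ <= X]big_seq; apply: ler_sum => u; rewrite -dvdn_divisors // => ui.
have [x0 /andP[Px0 /eqP gx0]|no] := pickP (fun x : 'I_i => P x && (gx x == u)); last first.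
  by rewrite big1 // => x _; rewrite no.
have u0 : (0 < u)%N by exact: dvdn_gt0 ui.
have l0 : (0 < lcmn u (i %/ u))%N by rewrite lcmn_gt0 u0 divn_gt0 // dvdn_leq.
have g2 : (gcdn u (i %/ u) %| 2)%N.
  have : ((gcdn u (i %/ u))%:Z %| (x0%:Z + 1) - (x0%:Z - 1))%Z.
    apply: rpredB; rewrite dvdzE /=.
      by apply: dvdn_trans (dvdn_gcdr _ _) _; have := hP _ Px0; rewrite gx0.
    by apply: dvdn_trans (dvdn_gcdl _ _) _; rewrite -gx0 dvdn_gcdl.
  by rewrite (_ : _ - _ = 2%:Z) ?dvdzE //; ring.
have li : (i <= 2 * lcmn u (i %/ u))%N.
  have e : (lcmn u (i %/ u) * gcdn u (i %/ u) = i)%N by rewrite muln_lcm_gcd mulnC divnK.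
  by rewrite -{1}e mulnC leq_mul2r dvdn_leq ?orbT.
apply: le_trans (@count_congr R i (lcmn u (i %/ u)) (fun x => P x && (gx x == u)) l0 _) _.
  move=> x y _ _ /andP[Px /eqP gxu] /andP[Py /eqP gyu].
  rewrite dvdzE /= dvdn_lcm; apply/andP; split.
    have -> : x%:Z - y%:Z = (x%:Z - 1) - (y%:Z - 1) by ring.
    rewrite -[u]/(absz u%:Z) -dvdzE; apply: rpredB; rewrite dvdzE /=.
      by rewrite -gxu dvdn_gcdl.
    by rewrite -gyu dvdn_gcdl.
  have -> : x%:Z - y%:Z = (x%:Z + 1) - (y%:Z + 1) by ring.
  rewrite -[(i %/ u)%N]/(absz (i %/ u)%N%:Z) -dvdzE; apply: rpredB; rewrite dvdzE /=.
    by have := hP _ Px; rewrite gxu.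
  by have := hP _ Py; rewrite gyu.
rewrite (_ : 3 = 2 + 1) ?lerD2r; last by ring.
rewrite ler_pdivrMr ?ltr0n // -natrM ler_nat //.
Qed.
End Count.

Section WordTotal.
Variables (R : realType) (c D : nat) (T : R).
Hypotheses (c_gt1 : (1 < c)%N) (Dc : (D %| c)%N).
Hypothesis hT : forall n, (0 < n <= c ^ 2)%N -> (tau n)%:R <= T.
Local Notation Zc := 'Z_c.
Local Notation vec := (Zc * Zc)%type.
Implicit Types (v w : vec) (x y a s t : Zc) (z : vec * vec).

Let k0 : Zc := (c %/ D)%:R.
Let c0 : (0 < c)%N. Proof. exact: ltnW. Qed.

Definition eigen_pair (g : vec -> vec) z t :=
  (g z.1 == vscale t z.1) && (g z.2 == vscale t^-1 z.2).

Lemma count_eigen_pairs a h1 k1 h2 k2 h3 k3 :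
  \sum_(z | inY D z) \sum_(t | (t \is a GRing.unit) && (k0 * a * t ^+ 2 == k0 * a)) (eigen_pair (@wordZ c h1 k1 h2 k2 h3 k3) z t)%:R
  <= D%:R * (4 * T * c%:R) * \sum_(i <- divisors c | (D %/ gcdn a D %| i)%N)
    ((i * sqd (c %/ i))%:R * \sum_(x < i | (i%:Z %| (x : nat)%:Z ^+ 2 - 1)%Z)
        (word_scalar i (x : nat)%:Z h1 k1 h2 k2 h3 k3)%:R) :> R.
Proof.
set g := @wordZ c h1 k1 h2 k2 h3 k3.
have T0 : 0 <= T by apply: le_trans (hT (_ : (0 < 1 <= c ^ 2)%N)); rewrite ?ler0n // expn_gt0 c0.
pose P (p : vec * vec * Zc) := [&& inY D p.1, (p.2 \is a GRing.unit) && (k0 * a * p.2 ^+ 2 == k0 * a) & eigen_pair g p.1 p.2].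
have [[z t] /and3P[/= Yz /andP[ut /eqP ta] /andP[/eqP g1 /eqP g2]]|no] := pickP P; last first.
  rewrite big1 ?mulr_ge0 ?sumr_ge0 // => [i _|z Yz]; first by rewrite mulr_ge0 ?sumr_ge0.
  by apply: big1 => t ht; have := no (z, t); rewrite /P /= Yz ht /= => ->.
have hTc n : (0 < n <= c)%N -> (tau n)%:R <= T.
  by move=> /andP[n0 nc]; apply: hT; rewrite n0 (leq_trans nc) // -mulnn leq_pmulr.
have [i [ic Di it sc cnt]] := word_eigen_content c_gt1 Dc hTc Yz ut ta g1 g2.
apply: (@le_trans _ _ (D%:R * \sum_v (vdet v (g v) == 0)%:R)).
  apply: (@le_trans _ _ (\sum_(z | inY D z) (primv z.1 && (vdet z.1 (g z.1) == 0))%:R)).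
    apply: ler_sum => -[v w] Yvw /=.
    have pv : primv v by case/and4P: Yvw.
    rewrite pv /=.
    have [t0 /andP[ht0 /andP[/eqP gv gw]]|no] := pickP (fun t => ((t \is a GRing.unit) && (k0 * a * t ^+ 2 == k0 * a)) && eigen_pair g (v, w) t); last first.
      by rewrite big1 ?ler0n // => t1 ht1; have := no t1; rewrite ht1 /= => ->.
    rewrite /= in gv; rewrite (bigD1 t0) //= big1 => [|t1 /andP[ht1 t10]].
      rewrite addr0 ler_nat gv.
      have -> : vdet v (vscale t0 v) = 0 by rewrite /vdet /vscale /=; ring.
      by rewrite eqxx leq_b1.
    case: (boolP (eigen_pair _ _ _)) => // /andP[/eqP gv1 _]; case/eqP: t10.
    rewrite /= gv in gv1; apply/eqP; rewrite -subr_eq0; apply/eqP; apply: (primv_eq0 pv).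
      by rewrite mulrBl; have /= := congr1 fst gv1; rewrite /vscale [_.1]/= => ->; rewrite subrr.
    by rewrite mulrBl; have /= := congr1 snd gv1; rewrite /vscale [_.2]/= => ->; rewrite subrr.
  rewrite (@sum_inY_fst _ _ c_gt1 Dc R (fun v => (primv v && (vdet v (g v) == 0))%:R)) => [|v /negbTE -> //].
  by rewrite ler_wpM2l // ler_sum // => v _; case: (primv v).
rewrite -mulrA ler_wpM2l //; apply: le_trans cnt _.
rewrite natrM -!mulrA ler_wpM2l // ler_wpM2l // ler_wpM2l //.
have iD : i \in divisors c by rewrite -dvdn_divisors.
rewrite [X in _ <= X]big_mkcond (bigD1_seq i iD (divisors_uniq c)) /= Di -[X in X <= _]addr0 lerD //; last first.
  by rewrite sumr_ge0 // => j _; case: ifP => // _; rewrite mulr_ge0 ?sumr_ge0.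
rewrite -[X in X <= _]mulr1 ler_wpM2l //.
have i0 : (0 < i)%N by exact: dvdn_gt0 ic.
pose x := Ordinal (ltn_pmod t i0).
have tx : (i%:Z %| (t : nat)%:Z - (x : nat)%:Z)%Z.
  by rewrite -eqz_mod_dvd /= !modz_nat modn_mod.
have hx : (i%:Z %| (x : nat)%:Z ^+ 2 - 1)%Z.
  have -> : (x : nat)%:Z ^+ 2 - 1 = ((t : nat)%:Z ^+ 2 - 1) - ((t : nat)%:Z + (x : nat)%:Z) * ((t : nat)%:Z - (x : nat)%:Z) by ring.
  by apply: rpredB => //; apply: dvdz_mull.
rewrite (bigD1 x) //= (_ : word_scalar _ _ _ _ _ _ _ _) ?lerDl ?sumr_ge0 //.
move: sc => /and4P[e1 e2 e3 e4].
have tr (m1 m2 n : int) : (i%:Z %| m1)%Z -> m2 = m1 + n * ((t : nat)%:Z - (x : nat)%:Z) -> (i%:Z %| m2)%Z.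
  by move=> hm ->; apply: rpredD => //; apply: dvdz_mull.
apply/and4P; split; [apply: (tr _ _ (1 + h3 * k2) e1)|apply: (tr _ _ (1 + h3 * k3) e2)
 |apply: (tr _ _ (- h3) e3)|apply: (tr _ _ (- (k2 + k3 * (1 + h3 * k2))) e4)]; rewrite -[(t %% i)%N]/(x : nat); ring.
Qed.
End WordTotal.

Lemma big_subType (V : nmodType) (T : finType) (P Q : pred T) (sT : subFinType P) (F : T -> V) :
  \sum_(x : sT | Q (val x)) F (val x) = \sum_(i | P i && Q i) F i.
Proof.
rewrite [RHS](reindex_omap (val : sT -> T) insub) => [|i /andP[Pi _]]; last by rewrite insubT /= SubK.
by apply: eq_bigl => x; rewrite valP valK eqxx andbT.
Qed.

Section TorusAction.
Variable A : finComUnitRingType.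
Local Notation vec := (A * A)%type.
Implicit Types (v w : vec) (s : {unit A}).

Definition tact s (z : vec * vec) : vec * vec :=
  (vscale (val s) z.1, vscale (val s)^-1 z.2).

Lemma vdet_scale a b v w : vdet (vscale a v) (vscale b w) = a * b * vdet v w.
Proof. by rewrite /vdet /vscale /=; ring. Qed.

Lemma word_collapse h1 h1' h2 h2' h3 h3' k1 k1' k2 k2' k3 k3' v :
  vu h3' (vl (- k3') (vl k2' (vu (- h2') (vu h1'
    (word (h2' - h1') (k3' - k2') (h3 - h3') (k2 - k3) (h1 - h2) (k1' - k1) v))))) =
  vu h3 (vl (- k3) (vl k2 (vu (- h2) (vu h1 (vl (- k1) (vl k1' v)))))).
Proof.
have E1 (x y : A) : - x + y + (x - y) = 0 by ring.
have E2 (x y : A) : x + (y - x) = y by ring.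
rewrite /word !(vuD, vlD) E1 vu0 vlD E1 vl0 vuD E2.
by congr (vu _ (vl _ (vu _ (vl _ _)))); exact: addrC.
Qed.

Lemma vscale_lc (s j : A) v w : s \is a GRing.unit ->
  vlc 1 (vscale s v) (s ^+ 2 * j) (vscale s^-1 w) = vscale s (vlc 1 v j w).
Proof.
move=> us; have e x : s ^+ 2 * j * (s^-1 * x) = s * (j * x).
  by rewrite mulrCA mulrA expr2 -!mulrA mulKr // mulrCA.
by rewrite /vscale /vlc /= !mul1r !e !mulrDr.
Qed.

Lemma tact1 z : tact 1%g z = z.
Proof. by case: z => [[a b] [e f]]; rewrite /tact /vscale /= invr1 !mul1r. Qed.

Lemma tactM s t z : tact (s * t)%g z = tact s (tact t z).
Proof.
case: z => [[a b] [e f]]; rewrite /tact /vscale /=.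
have us := valP s; have ut := valP t.
by rewrite invrM // !mulrA ![(val t)^-1 * _]mulrC.
Qed.

Lemma tactC s t z : tact s (tact t z) = tact t (tact s z).
Proof. by rewrite /tact /vscale /=; congr (_, _); congr (_, _); ring. Qed.
End TorusAction.

Section Operator.
Variables (R : realType) (c D H K : nat) (T : R).
Hypotheses (c_gt1 : (1 < c)%N) (Dc : (D %| c)%N).
Hypothesis hT : forall n, (0 < n <= c ^ 2)%N -> (tau n)%:R <= T.
Hypotheses (H0 : (0 < H)%N) (HK : (H <= K)%N) (HKc : (H * K <= c ^ 2)%N).
Local Notation Zc := 'Z_c.
Local Notation vec := (Zc * Zc)%type.
Implicit Types (v w : vec) (x y a : Zc) (z : vec * vec).

Let k0 : Zc := (c %/ D)%:R.
Let c0 : (0 < c)%N. Proof. exact: ltnW. Qed.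
Let D0 : (0 < D)%N. Proof. exact: dvdn_gt0 Dc. Qed.
Let K0 : (0 < K)%N. Proof. exact: leq_trans H0 HK. Qed.

Definition inYT := {z : vec * vec | inY D z}.
HB.instance Definition _ := Finite.on inYT.
Implicit Types (Y : inYT).

Lemma inY_tact (s : {unit Zc}) z : inY D z -> inY D (tact s z).
Proof.
move=> /and4P[p /eqP d1 /eqP d2 /eqP dt]; have us := valP s.
rewrite /inY primv_scale // p /= !mulrA ![D%:R * _]mulrC -!mulrA d1 d2 !mulr0 eqxx /= -dt.
by rewrite vdet_scale divrr ?mul1r.
Qed.

Definition zu (h : Zc) z : vec * vec := (vu h z.1, vu h z.2).
Definition zl (k : Zc) z : vec * vec := (vl k z.1, vl k z.2).

Lemma inY_zu h z : inY D z -> inY D (zu h z).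
Proof.
move=> /and4P[p /eqP d1 /eqP d2 dt]; rewrite /inY primv_u vdet_u p dt andbT /= d2 eqxx.
by rewrite mulrDr d1 mulrCA d2 mulr0 addr0 eqxx.
Qed.

Lemma inY_zl k z : inY D z -> inY D (zl k z).
Proof.
move=> /and4P[p /eqP d1 /eqP d2 dt]; rewrite /inY primv_l vdet_l p dt andbT /= d1 eqxx.
by rewrite mulrDr d2 mulrCA d1 mulr0 addr0 eqxx.
Qed.

Definition Yt (s : {unit Zc}) Y : inYT := Sub (tact s (val Y)) (inY_tact s (valP Y)).
Definition Yu h Y : inYT := Sub (zu h (val Y)) (inY_zu h (valP Y)).
Definition Yl k Y : inYT := Sub (zl k (val Y)) (inY_zl k (valP Y)).

Let YlD k k' Y : Yl k (Yl k' Y) = Yl (k + k') Y.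
Proof. by apply: val_inj; rewrite /= /zl !vlD. Qed.
Let YuD h h' Y : Yu h (Yu h' Y) = Yu (h + h') Y.
Proof. by apply: val_inj; rewrite /= /zu !vuD. Qed.
Let Yl0 Y : Yl 0 Y = Y.
Proof. by apply: val_inj; rewrite /= /zl !vl0; case: (val Y). Qed.
Let Yu0 Y : Yu 0 Y = Y.
Proof. by apply: val_inj; rewrite /= /zu !vu0; case: (val Y). Qed.
Let YuK h : cancel (Yu h) (Yu (- h)). Proof. by move=> Y; rewrite YuD addNr Yu0. Qed.
Let YuNK h : cancel (Yu (- h)) (Yu h). Proof. by move=> Y; rewrite YuD addrN Yu0. Qed.
Let YlK h : cancel (Yl h) (Yl (- h)). Proof. by move=> Y; rewrite YlD addNr Yl0. Qed.
Let YlNK h : cancel (Yl (- h)) (Yl h). Proof. by move=> Y; rewrite YlD addrN Yl0. Qed.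
Let Yut s h Y : Yu h (Yt s Y) = Yt s (Yu h Y).
Proof. by apply: val_inj; rewrite /= /zu /tact /= !vu_scale. Qed.
Let Ylt s k Y : Yl k (Yt s Y) = Yt s (Yl k Y).
Proof. by apply: val_inj; rewrite /= /zl /tact /= !vl_scale. Qed.

Local Notation idx := ('I_H * 'I_K)%type.
Definition pY (i : idx) Y := Yu (i.1 : nat)%:R (Yl (- (i.2 : nat)%:R) Y).
Definition pY' (i : idx) Y := Yl (i.2 : nat)%:R (Yu (- (i.1 : nat)%:R) Y).

Lemma pYK i : cancel (pY i) (pY' i).
Proof. by move=> Y; rewrite /pY /pY' YuK YlNK. Qed.
Lemma pY'K i : cancel (pY' i) (pY i).
Proof. by move=> Y; rewrite /pY /pY' YlK YuNK. Qed.
Lemma pYt i s Y : pY i (Yt s Y) = Yt s (pY i Y).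
Proof. by rewrite /pY Ylt Yut. Qed.

Definition zdiff (m n : nat) : int := m%:Z - n%:Z.

(* Moving the lower unipotent of [w'] to the variable turns the fixed-point equation of the trace
   into an eigenvector equation for one word in differences of the indices. *)
Lemma trace_word (w w' : idx * idx * idx) (s : {unit Zc}) Y :
  (pY w.2 (pY' w.1.2 (pY w.1.1 (Yl (w'.1.1.2 : nat)%:R Y))) ==
   Yt s (pY w'.2 (pY' w'.1.2 (pY w'.1.1 (Yl (w'.1.1.2 : nat)%:R Y))))) =
  eigen_pair (@wordZ c (zdiff w'.1.2.1 w'.1.1.1) (zdiff w'.2.2 w'.1.2.2) (zdiff w.2.1 w'.2.1)
     (zdiff w.1.2.2 w.2.2) (zdiff w.1.1.1 w.1.2.1) (zdiff w'.1.1.2 w.1.1.2)) (val Y) (val s).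
Proof.
set g := @wordZ _ _ _ _ _ _ _.
have toZ m n : (zdiff m n)%:~R = m%:R - n%:R :> Zc by rewrite /zdiff rmorphB.
pose G := Yu (zdiff w'.1.2.1 w'.1.1.1)%:~R (Yl (zdiff w'.2.2 w'.1.2.2)%:~R
  (Yu (zdiff w.2.1 w'.2.1)%:~R (Yl (zdiff w.1.2.2 w.2.2)%:~R (Yu (zdiff w.1.1.1 w.1.2.1)%:~R
  (Yl (zdiff w'.1.1.2 w.1.1.2)%:~R Y))))).
have gE : val G = (g (val Y).1, g (val Y).2) by [].
transitivity (G == Yt s Y); last first.
  by rewrite -(inj_eq val_inj) gE /= xpair_eqE.
have tinj : injective (Yt s).
  move=> Y1 Y2 /(congr1 (fun Y => val (Yt s^-1%g Y))) /=.
  by rewrite -!tactM mulVg !tact1 => /val_inj.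
pose Q Y := Yl (- (w'.2.2 : nat)%:R) (Yl (w'.1.2.2 : nat)%:R (Yu (- (w'.1.2.1 : nat)%:R) (Yu (w'.1.1.1 : nat)%:R Y))).
have Qinj : injective (fun Y => Yu (w'.2.1 : nat)%:R (Q Y)).
  by do ?[apply: (inj_comp (can_inj (YuK _)))|apply: (inj_comp (can_inj (YuNK _)))|apply: (inj_comp (can_inj (YlK _)))|apply: (inj_comp (can_inj (YlNK _)))]; exact: inj_id.
rewrite -[RHS](inj_eq Qinj); congr (_ == _).
  have zE (p q : vec * vec) : p.1 = q.1 -> p.2 = q.2 -> p = q.
    by case: p q => p1 p2 [q1 q2] /= -> ->.
  apply/val_inj/zE; rewrite /= !toZ; symmetry; exact: word_collapse.
have -> : pY w'.1.1 (Yl (w'.1.1.2 : nat)%:R Y) = Yu (w'.1.1.1 : nat)%:R Y.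
  by rewrite /pY YlD addNr Yl0.
by rewrite /Q /pY /pY' !(Yut, Ylt).
Qed.

Lemma words_total (i : nat) (x : int) : (0 < i <= c)%N -> (i%:Z %| x ^+ 2 - 1)%Z ->
  \sum_(w : idx * idx * idx) \sum_(w' : idx * idx * idx)
    (word_scalar i x (zdiff w'.1.2.1 w'.1.1.1) (zdiff w'.2.2 w'.1.2.2) (zdiff w.2.1 w'.2.1)
     (zdiff w.1.2.2 w.2.2) (zdiff w.1.1.1 w.1.2.1) (zdiff w'.1.1.2 w.1.1.2))%:R
  <= (H * K)%:R ^+ 3 * (600 * T ^+ 3 * (K%:R ^+ 2 + H%:R * K%:R ^+ 3 / i%:R + H%:R ^+ 3 * K%:R ^+ 3 / i%:R ^+ 3)) :> R.
Proof.
move=> /andP[i0 ic] hx.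
pose BT := ('I_H * 'I_K * 'I_H * 'I_K * 'I_H * 'I_K)%type.
pose phi (p : BT * BT) : (idx * idx * idx) * (idx * idx * idx) :=
  let: (h1', k2', h3', k3, h2, k1, (h2', k3', h1, k2, h3, k1')) := p in
  ((h1, k1), (h2, k2), (h3, k3), ((h1', k1'), (h2', k2'), (h3', k3'))).
pose psi (p : (idx * idx * idx) * (idx * idx * idx)) : BT * BT :=
  let: ((h1, k1), (h2, k2), (h3, k3), ((h1', k1'), (h2', k2'), (h3', k3'))) := p in
  (h1', k2', h3', k3, h2, k1, (h2', k3', h1, k2, h3, k1')).
rewrite pair_bigA (reindex phi) /=; last first.
  by exists psi => [[[[[[[? ?] ?] ?] ?] ?] [[[[[? ?] ?] ?] ?] ?]]|[[[[? ?] [? ?]] [? ?]] [[[? ?] [? ?]] [? ?]]]] _.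
pose G (b v : BT) : R := let w := (phi (b, v)).1 in let w' := (phi (b, v)).2 in
    (word_scalar i x (zdiff w'.1.2.1 w'.1.1.1) (zdiff w'.2.2 w'.1.2.2) (zdiff w.2.1 w'.2.1)
     (zdiff w.1.2.2 w.2.2) (zdiff w.1.1.1 w.1.2.1) (zdiff w'.1.1.2 w.1.1.2))%:R.
rewrite (eq_bigr (fun p => G p.1 p.2)) => [|[b v] _]; last by [].
rewrite -(pair_bigA _ G) /=.
have hin b : \sum_v G b v <= 600 * T ^+ 3 * (K%:R ^+ 2 + H%:R * K%:R ^+ 3 / i%:R + H%:R ^+ 3 * K%:R ^+ 3 / i%:R ^+ 3).
  case: b => [[[[[h1' k2'] h3'] k3] h2] k1].
  have hT1 n : (0 < n <= H * K)%N -> (size (divisors n))%:R <= T.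
    by move=> /andP[n0 nc]; apply: hT; rewrite n0 (leq_trans nc).
  have hT2 : (size (divisors i))%:R <= T.
    by apply: hT; rewrite i0 (leq_trans ic) // -mulnn leq_pmulr.
  apply: le_trans (@count_words R H K i x T HK i0 hx hT1 hT2 h1' k2' h3' k3 h2 k1 (ltn_ord _) (ltn_ord _) (ltn_ord _) (ltn_ord _)).
  by rewrite !pair_bigA /=; apply: ler_sum => -[[[[[? ?] ?] ?] ?] ?] _.
apply: le_trans (ler_sum _ (fun b _ => hin b)) _.
rewrite sumr_const !card_prod !card_ord -[X in X <= _]mulr_natl.
rewrite (_ : (_ * _ * _)%N%:R = (H * K)%:R ^+ 3) // !natrM; ring.
Qed.

Lemma trace_bound a :
  let h := (sqd (c %/ (D %/ gcdn a D)))%:R in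
  \sum_(w : idx * idx * idx) \sum_(w' : idx * idx * idx) \sum_(Y : inYT)
    \sum_(s : {unit Zc} | k0 * a * (val s) ^+ 2 == k0 * a)
     (pY w.2 (pY' w.1.2 (pY w.1.1 Y)) == Yt s (pY w'.2 (pY' w'.1.2 (pY w'.1.1 Y))))%:R
  <= 7200 * T ^+ 6 * (D * c)%:R * (H * K)%:R ^+ 3 *
   (c%:R * K%:R ^+ 2 + h * H%:R * K%:R ^+ 3 + h * H%:R ^+ 3 * K%:R ^+ 3 / (D %/ gcdn a D)%:R ^+ 2) :> R.
Proof.
set Db := (D %/ gcdn a D)%N; set hb := sqd _; rewrite [X in is_true X]/=.
have T1 : 1 <= T by apply: le_trans (hT (_ : (0 < 1 <= c ^ 2)%N)); rewrite // expn_gt0 c0.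
have T0 : 0 <= T by apply: le_trans T1.
have Db0 : (0 < Db)%N by rewrite divn_gt0 ?gcdn_gt0 ?D0 ?orbT // dvdn_leq // dvdn_gcdr.
pose ws (i : nat) (x : int) (w w' : idx * idx * idx) := (word_scalar i x (zdiff w'.1.2.1 w'.1.1.1) (zdiff w'.2.2 w'.1.2.2) (zdiff w.2.1 w'.2.1)
     (zdiff w.1.2.2 w.2.2) (zdiff w.1.1.1 w.1.2.1) (zdiff w'.1.1.2 w.1.1.2)).
apply: (@le_trans _ _ (\sum_(w : idx * idx * idx) \sum_(w' : idx * idx * idx)
  D%:R * (4 * T * c%:R) * \sum_(i <- divisors c | (Db %| i)%N)
    ((i * sqd (c %/ i))%:R * \sum_(x < i | (i%:Z %| (x : nat)%:Z ^+ 2 - 1)%Z) (ws i (x : nat)%:Z w w')%:R))).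
  apply: ler_sum => w _; apply: ler_sum => w' _.
  apply: le_trans (count_eigen_pairs c_gt1 Dc hT a _ _ _ _ _ _).
  rewrite (reindex (Yl (w'.1.1.2 : nat)%:R)) /=; last by exists (Yl (- (w'.1.1.2 : nat)%:R)) => Y _; rewrite ?YlK ?YlNK.
  rewrite [X in _ <= X](eq_bigl (fun z => inY D z && xpredT z)); last by move=> z; rewrite andbT.
  rewrite -(big_subType _ inYT) /=; apply: ler_sum => Y _.
  rewrite -(big_subType (fun t : Zc => k0 * a * t ^+ 2 == k0 * a) {unit Zc}) /=.
  by apply: ler_sum => s _; rewrite trace_word.
under eq_bigr do rewrite -mulr_sumr.
rewrite -mulr_sumr.
have -> : \sum_w \sum_w' \sum_(i <- divisors c | (Db %| i)%N)
    ((i * sqd (c %/ i))%:R * \sum_(x < i | (i%:Z %| (x : nat)%:Z ^+ 2 - 1)%Z) (ws i (x : nat)%:Z w w')%:R) =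
  \sum_(i <- divisors c | (Db %| i)%N) (i * sqd (c %/ i))%:R *
     \sum_(x < i | (i%:Z %| (x : nat)%:Z ^+ 2 - 1)%Z) \sum_w \sum_w' (ws i (x : nat)%:Z w w')%:R :> R.
  under eq_bigr do rewrite exchange_big /=.
  rewrite exchange_big /=; apply: eq_bigr => i _.
  under eq_bigr do rewrite -mulr_sumr.
  rewrite -mulr_sumr; congr (_ * _).
  rewrite [RHS]exchange_big /=; apply: eq_bigr => w _; exact: exchange_big.
set X := c%:R * _ + _ + _.
have X0 : 0 <= X by rewrite !addr_ge0 ?mulr_ge0 ?invr_ge0 ?exprn_ge0.
have key i : i \in divisors c -> (Db %| i)%N -> (i * sqd (c %/ i))%:R *
     (\sum_(x < i | (i%:Z %| (x : nat)%:Z ^+ 2 - 1)%Z) \sum_w \sum_w' (ws i (x : nat)%:Z w w')%:R) <=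
     1800 * T ^+ 4 * (H * K)%:R ^+ 3 * X.
  rewrite -dvdn_divisors // => ic Di; have i0 := dvdn_gt0 c0 ic.
  have ilec : (i <= c)%N by exact: dvdn_leq.
  set Xi := K%:R ^+ 2 + H%:R * K%:R ^+ 3 / i%:R + H%:R ^+ 3 * K%:R ^+ 3 / i%:R ^+ 3 : R.
  have Xi0 : 0 <= Xi by rewrite !addr_ge0 ?mulr_ge0 ?invr_ge0 ?exprn_ge0.
  have h1 : \sum_(x < i | (i%:Z %| (x : nat)%:Z ^+ 2 - 1)%Z) \sum_w \sum_w' (ws i (x : nat)%:Z w w')%:R <=
      3 * T * ((H * K)%:R ^+ 3 * (600 * T ^+ 3 * Xi)).
    apply: (@le_trans _ _ (\sum_(x < i) (i%:Z %| (x : nat)%:Z ^+ 2 - 1)%Z%:R * ((H * K)%:R ^+ 3 * (600 * T ^+ 3 * Xi)))).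
      rewrite big_mkcond; apply: ler_sum => x _; case: ifP => [hx|_]; last by rewrite mul0r.
      by rewrite mul1r; apply: words_total => //; rewrite i0.
    rewrite -mulr_suml ler_wpM2r ?mulr_ge0 ?exprn_ge0 //.
    apply: le_trans (count_sqr1 R i0) _; rewrite ler_wpM2l //.
    by apply: hT; rewrite i0 (leq_trans ilec) // -mulnn leq_pmulr.
  apply: le_trans (ler_wpM2l (ler0n _ _) h1) _.
  have h2 : (i * sqd (c %/ i))%:R * Xi <= X.
    have ciD : (sqd (c %/ i) <= hb)%N.
      apply: leq_sqd_dvd; first by rewrite divn_gt0 // (leq_trans _ ilec) // dvdn_leq.
      apply/dvdnP; exists (i %/ Db)%N; have /dvdnP[m cm] := ic; have /dvdnP[l il] := Di.
      have l0 : (0 < l)%N by move: i0; rewrite il muln_gt0 => /andP[].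
      by rewrite cm mulnK // il mulnK // mulnA mulnK // mulnC.
    have isq : (i * sqd (c %/ i) <= c)%N.
      by rewrite -{2}(divnK ic) mulnC leq_mul2r sqd_leq ?orbT // divn_gt0.
    have iR : (i%:R : R) != 0 by rewrite pnatr_eq0 -lt0n.
    have Dbi : (Db <= i)%N by exact: dvdn_leq.
    have -> : (i * sqd (c %/ i))%:R * Xi = (i * sqd (c %/ i))%:R * K%:R ^+ 2 +
       (sqd (c %/ i))%:R * H%:R * K%:R ^+ 3 + (sqd (c %/ i))%:R * (H%:R ^+ 3 * K%:R ^+ 3 / i%:R ^+ 2).
      by rewrite /Xi natrM; field.
    rewrite /X; apply: lerD; first apply: lerD.
    - by rewrite ler_wpM2r ?exprn_ge0 // ler_nat.
    - by rewrite ler_wpM2r ?exprn_ge0 // ler_wpM2r // ler_nat.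
    - rewrite -!mulrA; apply: ler_pM => //; first by rewrite !mulr_ge0 ?invr_ge0 ?exprn_ge0.
        by rewrite ler_nat.
      do !rewrite ler_wpM2l //.
      by rewrite lef_pV2 ?posrE ?exprn_gt0 ?ltr0n // lerXn2r ?nnegrE // ler_nat.
  have -> : (i * sqd (c %/ i))%:R * (3 * T * ((H * K)%:R ^+ 3 * (600 * T ^+ 3 * Xi))) =
     1800 * T ^+ 4 * (H * K)%:R ^+ 3 * ((i * sqd (c %/ i))%:R * Xi) by ring.
  by rewrite ler_wpM2l ?mulr_ge0 ?exprn_ge0.
apply: (@le_trans _ _ (D%:R * (4 * T * c%:R) * (T * (1800 * T ^+ 4 * (H * K)%:R ^+ 3 * X)))).
  rewrite ler_wpM2l ?mulr_ge0 //.
  apply: (@le_trans _ _ (\sum_(i <- divisors c) (1800 * T ^+ 4 * (H * K)%:R ^+ 3 * X))).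
    rewrite big_mkcond big_seq [X in _ <= X]big_seq; apply: ler_sum => i ic.
    by case: ifP => [|_]; [exact: key|rewrite ?mulr_ge0 ?exprn_ge0].
  rewrite big_const_seq count_predT iter_addr_0 -[X in X <= _]mulr_natl.
  rewrite ler_wpM2r ?mulr_ge0 ?exprn_ge0 //; apply: hT; rewrite c0 -mulnn leq_pmulr //.
by rewrite natrM le_eqVlt; apply/orP; left; apply/eqP; ring.
Qed.

Definition smooth (cf : idx -> R[i]) (A : vec -> R[i]) v : R[i] :=
  \sum_i cf i * A (vu (i.1 : nat)%:R (vl (- (i.2 : nat)%:R) v)).

Lemma Fhat_smooth cf A a z :
  Fhat D a (smooth cf A) z = \sum_i cf i * Fhat D a A (zu (i.1 : nat)%:R (zl (- (i.2 : nat)%:R) z)).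
Proof.
rewrite /Fhat /smooth; under eq_bigr do rewrite mulr_sumr.
rewrite exchange_big /=; apply: eq_bigr => i _; rewrite mulr_sumr; apply: eq_bigr => j _.
by rewrite mulrCA vl_lc vu_lc.
Qed.

Lemma Fhat_tact (A : vec -> R[i]) a (s : {unit Zc}) z : (forall (t : Zc) v, t \is a GRing.unit -> A (vscale t v) = A v) ->
  Fhat D a A (tact s z) = Fhat D (a * val s ^+ 2) A z.
Proof.
move=> homA; have us := valP s.
rewrite /Fhat (reindex (fun j => val s ^+ 2 * j)) /=; last first.
  exists (fun j => (val s ^+ 2)^-1 * j) => j _; first by rewrite mulKr // unitrX.
  by rewrite mulVKr // unitrX.
apply: eq_bigr => j _; rewrite !mulrA; congr (_ * _).
by rewrite vscale_lc // homA.
Qed.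

Definition gain : R :=
  D%:R * (c%:R / (H%:R ^+ 3 * K%:R) + (sqd (c %/ D))%:R / H%:R ^+ 2 + (sqd (c %/ D))%:R / D%:R ^+ 2).

Lemma gain_ge0 : 0 <= gain.
Proof.
by rewrite /gain; do ?[apply: addr_ge0|apply: mulr_ge0|rewrite invr_ge0|apply: exprn_ge0]; rewrite ?ler0n.
Qed.

Lemma Fhat_amplified a A cf :
  (forall (t : Zc) v, t \is a GRing.unit -> A (vscale t v) = A v) ->
  (forall i, cabs (cf i) = (H * K)%:R^-1) ->
  (\sum_(z | inY D z) cabs (Fhat D a (smooth cf A) z) ^+ 2) ^+ 3 <=
  (\sum_(z | inY D z) cabs (Fhat D a A z) ^+ 2) ^+ 3 * (7200 * T ^+ 7 * (gcdn a D)%:R ^+ 3 * gain).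
Proof.
move=> homA cfE; set b := gcdn a D.
have T1 : 1 <= T by apply: le_trans (hT (_ : (0 < 1 <= c ^ 2)%N)); rewrite // expn_gt0 c0.
have T0 : 0 <= T by apply: le_trans T1.
pose F (Y : inYT) := Fhat D a A (val Y).
have sumE (G : vec * vec -> R[i]) : \sum_(z | inY D z) cabs (G z) ^+ 2 = nsq (fun Y : inYT => G (val Y)).
  by rewrite /nsq (big_subType xpredT inYT (fun z => cabs (G z) ^+ 2)); apply: eq_bigl => z; rewrite andbT.
rewrite !sumE -/F.
have -> : nsq (fun Y : inYT => Fhat D a (smooth cf A) (val Y)) = nsq (psum cf pY F).
  by apply: eq_bigr => Y _; rewrite Fhat_smooth.
have Fact s Y : F (Yt s Y) = Fhat D (a * val s ^+ 2) A (val Y) by exact: (Fhat_tact a s (val Y) homA).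
have ipF s : k0 * (a * val s ^+ 2) != k0 * a -> ip (fun Y => F (Yt s Y)) F = 0.
  move=> ne; rewrite -[RHS](Fhat_orth c_gt1 Dc A A ne) /ip.
  rewrite [RHS](eq_bigl (fun z => inY D z && xpredT z)) => [|z]; last by rewrite andbT.
  by rewrite -(big_subType xpredT inYT); apply: eq_bigr => Y _; rewrite Fact.
have [F0|Fn0] := eqVneq (nsq F) 0.
  have Fz Y : F Y = 0.
    move/eqP: F0; rewrite psumr_eq0 => [/allP /(_ Y)|Y' _]; last by rewrite exprn_ge0 ?cabs_ge0.
    by rewrite mem_index_enum => /(_ isT) /=; rewrite sqrf_eq0 => /eqP/cabs_eq0.
  rewrite F0 expr0n mul0r; suff -> : nsq (psum cf pY F) = 0 by rewrite expr0n.
  rewrite /nsq big1 // => Y _.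
  by rewrite /psum big1 ?cabs0 ?expr0n // => i _; rewrite Fz mulr0.
have stabF s : fstab Yt F s -> k0 * a * val s ^+ 2 == k0 * a.
  move=> /fstabP hs; apply: contraNT Fn0 => ne.
  have : ip F F = 0.
    rewrite -[RHS](ipF s); first by apply: eq_bigr => Y _; rewrite hs.
    by rewrite mulrA.
  by rewrite ip_nsq => /eqP; rewrite fmorph_eq0.
have Forth s : ~~ fstab Yt F s -> ip (fun Y => F (Yt s Y)) F = 0.
  move=> ns; apply: ipF; apply: contraNneq ns => e; apply/fstabP => Y.
  by rewrite Fact; exact: eq_Fhat.
have act1 Y : Yt 1%g Y = Y by apply: val_inj; rewrite /= tact1.
have actM s t Y : Yt (s * t)%g Y = Yt s (Yt t Y) by apply: val_inj; rewrite /= tactM.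
have actC s t Y : Yt s (Yt t Y) = Yt t (Yt s Y) by apply: val_inj; rewrite /= tactC.
have := amplification act1 actM actC pYK pY'K (fun i s Y => pYt i s Y) Forth cfE.
rewrite (card_unit_Zc c_gt1) => hamp.
set phi := totient c in hamp.
have phi0 : (0 : R) < phi%:R by rewrite ltr0n totient_gt0.
rewrite -(ler_pM2l phi0); apply: le_trans hamp _.
set Tr := (X in _ * _ * X <= _).
have hTr : Tr <= 7200 * T ^+ 6 * (D * c)%:R * (H * K)%:R ^+ 3 *
   (c%:R * K%:R ^+ 2 + (sqd (c %/ (D %/ b)))%:R * H%:R * K%:R ^+ 3 + (sqd (c %/ (D %/ b)))%:R * H%:R ^+ 3 * K%:R ^+ 3 / (D %/ b)%:R ^+ 2).
  apply: le_trans (trace_bound a); rewrite /Tr natr_sum; apply: ler_sum => w _.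
  rewrite natr_sum; apply: ler_sum => w' _; rewrite natr_sum; apply: ler_sum => Y _.
  rewrite natr_sum big_mkcond [X in _ <= X]big_mkcond; apply: ler_sum => s _.
  by case: ifP => [/stabF ->|_] //; case: ifP.
have b0 : (0 < b)%N by rewrite gcdn_gt0 D0 orbT.
have bD : (b %| D)%N by exact: dvdn_gcdr.
have hb : (sqd (c %/ (D %/ b)))%:R <= b%:R * (sqd (c %/ D))%:R :> R.
  rewrite -natrM ler_nat; have -> : (c %/ (D %/ b) = c %/ D * b)%N.
    have /dvdnP[m cm] := Dc; have /dvdnP[l Dl] := bD.
    have l0 : (0 < l)%N by move: D0; rewrite Dl muln_gt0 => /andP[].
    by rewrite cm mulnK // {1}Dl Dl mulnK // mulnCA mulnC mulnK // mulnC.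
  by apply: sqd_mul_leq => //; rewrite divn_gt0 // dvdn_leq.
have HR : (H%:R : R) != 0 by rewrite pnatr_eq0 -lt0n.
have KR : (K%:R : R) != 0 by rewrite pnatr_eq0 -lt0n.
have bR : (b%:R : R) != 0 by rewrite pnatr_eq0 -lt0n.
have DR : (D%:R : R) != 0 by rewrite pnatr_eq0 -lt0n.
have b1 : 1 <= b%:R :> R by rewrite ler1n.
have hc : c%:R <= phi%:R * T.
  apply: (@le_trans _ _ (phi * tau c)%:R); first by rewrite ler_nat leq_totient_tau.
  by rewrite natrM ler_wpM2l //; apply: hT; rewrite c0 -mulnn leq_pmulr.
set h := (sqd (c %/ (D %/ b)))%:R in hb hTr; set h0 := (sqd (c %/ D))%:R in hb.
have hX : (H * K)%:R^-1 ^+ 3 * (c%:R * K%:R ^+ 2 + h * H%:R * K%:R ^+ 3 + h * H%:R ^+ 3 * K%:R ^+ 3 / (D %/ b)%:R ^+ 2) <=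
   b%:R ^+ 3 * (c%:R / (H%:R ^+ 3 * K%:R) + h0 / H%:R ^+ 2 + h0 / D%:R ^+ 2).
  rewrite natf_div // natrM.
  have -> : (H%:R * K%:R)^-1 ^+ 3 * (c%:R * K%:R ^+ 2 + h * H%:R * K%:R ^+ 3 + h * H%:R ^+ 3 * K%:R ^+ 3 / (D%:R / b%:R) ^+ 2) =
    c%:R / (H%:R ^+ 3 * K%:R) + h / H%:R ^+ 2 + h * b%:R ^+ 2 / D%:R ^+ 2 by field; rewrite HR KR bR DR.
  rewrite !mulrDr; apply: lerD; first apply: lerD.
  - by rewrite -[X in X <= _]mul1r ler_wpM2r ?mulr_ge0 ?invr_ge0 ?mulr_ge0 ?exprn_ge0 // exprn_ege1.
  - rewrite mulrA ler_wpM2r ?invr_ge0 ?exprn_ge0 //; apply: le_trans hb _.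
    by rewrite ler_wpM2r // exprS -[X in X <= _]mulr1 ler_wpM2l // exprn_ege1.
  - rewrite [X in _ <= X]mulrA ler_wpM2r ?invr_ge0 ?exprn_ge0 //.
    by rewrite (_ : b%:R ^+ 3 * h0 = b%:R * h0 * b%:R ^+ 2) ?ler_wpM2r ?exprn_ge0 //; ring.
set n3 := nsq F ^+ 3; have n30 : 0 <= n3 by rewrite exprn_ge0 ?nsq_ge0.
apply: le_trans (ler_wpM2l _ hTr) _; first by rewrite mulr_ge0 // exprn_ge0 // invr_ge0.
set Xb := (X in _ <= X) in hX; set X0 := (_ * K%:R ^+ 2 + _ + _) in hX *.
have HKR : ((H * K)%:R : R) != 0 by rewrite natrM mulf_neq0.
have -> : n3 * (H * K)%:R^-1 ^+ 6 * (7200 * T ^+ 6 * (D * c)%:R * (H * K)%:R ^+ 3 * X0) =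
  7200 * n3 * T ^+ 6 * D%:R * (c%:R * ((H * K)%:R^-1 ^+ 3 * X0)) by rewrite (natrM _ D); field; rewrite HR KR.
have -> : phi%:R * (n3 * (7200 * T ^+ 7 * b%:R ^+ 3 * gain)) = 7200 * n3 * T ^+ 6 * D%:R * (phi%:R * T * Xb).
  by rewrite /gain /Xb -/h0; ring.
apply: ler_wpM2l; first by rewrite !mulr_ge0 ?exprn_ge0 ?nsq_ge0 ?ler0n.
apply: (ler_pM _ _ hc hX); rewrite ?ler0n // /X0.
by do ?[apply: addr_ge0|apply: mulr_ge0|rewrite invr_ge0|apply: exprn_ge0]; rewrite ?ler0n.
Qed.
End Operator.

(** * Bilinear forms in Kloosterman sums *)

Section Bilinear.
Variables (R : realType) (c : nat).
Hypothesis c_gt1 : (1 < c)%N.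
Local Notation Zc := 'Z_c.
Local Notation vec := (Zc * Zc)%type.
Implicit Types (v w : vec) (x y a : Zc).
Local Notation fn := (fun m : nat => m%:R : Zc).

Lemma kloosterman_psi (m n : nat) : kloosterman R m n c =
  \sum_(x : Zc | x \is a GRing.unit) psi R (m%:R * x + n%:R * x^-1).
Proof.
apply: eq_bigr => x _.
have -> : m%:R * x + n%:R * x^-1 = (m * x + n * (x^-1 : Zc))%N%:R by rewrite natrD !natrM !Zc_valK.
by rewrite psi_nat // natrD !natrM -!pmulrn.
Qed.

Definition vswap v : vec := (v.2, v.1).

Lemma bilinear_kloosterman (I J : seq nat) (al be : nat -> R[i]) :
  \sum_v Afun I al fn v * Afun J be fn (vswap v) =
  (totient c)%:R * \sum_(m <- I) \sum_(n <- J) al m * be n * kloosterman R m n c.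
Proof.
pose G (u : Zc) := \sum_(m <- I) \sum_(n <- J) al m * be n * psi R (m%:R * u + n%:R * u^-1).
transitivity (\sum_(y : Zc | y \is a GRing.unit) \sum_(u : Zc | u \is a GRing.unit) G u).
  rewrite -(pair_bigA _ (fun x y => Afun I al fn (x, y) * Afun J be fn (vswap (x, y)))) exchange_big /=.
  rewrite [RHS]big_mkcond; apply: eq_bigr => y _; rewrite /Afun /vswap /=.
  case: ifP => uy; last by rewrite big1 // => x _; rewrite mul0r.
  rewrite [RHS]big_mkcond [LHS](reindex (fun u => u * y)) /=; last first.
    by exists (fun x => x / y) => x _; rewrite ?mulrK ?mulrVK.
  apply: eq_bigr => u _; rewrite unitrMl // mulrK //; case: ifP => uu; last by rewrite mulr0.
  rewrite /G mulr_suml; apply: eq_bigr => m _; rewrite mulr_sumr; apply: eq_bigr => n _.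
  by rewrite mulrACA psiD // invrM // mulVKr.
rewrite sumr_const -[LHS]mulr_natl.
have -> : #|[pred y : Zc | y \is a GRing.unit]| = totient c.
  rewrite -(card_unit_Zc c_gt1) -!sum1_card.
  rewrite (eq_bigl (fun y : Zc => (y \is a GRing.unit) && xpredT y)) => [|y]; last by rewrite andbT.
  by rewrite -(big_subType xpredT {unit Zc} (fun=> 1%N)).
congr (_ * _); rewrite /G exchange_big; apply: eq_bigr => m _.
rewrite exchange_big; apply: eq_bigr => n _.
by rewrite kloosterman_psi mulr_sumr.
Qed.

Lemma Afun_scale (I : seq nat) (al : nat -> R[i]) (f : nat -> Zc) (s : Zc) v : s \is a GRing.unit ->
  Afun I al f (vscale s v) = Afun I al f v.
Proof.
move=> us; rewrite /Afun /vscale /= unitrMr //; case: ifP => // uv.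
apply: eq_bigr => m _; congr (_ * psi R (_ * _)).
by rewrite invrM // [s * _]mulrC [_^-1 * _]mulrC -mulrA mulVKr.
Qed.

Lemma Afun_vu (I : seq nat) (al : nat -> R[i]) (f : nat -> Zc) (h : Zc) v :
  Afun I al f (vu h v) = Afun I (fun m => al m * psi R (f m * h)) f v.
Proof.
rewrite /Afun /vu /=; case: ifP => // uv; apply: eq_bigr => m _.
by rewrite -mulrA -psiD //; congr (_ * psi R _); rewrite mulrDl mulrK // addrC mulrDr.
Qed.

Definition mean_phase (H i0 m : nat) : R[i] :=
  H%:R^-1 * \sum_(h < H) psi R ((m%:R - i0%:R) * (h : nat)%:R : Zc).

Lemma cabs_mean_phase H i0 M m : (0 < H)%N -> (8 * M * H.-1 <= c)%N -> m \in iota i0 M ->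
  1 / 2 <= cabs (mean_phase H i0 m).
Proof.
move=> H0 hMH; rewrite mem_iota => /andP[im mi].
rewrite /mean_phase cabsM cabsV.
have H0R : (0 : R) < H%:R by rewrite ltr0n.
have -> : cabs (H%:R : R[i]) = H%:R.
  by rewrite -(rmorph_nat (real_complex R)) cabs_real ger0_norm ?ler0n.
rewrite ler_pdivlMl // -[H%:R]/(H%:R : R).
apply: le_trans (Re_le_cabs _); rewrite raddf_sum.
have -> : H%:R * (1 / 2) = \sum_(h < H) (1 / 2) :> R by rewrite sumr_const card_ord -[RHS]mulr_natl.
apply: ler_sum => h _.
rewrite -natrB // -natrM psi_nat //; apply: Re_e2pi_ge; first by rewrite divr_ge0.
rewrite mulrA ler_pdivrMr ?ltr0n ?(ltnW c_gt1) // mul1r -natrM ler_nat.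
by apply: leq_trans hMH; rewrite -mulnA leq_mul2l /= leq_mul //; have := ltn_ord h; lia.
Qed.

Lemma Afun_mean (H i0 M : nat) (al : nat -> R[i]) v :
  (forall m, m \in iota i0 M -> mean_phase H i0 m != 0) ->
  \sum_(h < H) H%:R^-1 * psi R (- (i0%:R * (h : nat)%:R) : Zc) *
     Afun (iota i0 M) (fun m => al m / mean_phase H i0 m) fn (vu (h : nat)%:R v) =
  Afun (iota i0 M) al fn v.
Proof.
move=> th0; under eq_bigr do rewrite Afun_vu.
rewrite /Afun; case: ifP => uv; last by rewrite big1 // => h _; rewrite mulr0.
under eq_bigr do rewrite mulr_sumr.
rewrite exchange_big /= big_seq [RHS]big_seq; apply: eq_bigr => m mI.
rewrite -[X in _ = X * _](divfK (th0 _ mI)) {3}/mean_phase mulrCA !mulrA [_ * H%:R^-1]mulrC.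
rewrite mulr_sumr mulr_suml; apply: eq_bigr => h _.
have -> : psi R ((m%:R - i0%:R) * (h : nat)%:R : Zc) = psi R (- (i0%:R * (h : nat)%:R) : Zc) * psi R (m%:R * (h : nat)%:R : Zc).
  by rewrite -psiD //; congr (psi R _); rewrite mulrBl addrC.
ring.
Qed.

Lemma smooth_bilinear (H K i0 j0 M N : nat) (al be : nat -> R[i]) :
  (forall m, m \in iota i0 M -> mean_phase H i0 m != 0) ->
  (forall n, n \in iota j0 N -> mean_phase K j0 n != 0) ->
  \sum_v smooth (fun i : 'I_H * 'I_K => H%:R^-1 * psi R (- (i0%:R * (i.1 : nat)%:R) : Zc) * (K%:R^-1 * psi R (- (j0%:R * (i.2 : nat)%:R) : Zc)))
       (Afun (iota i0 M) (fun m => al m / mean_phase H i0 m) fn) v *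
     Afun (iota j0 N) (fun n => be n / mean_phase K j0 n) fn (vswap v) =
  \sum_v Afun (iota i0 M) al fn v * Afun (iota j0 N) be fn (vswap v).
Proof.
move=> thI thJ; under eq_bigr do rewrite /smooth mulr_suml.
rewrite exchange_big /=.
under [RHS]eq_bigr do rewrite -(Afun_mean al _ thI) -(Afun_mean be _ thJ) mulr_suml.
rewrite [RHS]exchange_big /=.
under [RHS]eq_bigr => h _.
  under eq_bigr do rewrite mulr_sumr.
  rewrite exchange_big /=; over.
rewrite [RHS]pair_bigA /=; apply: eq_bigr => -[h k] _ /=.
rewrite (reindex (vl (k : nat)%:R)) /=; last by exists (vl (- (k : nat)%:R)) => v _; rewrite ?vlK ?vlNK.
apply: eq_bigr => v _; rewrite vlK.
rewrite -[vu (k : nat)%:R (vswap v)]/(vswap (vl (k : nat)%:R v)); ring.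
Qed.
End Bilinear.

Section Rotation.
Variable A : finComUnitRingType.
Implicit Types (v w : A * A).

Definition vrot v : A * A := (- v.2, v.1).

Lemma vrot_lc x v y w : vrot (vlc x v y w) = vlc x (vrot v) y (vrot w).
Proof. by rewrite /vrot /vlc /=; congr pair; ring. Qed.

Lemma vdet_rot v w : vdet (vrot v) (vrot w) = vdet v w.
Proof. by rewrite /vdet /vrot /=; ring. Qed.

Lemma vrot4 v : vrot (vrot (vrot (vrot v))) = v.
Proof. by case: v => a b; rewrite /vrot /= !opprK. Qed.

Lemma primv_rot v : primv v -> primv (vrot v).
Proof. by move=> /primvP[w e]; apply/primvP; exists (vrot w); rewrite vdet_rot. Qed.
End Rotation.

Section RotEnergy.
Variables (R : realType) (c D : nat).
Local Notation Zc := 'Z_c.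
Local Notation vec := (Zc * Zc)%type.

Definition energy (G : vec -> R[i]) (a : Zc) : R := \sum_(z | inY D z) cabs (Fhat D a G z) ^+ 2.

Lemma energy_ge0 G a : 0 <= energy G a.
Proof. by apply: sumr_ge0 => z _; rewrite exprn_ge0 ?cabs_ge0. Qed.

Lemma energy_rot G a : energy (fun v => G (vrot v)) a = energy G a.
Proof.
pose rz (z : vec * vec) := (vrot z.1, vrot z.2).
have rY z : inY D z -> inY D (rz z).
  move=> /and4P[p /eqP d1 /eqP d2 dt].
  by rewrite /inY primv_rot // vdet_rot dt /vrot [_.1]/= [_.2]/= mulrN d1 d2 oppr0 eqxx.
have rz4 z : rz (rz (rz (rz z))) = z by case: z => v w; rewrite /rz /= !vrot4.
rewrite /energy [RHS](reindex rz) /=; last by exists (fun z => rz (rz (rz z))) => z _; exact: rz4.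
apply: eq_big => [z|z _].
  by apply/idP/idP => [/rY|h] //; rewrite -(rz4 z); do 3!apply: (rY).
congr (cabs _ ^+ 2); apply: eq_bigr => j _; congr (_ * _).
by rewrite vrot_lc.
Qed.
End RotEnergy.

Lemma natr_inj_iota (c i0 M : nat) : (1 < c)%N -> (M <= c)%N ->
  {in iota i0 M &, injective (fun m : nat => m%:R : 'Z_c)}.
Proof.
move=> c1 Mc m n; rewrite !mem_iota => /andP[im mi] /andP[inn ni] /eqP.
wlog mn : m n im mi inn ni / (m <= n)%N => [hw e|].
  by have [/hw|/ltnW/hw] := leqP m n; [|rewrite eq_sym in e]; move=> h; [apply: h|symmetry; apply: h].
rewrite eq_sym -subr_eq0 -natrB // Zc_natr_eq0 // => cmn.
have : (n - m < c)%N by lia.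
by case: (posnP (n - m)) => [|p]; [lia|move/(dvdn_leq p): cmn; lia].
Qed.

Lemma coprime_pnat (pi : nat_pred) (b m : nat) : pi.-nat b ->
  (forall p, prime p -> (p %| b)%N -> p \in pi -> ~~ (p %| m)%N) -> coprime b m.
Proof.
move=> pib h; have b0 : (0 < b)%N by case/andP: pib.
apply: contraT; rewrite /coprime neq_ltn ltnNge gcdn_gt0 b0 /= => /pdivP[p pp pg].
have pb : (p %| b)%N by apply: dvdn_trans pg (dvdn_gcdl _ _).
have := h p pp pb (elimT (pnatP pi b0) pib p pp pb).
by rewrite (dvdn_trans pg (dvdn_gcdr _ _)).
Qed.

Section Pointwise.
Variables (R : realType) (c D : nat) (T : R).
Hypotheses (c_gt1 : (1 < c)%N) (Dc : (D %| c)%N).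
Hypothesis hT : forall n, (0 < n <= c ^ 2)%N -> (tau n)%:R <= T.
Variables (i0 j0 M N : nat) (al be : nat -> R[i]).
Hypotheses (N0 : (0 < N)%N) (NM : (N <= M)%N) (Mc : (M <= c)%N).
Hypothesis cop : forall p, prime p -> (p %| D)%N ->
  (forall m, m \in iota i0 M -> al m != 0 -> ~~ (p %| m)%N) \/
  (forall n, n \in iota j0 N -> be n != 0 -> ~~ (p %| n)%N).
Local Notation Zc := 'Z_c.
Local Notation vec := (Zc * Zc)%type.
Local Notation fn := (fun m : nat => m%:R : Zc).

Let I := iota i0 M.
Let J := iota j0 N.
Let c0 : (0 < c)%N. Proof. exact: ltnW. Qed.
Let D0 : (0 < D)%N. Proof. exact: dvdn_gt0 Dc. Qed.
Let M0 : (0 < M)%N. Proof. exact: leq_trans NM. Qed.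
Let H := maxn 1 (c %/ (8 * M)).
Let K := maxn 1 (c %/ (8 * N)).
Let H0 : (0 < H)%N. Proof. by rewrite leq_max. Qed.
Let K0 : (0 < K)%N. Proof. by rewrite leq_max. Qed.
Let HK : (H <= K)%N.
Proof. by rewrite geq_max leq_maxl leq_max leq_div2l ?orbT // ?muln_gt0 // leq_mul2l. Qed.
Let Hc : (H <= c)%N. Proof. by rewrite geq_max c0 leq_div. Qed.
Let Kc : (K <= c)%N. Proof. by rewrite geq_max c0 leq_div. Qed.
Let HKc : (H * K <= c ^ 2)%N. Proof. by rewrite -mulnn leq_mul. Qed.

Let al' m := al m / mean_phase R c H i0 m.
Let be' n := be n / mean_phase R c K j0 n.
Let A := Afun I al' fn.
Let B v := Afun J be' fn (vswap v).
Let cf (i : 'I_H * 'I_K) : R[i] :=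
  H%:R^-1 * psi R (- (i0%:R * (i.1 : nat)%:R) : Zc) * (K%:R^-1 * psi R (- (j0%:R * (i.2 : nat)%:R) : Zc)).

Let width (L : nat) : (8 * L * (maxn 1 (c %/ (8 * L))).-1 <= c)%N.
Proof.
case: (leqP (c %/ (8 * L)) 1) => h; first by rewrite muln0.
rewrite mulnC; apply: leq_trans (leq_divM c (8 * L)).
by rewrite leq_mul2r leq_pred orbT.
Qed.

Let thI m : m \in I -> 1 / 2 <= cabs (mean_phase R c H i0 m).
Proof. by apply: cabs_mean_phase => //; exact: width. Qed.
Let thJ n : n \in J -> 1 / 2 <= cabs (mean_phase R c K j0 n).
Proof. by apply: cabs_mean_phase => //; exact: width. Qed.

Let neq0_of_ge (x : R[i]) : 1 / 2 <= cabs x -> x != 0.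
Proof. by apply: contraTneq => ->; rewrite cabs0; lra. Qed.

Let l2_div (s : seq nat) (g th : nat -> R[i]) : (forall m, m \in s -> 1 / 2 <= cabs (th m)) ->
  \sum_(m <- s) cabs (g m / th m) ^+ 2 <= 4 * \sum_(m <- s) cabs (g m) ^+ 2.
Proof.
move=> hth; rewrite mulr_sumr big_seq [X in _ <= X]big_seq; apply: ler_sum => m /hth h.
rewrite cabsM cabsV exprMn mulrC ler_wpM2r ?exprn_ge0 ?cabs_ge0 // exprVn.
have h0 : 0 < cabs (th m) by apply: lt_le_trans h; lra.
rewrite -[4]invrK lef_pV2 ?posrE ?exprn_gt0 ?invr_gt0 //.
by have := ler_pM (_ : 0 <= 1 / 2) (_ : 0 <= 1 / 2) h h; rewrite -expr2; move=> /(_ _ _); lra.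
Qed.

Let cfE i : cabs (cf i) = (H * K)%:R^-1.
Proof.
have hn n : cabs (n%:R : R[i]) = n%:R by rewrite -(rmorph_nat (real_complex R)) cabs_real ger0_norm ?ler0n.
by rewrite /cf !cabsM !cabsV !cabs_psi !hn !mulr1 natrM invfM.
Qed.

Let B2 v := conjc (B v).
Let B2E v : B2 v = Afun J (fun n => conjc (be' n)) fn (vrot v).
Proof.
rewrite /B2 /B /Afun /vswap /vrot /=; case: ifP => u1; last by rewrite conjc0.
rewrite conjc_sum; apply: eq_bigr => n _.
by rewrite conjcM -psiN //; congr (_ * psi R _); rewrite mulNr mulrN.
Qed.

Let aI : R := \sum_(m <- I) cabs (al m) ^+ 2.
Let bJ : R := \sum_(n <- J) cabs (be n) ^+ 2.

Let energyA b : (b %| D)%N -> (forall m, m \in I -> al m != 0 -> coprime b m) ->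
  \sum_(a : Zc | (b %| a)%N) energy D A a <= b%:R^-1 * ((c ^ 4 * totient c)%:R * (4 * aI)).
Proof.
move=> bD hb; apply: le_trans (@Fhat_energy R c D b c_gt1 Dc bD I al' fn (iota_uniq _ _) (natr_inj_iota c_gt1 Mc) _) _.
  move=> m mI; rewrite mulf_eq0 negb_or => /andP[am _] /=.
  rewrite val_Zp_nat // -(@coprime_modr b) modn_dvdm ?(dvdn_trans bD Dc) // coprime_modr.
  exact: hb.
rewrite ler_wpM2l ?invr_ge0 // ler_wpM2l //; exact: l2_div.
Qed.

Let energyB b : (b %| D)%N -> (forall n, n \in J -> be n != 0 -> coprime b n) ->
  \sum_(a : Zc | (b %| a)%N) energy D B2 a <= b%:R^-1 * ((c ^ 4 * totient c)%:R * (4 * bJ)).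
Proof.
move=> bD hb.
rewrite (eq_bigr (fun a => energy D (Afun J (fun n => conjc (be' n)) fn) a)); last first.
  move=> a _; rewrite -[RHS]energy_rot; apply: eq_bigr => z _; congr (cabs _ ^+ 2).
  by apply: eq_bigr => j _; rewrite B2E.
have Nc : (N <= c)%N by exact: leq_trans Mc.
apply: le_trans (@Fhat_energy R c D b c_gt1 Dc bD J (fun n => conjc (be' n)) fn (iota_uniq _ _) (natr_inj_iota c_gt1 Nc) _) _.
  move=> n nJ bn.
  rewrite [fn n]/= val_Zp_nat // -(@coprime_modr b) modn_dvdm ?(dvdn_trans bD Dc) // coprime_modr.
  apply: hb => //; apply: contraNneq bn => b0; rewrite /be' b0 mul0r conjc0 //.
rewrite ler_wpM2l ?invr_ge0 // ler_wpM2l //.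
by under eq_bigr do rewrite cabsJ; exact: l2_div.
Qed.

Let y : R := (7200 * T ^+ 7 * gain R c D H K) `^ 6^-1.
Let TA := smooth cf A.

Let T1 : 1 <= T.
Proof. by apply: le_trans (hT (_ : (0 < 1 <= c ^ 2)%N)); rewrite // expn_gt0 c0. Qed.

Let y0 : 0 <= y. Proof. exact: powR_ge0. Qed.
Let y6 : y ^+ 6 = 7200 * T ^+ 7 * gain R c D H K.
Proof.
have T0 := le_trans ler01 T1.
have Z0 : 0 <= 7200 * T ^+ 7 * gain R c D H K.
  by apply: mulr_ge0; [rewrite mulr_ge0 ?exprn_ge0|exact: gain_ge0].
by rewrite /y -powR_mulrn ?powR_ge0 // -powRrM mulVf ?powRr1 // pnatr_eq0.
Qed.

Let energyTA a : energy D TA a <= energy D A a * ((gcdn a D)%:R * y ^+ 2).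
Proof.
have := @Fhat_amplified R c D H K T c_gt1 Dc hT H0 HK HKc a A cf (fun t v ut => Afun_scale I al' fn v ut) cfE.
rewrite -/(energy D TA a) -/(energy D A a).
have -> : energy D A a ^+ 3 * (7200 * T ^+ 7 * (gcdn a D)%:R ^+ 3 * gain R c D H K) =
   (energy D A a * ((gcdn a D)%:R * y ^+ 2)) ^+ 3.
  transitivity (energy D A a ^+ 3 * ((gcdn a D)%:R ^+ 3 * y ^+ 6)); last by ring.
  by rewrite y6; ring.
by rewrite ler_pXn2r // nnegrE ?mulr_ge0 ?energy_ge0 ?exprn_ge0.
Qed.

Let block b : (b %| D)%N ->
  \sum_(a : Zc | gcdn a D == b) Num.sqrt (energy D TA a) * Num.sqrt (energy D B2 a) <=
  y * ((c ^ 4 * totient c)%:R * 4 * (Num.sqrt aI * Num.sqrt bJ)).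
Proof.
move=> bD; have b0 : (0 < b)%N by exact: dvdn_gt0 bD.
pose pi : nat_pred := [pred p | all (fun m => (al m != 0) ==> ~~ (p %| m)%N) I].
pose b1 := (b`_pi)%N; pose b2 := (b`_pi^')%N.
have b12 : (b1 * b2 = b)%N by rewrite partnC.
have cop1 m : m \in I -> al m != 0 -> coprime b1 m.
  move=> mI am; apply: coprime_pnat (part_pnat _ _) _ => p pp pb.
  by rewrite inE => /allP/(_ _ mI); rewrite am.
have cop2 n : n \in J -> be n != 0 -> coprime b2 n.
  move=> nJ bn; apply: coprime_pnat (part_pnat _ _) _ => p pp pb.
  have pD : (p %| D)%N by apply: dvdn_trans bD; apply: dvdn_trans pb _; rewrite dvdn_part.
  case: (cop pp pD) => h; last by move=> _; exact: h.
  rewrite inE => /negP[]; rewrite inE; apply/allP => m mI; apply/implyP; exact: h.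
have b1b : (b1 %| b)%N by rewrite dvdn_part.
have b2b : (b2 %| b)%N by rewrite dvdn_part.
have EA : \sum_(a : Zc | gcdn a D == b) energy D A a <= b1%:R^-1 * ((c ^ 4 * totient c)%:R * (4 * aI)).
  apply: le_trans (energyA (dvdn_trans b1b bD) cop1).
  rewrite big_mkcond [X in _ <= X]big_mkcond; apply: ler_sum => a _; case: eqP => [e|_].
    by rewrite (dvdn_trans b1b) // -e dvdn_gcdl.
  by case: ifP => _ //; exact: energy_ge0.
have EB : \sum_(a : Zc | gcdn a D == b) energy D B2 a <= b2%:R^-1 * ((c ^ 4 * totient c)%:R * (4 * bJ)).
  apply: le_trans (energyB (dvdn_trans b2b bD) cop2).
  rewrite big_mkcond [X in _ <= X]big_mkcond; apply: ler_sum => a _; case: eqP => [e|_].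
    by rewrite (dvdn_trans b2b) // -e dvdn_gcdl.
  by case: ifP => _ //; exact: energy_ge0.
have sb0 : 0 < Num.sqrt (b%:R : R) by rewrite sqrtr_gt0 ltr0n.
apply: (@le_trans _ _ (Num.sqrt b%:R * y * \sum_(a : Zc | gcdn a D == b) Num.sqrt (energy D A a) * Num.sqrt (energy D B2 a))).
  rewrite mulr_sumr; apply: ler_sum => a /eqP ab; rewrite mulrA ler_wpM2r ?sqrtr_ge0 //.
  apply: le_trans (ler_wsqrtr (energyTA a)) _.
  by rewrite ab sqrtrM ?energy_ge0 // sqrtrM // sqrtr_sqr ger0_norm // mulrC.
have hS : \sum_(a : Zc | gcdn a D == b) Num.sqrt (energy D A a) * Num.sqrt (energy D B2 a) <=
  Num.sqrt (b1%:R^-1 * ((c ^ 4 * totient c)%:R * (4 * aI))) * Num.sqrt (b2%:R^-1 * ((c ^ 4 * totient c)%:R * (4 * bJ))).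
  apply: le_trans (cauchy_schwarz_sqrt _ _ _ _) _.
  apply: ler_pM; rewrite ?sqrtr_ge0 // ler_wsqrtr //.
    by apply: le_trans EA; apply: ler_sum => a _; rewrite sqr_sqrtr ?energy_ge0.
  by apply: le_trans EB; apply: ler_sum => a _; rewrite sqr_sqrtr ?energy_ge0.
apply: le_trans (ler_wpM2l _ hS) _; first by rewrite mulr_ge0 // ltW.
have aI0 : 0 <= aI by apply: sumr_ge0 => m _; rewrite exprn_ge0 ?cabs_ge0.
have bJ0 : 0 <= bJ by apply: sumr_ge0 => m _; rewrite exprn_ge0 ?cabs_ge0.
rewrite -sqrtrM ?mulr_ge0 ?invr_ge0 //.
set P := (c ^ 4 * totient c)%:R.
have -> : b1%:R^-1 * (P * (4 * aI)) * (b2%:R^-1 * (P * (4 * bJ))) = b%:R^-1 * ((P * 4) ^+ 2 * (aI * bJ)) :> R.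
  by rewrite -[in b%:R^-1]b12 natrM invfM; ring.
rewrite sqrtrM ?invr_ge0 // sqrtrV // sqrtrM ?exprn_ge0 ?mulr_ge0 // sqrtr_sqr ger0_norm ?mulr_ge0 // sqrtrM //.
by rewrite le_eqVlt; apply/orP; left; apply/eqP; field; rewrite lt0r_neq0.
Qed.

Lemma bilinear_bound_gain :
  cabs (\sum_(m <- I) \sum_(n <- J) al m * be n * kloosterman R m n c) <=
  4 * T * c%:R * y * (l2norm I al * l2norm J be).
Proof.
set S := \sum_(m <- I) _.
have hS : (c ^ 3 * totient c)%:R * S = \sum_(a : Zc) \sum_(z | inY D z) Fhat D a TA z * conjc (Fhat D a B2 z).
  rewrite (Fhat_plancherel c_gt1 Dc).
    rewrite natrM -mulrA -(bilinear_kloosterman c_gt1); congr (_ * _).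
    rewrite -(@smooth_bilinear R c c_gt1 H K i0 j0 M N al be).
    - by apply: eq_bigr => v _; rewrite /B2 conjcK.
    - by move=> m mI; apply: neq0_of_ge; exact: thI.
    - by move=> n nJ; apply: neq0_of_ge; exact: thJ.
  move=> v npv; rewrite /TA /smooth big1 // => i _; rewrite /A /Afun; case: ifP => [u2|_]; last by rewrite mulr0.
  by case/negP: npv; have := primv_unit2 u2; rewrite primv_u primv_l.
have pos : (0 : R) < (c ^ 3 * totient c)%:R by rewrite ltr0n muln_gt0 expn_gt0 c0 totient_gt0.
rewrite -(ler_pM2l pos).
have -> : (c ^ 3 * totient c)%:R * cabs S = cabs ((c ^ 3 * totient c)%:R * S).
  by rewrite cabsM -(rmorph_nat (real_complex R)) cabs_real ger0_norm ?ler0n.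
rewrite hS.
apply: (@le_trans _ _ (\sum_(a : Zc) Num.sqrt (energy D TA a) * Num.sqrt (energy D B2 a))).
  apply: le_trans (cabs_sum _ _ _) _; apply: ler_sum => a _.
  apply: le_trans (cabs_sum _ _ _) _.
  under eq_bigr do rewrite cabsM cabsJ.
  exact: cauchy_schwarz_sqrt.
apply: (@le_trans _ _ (\sum_(b <- divisors D) y * ((c ^ 4 * totient c)%:R * 4 * (Num.sqrt aI * Num.sqrt bJ)))).
  apply: (@le_trans _ _ (\sum_(b <- divisors D) \sum_(a : Zc | gcdn a D == b) Num.sqrt (energy D TA a) * Num.sqrt (energy D B2 a))).
    under [X in _ <= X]eq_bigr do rewrite big_mkcond.
    rewrite exchange_big /=; apply: ler_sum => a _.
    rewrite (bigD1_seq (gcdn a D)) ?divisors_uniq -?dvdn_divisors ?dvdn_gcdr //= eqxx lerDl.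
    by apply: sumr_ge0 => b _; case: ifP => _ //; rewrite mulr_ge0 ?sqrtr_ge0.
  rewrite big_seq [X in _ <= X]big_seq; apply: ler_sum => b; rewrite -dvdn_divisors //; exact: block.
rewrite big_const_seq count_predT iter_addr_0 -[X in X <= _]mulr_natl.
have hD : (size (divisors D))%:R <= T.
  by apply: hT; rewrite D0 (leq_trans (dvdn_leq c0 Dc)) // -mulnn leq_pmulr.
apply: (@le_trans _ _ (T * (y * ((c ^ 4 * totient c)%:R * 4 * (Num.sqrt aI * Num.sqrt bJ))))).
  by rewrite ler_wpM2r // !mulr_ge0 ?sqrtr_ge0.
by rewrite /l2norm -/aI -/bJ !(natrX, natrM) le_eqVlt; apply/orP; left; apply/eqP; ring.
Qed.

Lemma bilinear_bound :
  cabs (\sum_(m <- I) \sum_(n <- J) al m * be n * kloosterman R m n c) <=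
  360 * T ^+ 3 * c%:R * (l2norm I al * l2norm J be) *
  (D%:R * M%:R ^+ 3 * N%:R / c%:R ^+ 3 + D%:R * (sqd (c %/ D))%:R * M%:R ^+ 2 / c%:R ^+ 2
    + (sqd (c %/ D))%:R / D%:R) `^ 6^-1.
Proof.
set h := (sqd (c %/ D))%:R; set X := _ + _ + _.
have T0 := le_trans ler01 T1.
have cR : (0 : R) < c%:R by rewrite ltr0n.
have DR : (0 : R) < D%:R by rewrite ltr0n.
have width_ge L : (0 < L)%N -> (maxn 1 (c %/ (8 * L)))%:R^-1 <= 16 * L%:R / c%:R :> R.
  move=> L0; set W := maxn 1 _; have W0 : (0 < W)%N by rewrite leq_max.
  rewrite -[X in X <= _]mul1r ler_pdivrMr ?ltr0n // mulrAC ler_pdivlMr // mul1r -!natrM ler_nat.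
  have := ltn_ceil c (_ : 0 < 8 * L)%N; rewrite muln_gt0 L0 => /(_ isT).
  have : (c %/ (8 * L) <= W)%N by rewrite leq_max leqnn orbT.
  move=> kW cl; apply: leq_trans (ltnW cl) _.
  rewrite (_ : 16 * L * W = W.*2 * (8 * L))%N; last by rewrite -muln2; ring.
  by rewrite leq_mul2r -addnn (leq_add W0 kW) orbT.
have HR : (0 : R) < H%:R by rewrite ltr0n.
have KR : (0 : R) < K%:R by rewrite ltr0n.
have hH := width_ge M M0; have hK := width_ge N N0.
have X0 : 0 <= X by rewrite !addr_ge0 // ?mulr_ge0 ?invr_ge0 ?exprn_ge0.
have gX : gain R c D H K <= 16 ^+ 4 * X.
  have -> : gain R c D H K = D%:R * c%:R * (H%:R^-1 ^+ 3 * K%:R^-1) + D%:R * h * H%:R^-1 ^+ 2 + h / D%:R.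
    by rewrite /gain -/h; field; rewrite !lt0r_neq0.
  have -> : 16 ^+ 4 * X = D%:R * c%:R * ((16 * M%:R / c%:R) ^+ 3 * (16 * N%:R / c%:R)) +
     (16 ^+ 2 * (D%:R * h * (16 * M%:R / c%:R) ^+ 2) + 16 ^+ 4 * (h / D%:R)).
    by rewrite /X; field; rewrite !lt0r_neq0.
  have p3 : H%:R^-1 ^+ 3 <= (16 * M%:R / c%:R) ^+ 3 :> R.
    by rewrite lerXn2r ?nnegrE ?invr_ge0 // ?mulr_ge0 ?invr_ge0.
  have p2 : H%:R^-1 ^+ 2 <= (16 * M%:R / c%:R) ^+ 2 :> R.
    by rewrite lerXn2r ?nnegrE ?invr_ge0 // ?mulr_ge0 ?invr_ge0.
  rewrite -addrA; apply: lerD.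
    by apply: ler_wpM2l; rewrite ?mulr_ge0 //; apply: ler_pM; rewrite ?exprn_ge0 ?invr_ge0.
  have q2 : D%:R * h * H%:R^-1 ^+ 2 <= D%:R * h * (16 * M%:R / c%:R) ^+ 2.
    by apply: ler_wpM2l; rewrite ?mulr_ge0.
  have q0 : 0 <= D%:R * h * H%:R^-1 ^+ 2 by rewrite !mulr_ge0 ?exprn_ge0 ?invr_ge0.
  have q1 : 0 <= h / D%:R by rewrite divr_ge0.
  apply: lerD; last by apply: ler_peMl; rewrite // exprn_ege1 // ler1n.
  apply: le_trans q2 _; apply: ler_peMl; last by rewrite exprn_ege1 // ler1n.
  by rewrite !mulr_ge0 ?exprn_ge0 ?mulr_ge0 ?invr_ge0.
have hy : y <= 90 * T ^+ 2 * X `^ 6^-1.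
  have -> : 90 * T ^+ 2 * X `^ 6^-1 = ((90 * T ^+ 2) ^+ 6 * X) `^ 6^-1.
    have : 0 <= 90 * T ^+ 2 by rewrite mulr_ge0 ?exprn_ge0.
    move: (90 * T ^+ 2) => v v0; rewrite powRM ?exprn_ge0 //; congr (_ * _).
    by rewrite -powR_mulrn // -powRrM mulfV ?pnatr_eq0 // powRr1.
  apply: ge0_ler_powR; rewrite ?invr_ge0 ?nnegrE //.
  - by apply: mulr_ge0; [rewrite mulr_ge0 ?exprn_ge0|exact: gain_ge0].
  - by rewrite mulr_ge0 ?exprn_ge0 // mulr_ge0 ?exprn_ge0.
  apply: le_trans (ler_wpM2l _ gX) _; first by rewrite mulr_ge0 ?exprn_ge0.
  rewrite mulrA ler_wpM2r //.
  have T712 : T ^+ 7 <= T ^+ 12 by apply: ler_weXn2l.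
  have -> : 7200 * T ^+ 7 * 16 ^+ 4 = 7200 * 16 ^+ 4 * T ^+ 7 by rewrite mulrAC.
  rewrite exprMn -exprM; apply: ler_pM; rewrite ?mulr_ge0 ?exprn_ge0 //.
  rewrite (exprD 90 2 4); apply: ler_pM; rewrite ?exprn_ge0 //.
    by rewrite -natrX ler_nat.
  by rewrite lerXn2r ?nnegrE // ler_nat.
apply: le_trans bilinear_bound_gain _.
have -> : 360 * T ^+ 3 * c%:R * (l2norm I al * l2norm J be) * X `^ 6^-1 =
  4 * T * c%:R * (90 * T ^+ 2 * X `^ 6^-1) * (l2norm I al * l2norm J be) by ring.
by rewrite ler_wpM2r ?mulr_ge0 ?sqrtr_ge0 // ler_wpM2l ?mulr_ge0.
Qed.
End Pointwise.

(** * Averaging over the moduli *)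

(* [h] comes from [n] alone, while [g * x] is rarely large when [k] varies. *)
Lemma sqd_mul_split n k : (0 < n)%N -> (0 < k)%N ->
  exists h g x : nat, [/\ (h ^ 2 %| n)%N, (g %| n)%N, (g * x ^ 2 %| k)%N & sqd (n * k) = (h * (g * x))%N].
Proof.
move=> n0 k0; set s := sqd (n * k).
have nk0 : (0 < n * k)%N by rewrite muln_gt0 n0.
have s0 : (0 < s)%N by exact: sqd_gt0.
have snk : (s ^ 2 %| n * k)%N by exact: sqd_dvd.
pose g0 := gcdn n (s ^ 2); have g00 : (0 < g0)%N by rewrite gcdn_gt0 n0.
have g0n : (g0 %| n)%N by exact: dvdn_gcdl.
have g0s : (g0 %| s ^ 2)%N by exact: dvdn_gcdr.
pose h := sqd g0; have h0 : (0 < h)%N by exact: sqd_gt0.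
have hg0 : (h ^ 2 %| g0)%N by exact: sqd_dvd.
have hs : (h %| s)%N by rewrite -(@dvdn_pexp2r _ _ 2) //; exact: dvdn_trans g0s.
have h20 : (0 < h ^ 2)%N by rewrite expn_gt0 h0.
pose g := (g0 %/ h ^ 2)%N; have g0E : (g0 = g * h ^ 2)%N by rewrite divnK.
have gpos : (0 < g)%N by move: g00; rewrite g0E muln_gt0 => /andP[].
pose w := (s %/ h)%N; have sE : (s = w * h)%N by rewrite divnK.
have w0 : (0 < w)%N by move: s0; rewrite sE muln_gt0 => /andP[].
have gw2 : (g %| w ^ 2)%N by move: g0s; rewrite g0E sE expnMn dvdn_pmul2r.
have gw : (g %| w)%N.
  pose u := gcdn g w; have u0 : (0 < u)%N by rewrite gcdn_gt0 gpos.
  have ug : (u %| g)%N by exact: dvdn_gcdl.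
  have uw : (u %| w)%N by exact: dvdn_gcdr.
  have cop : coprime (g %/ u) (w %/ u).
    by rewrite /coprime -(eqn_pmul2r u0) muln_gcdl !divnK // mul1n.
  have vu : (g %/ u %| u)%N.
    rewrite -(@Gauss_dvdl _ u ((w %/ u) ^ 2)) ?coprimeXr //.
    rewrite -(dvdn_pmul2r u0) divnK // mulnAC.
    have -> : (u * u * (w %/ u) ^ 2 = (w %/ u * u) ^ 2)%N by rewrite expnMn mulnC.
    by rewrite divnK.
  have : ((h * (g %/ u)) ^ 2 %| g0)%N.
    rewrite expnMn g0E mulnC dvdn_pmul2r // -mulnn -{3}(divnK ug) dvdn_mul //.
  move=> /(leq_sqd g00); rewrite -/h -{2}[h]muln1 leq_pmul2l // => le1.
  rewrite -(divnK ug) (_ : g %/ u = 1)%N ?mul1n //; apply/eqP; rewrite eqn_leq le1 /=.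
  by rewrite divn_gt0 // dvdn_leq.
exists h, g, (w %/ g)%N; split.
- exact: dvdn_trans g0n.
- by apply: dvdn_trans g0n; rewrite g0E dvdn_mulr.
- have : (s ^ 2 %/ g0 %| k)%N.
    rewrite -(@Gauss_dvdr _ (n %/ g0)) .
      by rewrite -(dvdn_pmul2r g00) mulnAC !divnK.
    by rewrite coprime_sym /coprime -(eqn_pmul2r g00) muln_gcdl !divnK // mul1n.
  rewrite g0E sE expnMn divnMr //.
  by rewrite -{1}(divnK gw) expnMn -(mulnn g) mulnA mulnK // mulnC.
- by rewrite -/s sE mulnC [(g * _)%N]mulnC divnK.
Qed.

Section Classes.
Variables (R : realType) (c q : nat).
Hypotheses (c0 : (0 < c)%N) (qc : (q %| c)%N).
Variables (I J : seq nat) (a b : nat -> R[i]) (S : nat -> nat -> R[i]).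

Definition gclass (g : nat -> R[i]) (r m : nat) : R[i] := if gcdn m c == r then g m else 0.

Definition l2w (w : nat -> R) (s : seq nat) (g : nat -> R[i]) : R :=
  Num.sqrt (\sum_(m <- s) cabs (g m) ^+ 2 * w m).

Lemma l2w_ge0 w s g : 0 <= l2w w s g. Proof. exact: sqrtr_ge0. Qed.

Lemma l2w1 s g : l2w (fun=> 1) s g = l2norm s g.
Proof. by rewrite /l2w /l2norm; under eq_bigr do rewrite mulr1. Qed.

Let gcd_in m : gcdn m c \in divisors c. Proof. by rewrite -dvdn_divisors // dvdn_gcdr. Qed.

Lemma sum_gclass (V : nmodType) (F : nat -> V) m :
  \sum_(r <- divisors c) (if gcdn m c == r then F r else 0) = F (gcdn m c).
Proof.
rewrite (bigD1_seq (gcdn m c)) ?gcd_in ?divisors_uniq //= eqxx big1 ?addr0 // => r.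
by rewrite eq_sym => /negbTE ->.
Qed.

Lemma cabs_sum_classes :
  cabs (\sum_(m <- I) \sum_(n <- J | gcdn (gcdn m n) q == 1%N) a m * b n * S m n) <=
  \sum_(r <- divisors c) \sum_(t <- divisors c | gcdn (gcdn r t) q == 1%N)
    cabs (\sum_(m <- I) \sum_(n <- J) gclass a r m * gclass b t n * S m n).
Proof.
have -> : \sum_(m <- I) \sum_(n <- J | gcdn (gcdn m n) q == 1%N) a m * b n * S m n =
  \sum_(r <- divisors c) \sum_(t <- divisors c | gcdn (gcdn r t) q == 1%N)
     \sum_(m <- I) \sum_(n <- J) gclass a r m * gclass b t n * S m n.
  transitivity (\sum_(m <- I) \sum_(n <- J) \sum_(r <- divisors c) \sum_(t <- divisors c | gcdn (gcdn r t) q == 1%N)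
      gclass a r m * gclass b t n * S m n); last first.
    transitivity (\sum_(m <- I) \sum_(r <- divisors c) \sum_(t <- divisors c | gcdn (gcdn r t) q == 1%N)
        \sum_(n <- J) gclass a r m * gclass b t n * S m n).
      by apply: eq_bigr => m _; rewrite exchange_big; apply: eq_bigr => r _; rewrite exchange_big.
    by rewrite exchange_big; apply: eq_bigr => r _; rewrite exchange_big.
  apply: eq_bigr => m _; rewrite big_mkcond; apply: eq_bigr => n _.
  transitivity (\sum_(r <- divisors c) if gcdn m c == r then
     \sum_(t <- divisors c) (if gcdn n c == t then (if gcdn (gcdn r t) q == 1%N then a m * b n * S m n else 0) else 0) else 0).
    rewrite sum_gclass sum_gclass.
    suff -> : gcdn (gcdn (gcdn m c) (gcdn n c)) q = gcdn (gcdn m n) q by [].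
    have /gcdn_idPr cq := qc.
    by rewrite gcdnACA gcdnn -gcdnA cq.
  apply: eq_bigr => r _; rewrite [RHS]big_mkcond /gclass; case: ifP => _; last first.
    by rewrite big1 // => t _; rewrite !mul0r if_same.
  by apply: eq_bigr => t _; case: ifP => _ //; rewrite mulr0 mul0r if_same.
apply: le_trans (cabs_sum _ _ _) _; apply: ler_sum => r _; exact: cabs_sum.
Qed.

Lemma sum_l2w_gclass w s g : (forall m, 0 <= w m) ->
  \sum_(r <- divisors c) l2w w s (gclass g r) <= Num.sqrt (tau c)%:R * l2w w s g.
Proof.
move=> w0.
have := cauchy_schwarz_sqrt (divisors c) xpredT (fun=> 1) (fun r => l2w w s (gclass g r)).
under eq_bigr do rewrite mul1r; move=> h; apply: le_trans h _.
rewrite (_ : \sum_(i <- divisors c) 1 ^+ 2 = (tau c)%:R); last first.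
  by under eq_bigr do rewrite expr1n; rewrite big_const_seq count_predT iter_addr_0.
rewrite (_ : \sum_(i <- _) _ = \sum_(m <- s) cabs (g m) ^+ 2 * w m) //.
have nn g' : 0 <= \sum_(m <- s) cabs (g' m) ^+ 2 * w m.
  by apply: sumr_ge0 => m _; rewrite mulr_ge0 ?exprn_ge0 ?cabs_ge0.
under eq_bigr do rewrite sqr_sqrtr ?nn //.
rewrite exchange_big /=; apply: eq_bigr => m _.
rewrite -[RHS](sum_gclass (fun=> cabs (g m) ^+ 2 * w m) m); apply: eq_bigr => r _.
by rewrite /gclass; case: ifP => _ //; rewrite cabs0 expr0n mul0r.
Qed.

Lemma classes_bound (Z : R) (w w' : nat -> R) : 0 <= Z -> (forall m, 0 <= w m) -> (forall n, 0 <= w' n) ->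
  (forall r t, (r %| c)%N -> (t %| c)%N -> gcdn (gcdn r t) q = 1%N ->
    cabs (\sum_(m <- I) \sum_(n <- J) gclass a r m * gclass b t n * S m n) <=
     Z * (l2w w I (gclass a r) * l2w w' J (gclass b t))) ->
  cabs (\sum_(m <- I) \sum_(n <- J | gcdn (gcdn m n) q == 1%N) a m * b n * S m n) <=
  Z * (tau c)%:R * (l2w w I a * l2w w' J b).
Proof.
move=> Z0 w0 w'0 hZ; apply: le_trans cabs_sum_classes _.
apply: (@le_trans _ _ (\sum_(r <- divisors c) \sum_(t <- divisors c) Z * (l2w w I (gclass a r) * l2w w' J (gclass b t)))).
  rewrite big_seq [X in _ <= X]big_seq; apply: ler_sum => r; rewrite -dvdn_divisors // => rc.
  rewrite big_mkcond big_seq [X in _ <= X]big_seq; apply: ler_sum => t; rewrite -dvdn_divisors // => tc.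
  case: eqP => [e|_]; first exact: hZ.
  by rewrite !mulr_ge0 ?l2w_ge0.
under eq_bigr do rewrite -mulr_sumr -mulr_sumr.
rewrite -mulr_sumr -mulr_suml -mulrA ler_wpM2l //.
have -> : (tau c)%:R = Num.sqrt (tau c)%:R * Num.sqrt (tau c)%:R :> R by rewrite -expr2 sqr_sqrtr.
rewrite mulrACA; apply: ler_pM; rewrite ?sum_l2w_gclass //.
  by rewrite sumr_ge0 // => r _; rewrite l2w_ge0.
by rewrite sumr_ge0 // => r _; rewrite l2w_ge0.
Qed.
End Classes.

Section Averages.
Variable R : realType.

(* A majorant of the factor [Num.sqrt (g * x)] of [sqd_mul_split] that is easy to average. *)
Definition sqw (n k : nat) : R :=
  \sum_(g <- divisors n) \sum_(1 <= x < k.+1 | (g * x ^ 2 %| k)%N) Num.sqrt (g * x)%:R.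

Lemma sqd_mul_sqw n k : (0 < n)%N -> (0 < k)%N ->
  exists h w : nat, [/\ (h ^ 2 %| n)%N, sqd (n * k) = (h * w)%N, (0 < w <= k)%N & Num.sqrt w%:R <= sqw n k].
Proof.
move=> n0 k0; have [h [g [x [hn gn gxk e]]]] := sqd_mul_split n0 k0.
have gx0 : (0 < g * x ^ 2)%N by exact: dvdn_gt0 gxk.
have g0 : (0 < g)%N by move: gx0; rewrite muln_gt0 => /andP[].
have x0 : (0 < x)%N by move: gx0; rewrite muln_gt0 expn_gt0 orbF => /andP[].
have lek : (g * x <= k)%N.
  by apply: leq_trans (dvdn_leq k0 gxk); rewrite leq_mul2l -mulnn leq_pmulr ?orbT.
exists h, (g * x)%N; split; rewrite ?muln_gt0 ?g0 ?x0 //.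
have nn (g' : nat) : 0 <= \sum_(1 <= x < k.+1 | (g' * x ^ 2 %| k)%N) Num.sqrt (g' * x)%:R :> R.
  by apply: sumr_ge0 => i _; exact: sqrtr_ge0.
rewrite /sqw (bigD1_seq g) ?divisors_uniq -?dvdn_divisors //=.
apply: ler_wpDr; first by apply: sumr_ge0 => i _; exact: nn.
have xk : x \in index_iota 1 k.+1.
  by rewrite mem_index_iota x0 ltnS (leq_trans _ lek) // leq_pmull.
rewrite big_mkcond (bigD1_seq x) ?iota_uniq //= gxk.
by apply: ler_wpDr => //; apply: sumr_ge0 => i _; case: ifP => _ //; exact: sqrtr_ge0.
Qed.

Lemma sum_sqw n X : (0 < n)%N -> \sum_(1 <= k < X.+1) sqw n k <= 3 * (tau n)%:R * X%:R.
Proof.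
move=> n0.
apply: (@le_trans _ _ (\sum_(g <- divisors n) \sum_(1 <= x < X.+1) \sum_(1 <= k < X.+1 | (g * x ^ 2 %| k)%N) Num.sqrt (g * x)%:R)).
  rewrite /sqw exchange_big /=; apply: ler_sum => g _.
  apply: (@le_trans _ _ (\sum_(1 <= k < X.+1) \sum_(1 <= x < X.+1 | (g * x ^ 2 %| k)%N) Num.sqrt (g * x)%:R)).
    rewrite big_nat_cond [X in _ <= X]big_nat_cond; apply: ler_sum => k; rewrite andbT => /andP[k0 kX].
    rewrite [X in _ <= X](@big_cat_nat _ _ _ k.+1) //= ?ltnS ?(ltnW kX) //.
    by rewrite lerDl; apply: sumr_ge0 => x _; exact: sqrtr_ge0.
  by rewrite (exchange_big_dep xpredT).
apply: (@le_trans _ _ (\sum_(g <- divisors n) 3 * X%:R)); last first.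
  rewrite big_const_seq count_predT iter_addr_0 -[X in X <= _]mulr_natl.
  by rewrite le_eqVlt; apply/orP; left; apply/eqP; rewrite /tau; ring.
rewrite big_seq [X in _ <= X]big_seq; apply: ler_sum => g; rewrite -dvdn_divisors // => gn.
have g0 : (0 < g)%N by exact: dvdn_gt0 gn.
apply: (@le_trans _ _ (\sum_(1 <= x < X.+1) X%:R * (x%:R * Num.sqrt x%:R)^-1)).
  rewrite big_nat_cond [X in _ <= X]big_nat_cond; apply: ler_sum => x; rewrite andbT => /andP[x0 _].
  have gx0 : (0 < g * x ^ 2)%N by rewrite muln_gt0 g0 expn_gt0 x0.
  apply: le_trans (sum_dvdn_le _ gx0 (sqrtr_ge0 _)) _; rewrite -mulrA ler_wpM2l //.
  have sx : 0 < Num.sqrt x%:R :> R by rewrite sqrtr_gt0 ltr0n.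
  have sg : 0 < Num.sqrt g%:R :> R by rewrite sqrtr_gt0 ltr0n.
  have sg1 : 1 <= Num.sqrt g%:R :> R by rewrite -[X in X <= _]sqrtr1 ler_wsqrtr // ler1n.
  have xE : x%:R = Num.sqrt x%:R ^+ 2 :> R by rewrite sqr_sqrtr.
  have gE : g%:R = Num.sqrt g%:R ^+ 2 :> R by rewrite sqr_sqrtr.
  rewrite natrM natrX natrM sqrtrM //.
  move: sx sg sg1 xE gE; move: (Num.sqrt x%:R) (Num.sqrt g%:R) => s t s0 t0 t1 -> ->.
  have -> : (t ^+ 2 * (s ^+ 2) ^+ 2)^-1 * (t * s) = t^-1 * (s ^+ 2 * s)^-1 by field; rewrite !lt0r_neq0.
  by apply: ler_piMl; rewrite ?invf_le1 // invr_ge0 mulr_ge0 ?exprn_ge0 ?ltW.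
rewrite -mulr_sumr [X in _ <= X]mulrC ler_wpM2l //; exact: sum_inv_sqrt3.
Qed.
End Averages.

Section PerModulus.
Variables (R : realType) (q d n0 f k c : nat) (T C : R).
Hypotheses (d0 : (0 < d)%N) (n00 : (0 < n0)%N) (k0 : (0 < k)%N).
Hypotheses (hq : q = (d * n0)%N) (hc : c = (q * k)%N).
Hypothesis hf : forall g, (g ^ 2 %| q * d)%N -> (g <= f)%N.
Hypotheses (C0 : 0 < C) (Cc : C <= c%:R) (c_gt1 : (1 < c)%N).
Hypothesis hT : forall n, (0 < n <= c ^ 2)%N -> (tau n)%:R <= T.
Variables (i0 j0 M N : nat) (a b : nat -> R[i]).
Hypotheses (i00 : (0 < i0)%N) (j00 : (0 < j0)%N).
Hypotheses (N0 : (0 < N)%N) (NM : (N <= M)%N) (Mc : (M <= c)%N).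

Let I := iota i0 M.
Let J := iota j0 N.
Let c0 : (0 < c)%N. Proof. exact: ltnW. Qed.
Let q0 : (0 < q)%N. Proof. by rewrite hq muln_gt0 d0. Qed.
Let qc : (q %| c)%N. Proof. by rewrite hc dvdn_mulr. Qed.
Let T1 : 1 <= T.
Proof. by apply: le_trans (hT (_ : (0 < 1 <= c ^ 2)%N)); rewrite // expn_gt0 c0. Qed.
Let T0 : 0 <= T. Proof. exact: le_trans ler01 T1. Qed.
Let tauc : (tau c)%:R <= T.
Proof. by apply: hT; rewrite c0 -mulnn leq_pmulr. Qed.
Let IP m : m \in I -> (0 < m)%N. Proof. by rewrite mem_iota; lia. Qed.
Let JP n : n \in J -> (0 < n)%N. Proof. by rewrite mem_iota; lia. Qed.

Let dR : (0 : R) < d%:R. Proof. by rewrite ltr0n. Qed.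
Let qR : (0 : R) < q%:R. Proof. by rewrite ltr0n. Qed.
Let cR : (0 : R) < c%:R. Proof. by rewrite ltr0n. Qed.

Let leqdf h : (h ^ 2 %| n0)%N -> (d * h <= f)%N.
Proof.
move=> hn; apply: hf; rewrite hq -mulnA [(n0 * d)%N]mulnC mulnA expnMn -mulnn.
exact: dvdn_mul.
Qed.

Let cop_classes D r t : (gcdn (gcdn r t) q = 1)%N -> (D %| c)%N ->
  (forall p, prime p -> (p %| D)%N -> ~~ (p %| gcdn r t)%N) ->
  forall p, prime p -> (p %| D)%N ->
  (forall m, m \in I -> gclass c a r m != 0 -> ~~ (p %| m)%N) \/
  (forall n, n \in J -> gclass c b t n != 0 -> ~~ (p %| n)%N).
Proof.
move=> _ Dc hD p pp pD; have pc := dvdn_trans pD Dc.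
have := hD p pp pD; rewrite dvdn_gcd negb_and => /orP[nr|nt]; [left|right] => m _;
  rewrite /gclass; case: (gcdn m c =P _) => [e _|_]; rewrite ?eqxx //.
  by apply: contra nr => pm; rewrite -e dvdn_gcd pm.
by apply: contra nt => pm; rewrite -e dvdn_gcd pm.
Qed.

Definition size1 : R :=
  d%:R * M%:R ^+ 3 * N%:R / C ^+ 3 + f%:R * M%:R ^+ 2 / C ^+ 2 + f%:R / d%:R ^+ 2.
Definition size2 : R :=
  d%:R * M%:R ^+ 3 * N%:R / (q%:R * C ^+ 2) + f%:R * M%:R ^+ 2 / (q%:R * C)
    + f%:R * q%:R / (d%:R ^+ 2 * C).

Let pos := (mulr_ge0, invr_ge0, exprn_ge0, addr_ge0, ler0n, ltW C0).

Lemma size1_ge0 : 0 <= size1.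
Proof. by rewrite /size1 !addr_ge0 // !pos. Qed.
Lemma size2_ge0 : 0 <= size2.
Proof. by rewrite /size2 !addr_ge0 // !pos. Qed.

Let cC : c%:R^-1 <= C^-1 :> R.
Proof. by rewrite lef_pV2 ?posrE. Qed.

Let root_pow (w : nat) (e : nat) (X Y : R) : (0 < w)%N -> (e <= 3)%N -> 0 <= X -> 0 <= Y -> X <= w%:R ^+ e * Y ->
  X `^ 6^-1 <= Num.sqrt w%:R * Y `^ 6^-1.
Proof.
move=> w0 e3 X0 Y0 h.
have w1 : 1 <= w%:R :> R by rewrite ler1n.
have -> : Num.sqrt w%:R * Y `^ 6^-1 = (w%:R ^+ 3 * Y) `^ 6^-1.
  rewrite powRM ?exprn_ge0 //; congr (_ * _).
  by rewrite -powR12_sqrt // -powR_mulrn // -powRrM; congr (_ `^ _); lra.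
apply: ge0_ler_powR; rewrite ?nnegrE ?invr_ge0 ?mulr_ge0 ?exprn_ge0 //.
by apply: le_trans h _; rewrite ler_wpM2r // ler_weXn2l.
Qed.

Lemma modulus_bound1 :
  cabs (\sum_(m <- I) \sum_(n <- J | gcdn (gcdn m n) q == 1%N) a m * b n * kloosterman R m n c) <=
  360 * T ^+ 4 * c%:R * (l2norm I a * l2norm J b) * (sqw R n0 k * size1 `^ 6^-1).
Proof.
have [h [w [hn sE /andP[w0 wk] hw]]] := sqd_mul_sqw R n00 k0.
have dc : (d %| c)%N by rewrite hc hq -mulnA dvdn_mulr.
have cd : (c %/ d = n0 * k)%N by rewrite hc hq -mulnA mulKn.
set Z := 360 * T ^+ 3 * c%:R * (sqw R n0 k * size1 `^ 6^-1).
have sq0 : 0 <= sqw R n0 k by apply: le_trans hw; exact: sqrtr_ge0.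
have Z0 : 0 <= Z by rewrite /Z !mulr_ge0 ?exprn_ge0 ?powR_ge0.
have := @classes_bound R c q c0 qc I J a b (fun m n => kloosterman R m n c) Z (fun=> 1) (fun=> 1) Z0 (fun=> ler01) (fun=> ler01).
rewrite !l2w1 => hcl; apply: le_trans (hcl _) _; last first.
  have -> : 360 * T ^+ 4 * c%:R * (l2norm I a * l2norm J b) * (sqw R n0 k * size1 `^ 6^-1) =
     Z * T * (l2norm I a * l2norm J b) by rewrite /Z; ring.
  by rewrite ler_wpM2r ?mulr_ge0 ?sqrtr_ge0 // ler_wpM2l.
move=> r t _ _ rt; rewrite !l2w1.
apply: le_trans (bilinear_bound c_gt1 dc hT N0 NM Mc (cop_classes rt dc _)) _.
  move=> p pp pd; apply/negP => prt.
  have : (p %| gcdn (gcdn r t) q)%N by rewrite dvdn_gcd prt hq dvdn_mulr.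
  by rewrite rt dvdn1 => /eqP p1; rewrite p1 in pp.
have -> : Z * (l2norm I (gclass c a r) * l2norm J (gclass c b t)) =
  360 * T ^+ 3 * c%:R * (l2norm I (gclass c a r) * l2norm J (gclass c b t)) * (sqw R n0 k * size1 `^ 6^-1).
  by rewrite /Z; ring.
apply: ler_wpM2l; first by rewrite !mulr_ge0 ?exprn_ge0 ?sqrtr_ge0.
apply: le_trans (_ : Num.sqrt w%:R * size1 `^ 6^-1 <= _); last by rewrite ler_wpM2r ?powR_ge0.
apply: (@root_pow w 1) => //; first by rewrite !addr_ge0 // !pos.
  exact: size1_ge0.
rewrite cd sE.
have w1 : 1 <= w%:R :> R by rewrite ler1n.
have fh : d%:R * h%:R <= f%:R :> R by rewrite -natrM ler_nat leqdf.
rewrite expr1 /size1 !mulrDr natrM; apply: lerD; first apply: lerD.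
- apply: (@le_trans _ _ (d%:R * M%:R ^+ 3 * N%:R / C ^+ 3)).
    by apply: ler_wpM2l; rewrite ?pos // -!exprVn lerXn2r ?nnegrE ?pos.
  by rewrite ler_peMl ?pos.
- have -> : d%:R * (h%:R * w%:R) * M%:R ^+ 2 / c%:R ^+ 2 = w%:R * (d%:R * h%:R * (M%:R ^+ 2 / c%:R ^+ 2)) :> R by ring.
  apply: ler_wpM2l => //; rewrite -[X in _ <= X]mulrA; apply: ler_pM; rewrite ?pos //.
  by apply: ler_wpM2l; rewrite ?pos // -!exprVn lerXn2r ?nnegrE ?pos.
- have -> : h%:R * w%:R / d%:R = w%:R * (d%:R * h%:R / d%:R ^+ 2) :> R by field; rewrite lt0r_neq0.
  by rewrite ler_wpM2l // ler_wpM2r ?pos.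
Qed.

Definition kpart (m : nat) : R := Num.sqrt (k`_[pred p | p \in primes m])%N%:R.

Lemma kpart_ge0 m : 0 <= kpart m. Proof. exact: sqrtr_ge0. Qed.

Let kpart_dvd m g : (0 < m)%N -> (g %| m)%N -> kpart g <= kpart m.
Proof.
move=> m0 gm; rewrite /kpart ler_wsqrtr // ler_nat dvdn_leq ?part_gt0 //.
apply: sub_in_partn => p _; rewrite !inE !mem_primes => /and3P[-> g0 pg].
by rewrite m0 (dvdn_trans pg).
Qed.

Let l2w_class (s : seq nat) (g : nat -> R[i]) (r u : nat) : (u %| r)%N -> (forall m, m \in s -> (0 < m)%N) ->
  Num.sqrt (kpart u) * l2norm s (gclass c g r) <= l2w kpart s (gclass c g r).
Proof.
move=> ur s0; rewrite /l2norm /l2w -sqrtrM ?kpart_ge0 // ler_wsqrtr // mulr_sumr.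
rewrite big_seq [X in _ <= X]big_seq; apply: ler_sum => m ms; rewrite mulrC /gclass.
case: eqP => [e|_]; last by rewrite cabs0 expr0n !mul0r.
rewrite ler_wpM2l ?exprn_ge0 ?cabs_ge0 //; apply: kpart_dvd; first exact: s0.
by apply: dvdn_trans ur _; rewrite -e dvdn_gcdl.
Qed.

Lemma modulus_bound2 :
  cabs (\sum_(m <- I) \sum_(n <- J | gcdn (gcdn m n) q == 1%N) a m * b n * kloosterman R m n c) <=
  360 * T ^+ 4 * c%:R * (l2w kpart I a * l2w kpart J b) * size2 `^ 6^-1.
Proof.
set Z := 360 * T ^+ 3 * c%:R * size2 `^ 6^-1.
have Z0 : 0 <= Z by rewrite /Z !mulr_ge0 ?exprn_ge0 ?powR_ge0.
have := @classes_bound R c q c0 qc I J a b (fun m n => kloosterman R m n c) Z kpart kpart Z0 kpart_ge0 kpart_ge0.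
move=> hcl; apply: le_trans (hcl _) _; last first.
  have -> : 360 * T ^+ 4 * c%:R * (l2w kpart I a * l2w kpart J b) * size2 `^ 6^-1 =
     Z * T * (l2w kpart I a * l2w kpart J b) by rewrite /Z; ring.
  by rewrite ler_wpM2r ?mulr_ge0 ?l2w_ge0 // ler_wpM2l.
move=> r t rc tc rt; set u := gcdn r t.
have u0 : (0 < u)%N by rewrite gcdn_gt0 (dvdn_gt0 c0 rc).
pose pi : nat_pred := [pred p | p \in primes u].
pose k2 := (k`_pi)%N; pose k1 := (k`_(pi^'))%N.
have k12 : (k2 * k1 = k)%N by rewrite partnC.
have k20 : (0 < k2)%N by exact: part_gt0.
have k10 : (0 < k1)%N by exact: part_gt0.
pose D := (d * k1)%N.
have cD : (c = D * (n0 * k2))%N by rewrite hc hq /D -k12; ring.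
have Dc : (D %| c)%N by rewrite cD dvdn_mulr.
have D0 : (0 < D)%N by rewrite muln_gt0 d0.
have cdD : (c %/ D = n0 * k2)%N by rewrite cD mulKn.
apply: le_trans (bilinear_bound c_gt1 Dc hT N0 NM Mc (cop_classes rt Dc _)) _.
  move=> p pp; rewrite Euclid_dvdM // => /orP[pd|pk1]; apply/negP => prt.
    have : (p %| gcdn (gcdn r t) q)%N by rewrite dvdn_gcd prt hq dvdn_mulr.
    by rewrite rt dvdn1 => /eqP p1; rewrite p1 in pp.
  have := pnatPpi (part_pnat pi^' k) (_ : p \in \pi(k1)).
  rewrite mem_primes pp k10 pk1 => /(_ isT); rewrite !inE mem_primes pp u0 /=.
  by rewrite prt.
have [h [w [hn sE /andP[w0 wk] _]]] := sqd_mul_sqw R n00 k20.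
set Y := (X in X `^ _).
have hY : Y `^ 6^-1 <= Num.sqrt k2%:R * size2 `^ 6^-1.
  apply: (@root_pow k2 2) => //; first by rewrite !addr_ge0 // !pos.
    exact: size2_ge0.
  rewrite /Y cdD sE.
  have k2R : (0 : R) < k2%:R by rewrite ltr0n.
  have k1R : (0 : R) < k1%:R by rewrite ltr0n.
  have k21 : 1 <= k2%:R :> R by rewrite ler1n.
  have w1 : 1 <= w%:R :> R by rewrite ler1n.
  have wk2 : w%:R <= k2%:R :> R by rewrite ler_nat.
  have fh : d%:R * h%:R <= f%:R :> R by rewrite -natrM ler_nat leqdf.
  have cE : c%:R = q%:R * k1%:R * k2%:R :> R by rewrite hc -k12 !natrM; ring.
  have fw : d%:R * h%:R * w%:R <= f%:R * k2%:R :> R by apply: ler_pM; rewrite ?pos.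
  rewrite /size2 /D !natrM !mulrDr; apply: lerD; first apply: lerD.
  - have -> : d%:R * k1%:R * M%:R ^+ 3 * N%:R / c%:R ^+ 3 = d%:R * M%:R ^+ 3 * N%:R * q%:R^-1 * c%:R^-1 ^+ 2 * k2%:R^-1 :> R.
      by rewrite cE; field; rewrite !lt0r_neq0.
    have -> : k2%:R ^+ 2 * (d%:R * M%:R ^+ 3 * N%:R / (q%:R * C ^+ 2)) = d%:R * M%:R ^+ 3 * N%:R * q%:R^-1 * C^-1 ^+ 2 * k2%:R ^+ 2.
      by field; rewrite !lt0r_neq0.
    apply: ler_pM; rewrite ?pos //.
      by apply: ler_wpM2l; rewrite ?pos // lerXn2r ?nnegrE ?pos.
    by apply: (@le_trans _ _ 1); [rewrite invf_le1|rewrite exprn_ege1].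
  - have -> : d%:R * k1%:R * (h%:R * w%:R) * M%:R ^+ 2 / c%:R ^+ 2 = d%:R * h%:R * w%:R * (M%:R ^+ 2 * q%:R^-1 * c%:R^-1 * k2%:R^-1) :> R.
      by rewrite cE; field; rewrite !lt0r_neq0.
    apply: (@le_trans _ _ (f%:R * k2%:R * (M%:R ^+ 2 * q%:R^-1 * C^-1 * k2%:R^-1))).
      by apply: ler_pM; rewrite ?pos // ler_wpM2r ?pos // ler_wpM2l ?pos.
    have -> : f%:R * k2%:R * (M%:R ^+ 2 * q%:R^-1 * C^-1 * k2%:R^-1) = f%:R * M%:R ^+ 2 / (q%:R * C).
      by field; rewrite !lt0r_neq0.
    by rewrite ler_peMl ?pos // exprn_ege1.
  - have -> : h%:R * w%:R / (d%:R * k1%:R) = d%:R * h%:R * w%:R * (q%:R * k2%:R * d%:R^-1 ^+ 2 * c%:R^-1) :> R.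
      by rewrite cE; field; rewrite !lt0r_neq0.
    have -> : k2%:R ^+ 2 * (f%:R * q%:R / (d%:R ^+ 2 * C)) = f%:R * k2%:R * (q%:R * k2%:R * d%:R^-1 ^+ 2 * C^-1).
      by field; rewrite !lt0r_neq0.
    by apply: ler_pM; rewrite ?pos // ler_wpM2l ?pos.
apply: le_trans (ler_wpM2l _ hY) _; first by rewrite !mulr_ge0 ?exprn_ge0 ?sqrtr_ge0.
have -> : Num.sqrt k2%:R = Num.sqrt (kpart u) * Num.sqrt (kpart u) :> R.
  by rewrite -expr2 sqr_sqrtr ?kpart_ge0.
set la := l2norm I _; set lb := l2norm J _.
have -> : 360 * T ^+ 3 * c%:R * (la * lb) * (Num.sqrt (kpart u) * Num.sqrt (kpart u) * size2 `^ 6^-1) =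
   Z * ((Num.sqrt (kpart u) * la) * (Num.sqrt (kpart u) * lb)) by rewrite /Z; ring.
apply: ler_wpM2l => //; apply: ler_pM; rewrite ?mulr_ge0 ?sqrtr_ge0 //.
  by apply: l2w_class => //; exact: dvdn_gcdl.
by apply: l2w_class => //; exact: dvdn_gcdr.
Qed.
End PerModulus.

Section Totals.
Variables (R : realType) (q d n0 f : nat) (T C : R).
Hypotheses (d0 : (0 < d)%N) (n00 : (0 < n0)%N) (hq : q = (d * n0)%N).
Hypothesis hf : forall g, (g ^ 2 %| q * d)%N -> (g <= f)%N.
Variables (i0 j0 M N : nat).
Hypotheses (i00 : (0 < i0)%N) (j00 : (0 < j0)%N).
Hypotheses (N0 : (0 < N)%N) (NM : (N <= M)%N) (MC : M%:R <= C).
Let I := iota i0 M.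
Let J := iota j0 N.
Hypothesis hTc : forall n, (0 < n)%N -> n%:R <= 4 * C ^+ 2 -> (tau n)%:R <= T.
Hypothesis hTm : forall m, m \in I ++ J -> (tau m)%:R <= T.
Variables (al be : nat -> R[i]) (alc bec : nat -> nat -> R[i]).
Hypothesis hal : forall c m, C < c%:R <= 2 * C -> m \in I -> cabs (alc c m) <= cabs (al m).
Hypothesis hbe : forall c n, C < c%:R <= 2 * C -> n \in J -> cabs (bec c n) <= cabs (be n).

Let C1 : 1 <= C.
Proof. by apply: le_trans MC; rewrite ler1n (leq_trans N0). Qed.
Let C0 : 0 < C. Proof. exact: lt_le_trans ltr01 C1. Qed.
Let T1 : 1 <= T.
Proof.
by apply: (hTc (n := 1)) => //; have := exprn_ege1 2 C1; lra.
Qed.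
Let T0 : 0 <= T. Proof. exact: le_trans ler01 T1. Qed.
Let q0 : (0 < q)%N. Proof. by rewrite hq muln_gt0 d0. Qed.
Let qR : (0 : R) < q%:R. Proof. by rewrite ltr0n. Qed.

Definition form (c : nat) : R :=
  cabs (\sum_(m <- I) \sum_(n <- J | gcdn (gcdn m n) q == 1%N) alc c m * bec c n * kloosterman R m n c).

Let total : R := \sum_(0 <= c < (Num.truncn (2 * C)).+1 | (C < c%:R <= 2 * C) && (q %| c)%N) form c.
Let X := (Num.truncn (2 * C) %/ q)%N.

Let C20 : 0 <= 2 * C. Proof. by rewrite mulr_ge0 // ltW. Qed.

Let XC : X%:R <= 2 * C / q%:R.
Proof.
rewrite ler_pdivlMr // -natrM; apply: le_trans (_ : (Num.truncn (2 * C))%:R <= _).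
  by rewrite ler_nat leq_divM.
by rewrite truncn_le.
Qed.

Let totalE : total = \sum_(1 <= k < X.+1) (if C < (q * k)%:R <= 2 * C then form (q * k) else 0).
Proof.
rewrite -(sum_dvdn_reindex _ (fun c => if C < c%:R <= 2 * C then form c else 0) q0) /total.
rewrite big_mkcond big_nat_recl //= [C < 0]ltNge (ltW C0) /= add0r.
rewrite big_add1 /= [RHS]big_mkcond; apply: eq_bigr => c _.
by case: (C < _ <= _); case: (_ %| _)%N.
Qed.

Let nPT (c : nat) : C < c%:R <= 2 * C -> forall n, (0 < n <= c ^ 2)%N -> (tau n)%:R <= T.
Proof.
move=> /andP[_ c2] n /andP[n1 nc]; apply: hTc => //.
apply: (@le_trans _ _ (c ^ 2)%:R); first by rewrite ler_nat.
have -> : 4 * C ^+ 2 = (2 * C) ^+ 2 by ring.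
by rewrite natrX lerXn2r ?nnegrE.
Qed.

Let c_gt1 (c : nat) : C < c%:R <= 2 * C -> (1 < c)%N.
Proof. by move=> /andP[c1 _]; rewrite -(ltr1n R); apply: le_lt_trans c1. Qed.

Let Mc (c : nat) : C < c%:R <= 2 * C -> (M <= c)%N.
Proof. by move=> /andP[c1 _]; rewrite -(ler_nat R); apply: le_trans (ltW c1). Qed.

Lemma l2w_le (w : nat -> R) (s : seq nat) (g g' : nat -> R[i]) : (forall m, 0 <= w m) ->
  (forall m, m \in s -> cabs (g m) <= cabs (g' m)) -> l2w w s g <= l2w w s g'.
Proof.
move=> w0 h; rewrite /l2w ler_wsqrtr // big_seq [X in _ <= X]big_seq; apply: ler_sum => m ms.
by rewrite ler_wpM2r // lerXn2r ?nnegrE ?cabs_ge0 // h.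
Qed.

Let nab_ge0 : 0 <= l2norm I al * l2norm J be.
Proof. by rewrite mulr_ge0 ?sqrtr_ge0. Qed.

Lemma total_bound1 :
  total <= 4320 * T ^+ 6 * (l2norm I al * l2norm J be) * (C ^+ 2 / q%:R) * size1 d f C M N `^ 6^-1.
Proof.
set Y := _ `^ _; have Y0 : 0 <= Y by exact: powR_ge0.
have [P PE] : {P : R | P = l2norm I al * l2norm J be} by exists (l2norm I al * l2norm J be).
have P0 : 0 <= P by rewrite PE nab_ge0.
rewrite -PE.
have sq0 k : 0 <= sqw R n0 k.
  by apply: sumr_ge0 => g _; apply: sumr_ge0 => x _; exact: sqrtr_ge0.
have [X0|Xpos] := posnP X.
  by rewrite totalE X0 big_geq // !mulr_ge0 ?exprn_ge0 ?invr_ge0 // ltW.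
have tn0 : (tau n0)%:R <= T.
  apply: hTc => //.
  have h1 : q%:R <= 2 * C.
    apply: le_trans (_ : (Num.truncn (2 * C))%:R <= _); last by rewrite truncn_le.
    by rewrite ler_nat leqNgt; apply: contraL Xpos => h; rewrite /X divn_small.
  have h2 : n0%:R <= q%:R :> R by rewrite ler_nat hq leq_pmull.
  have h3 : 2 * C <= 4 * C ^+ 2 by have := ler_peMl C20 C1; have := sqr_ge0 C; rewrite expr2; lra.
  exact: le_trans h2 (le_trans h1 h3).
apply: (@le_trans _ _ (\sum_(1 <= k < X.+1) 720 * T ^+ 4 * C * P * Y * sqw R n0 k)).
  rewrite totalE big_nat_cond [X in _ <= X]big_nat_cond; apply: ler_sum => k; rewrite andbT => /andP[k0 _].
  case: ifP => [hc|_]; last by rewrite !mulr_ge0 ?exprn_ge0 // ltW.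
  have /andP[Cc c2C] := hc.
  apply: le_trans (modulus_bound1 d0 n00 k0 hq erefl hf C0 (ltW Cc) (c_gt1 hc) (nPT hc) i0 j0 _ _ N0 NM (Mc hc)) _.
  rewrite -/I -/J -!l2w1 -/Y.
  have hP : l2w (fun=> 1) I (alc (q * k)) * l2w (fun=> 1) J (bec (q * k)) <= P.
    rewrite PE -!l2w1; apply: ler_pM; rewrite ?l2w_ge0 //.
      by apply: l2w_le => // m mI; exact: hal.
    by apply: l2w_le => // m mI; exact: hbe.
  have -> : 720 * T ^+ 4 * C * P * Y * sqw R n0 k = 360 * T ^+ 4 * (2 * C) * P * (sqw R n0 k * Y) by ring.
  apply: ler_wpM2r; first by rewrite mulr_ge0.
  apply: ler_pM; rewrite ?mulr_ge0 ?exprn_ge0 ?l2w_ge0 //.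
  by apply: ler_wpM2l; rewrite ?mulr_ge0 ?exprn_ge0.
rewrite -mulr_sumr.
apply: (@le_trans _ _ (720 * T ^+ 4 * C * P * Y * (3 * T * (2 * C / q%:R)))).
  apply: ler_wpM2l; first by rewrite !mulr_ge0 ?exprn_ge0 // ltW.
  apply: le_trans (sum_sqw _ _ n00) _; apply: ler_pM; rewrite ?mulr_ge0 //.
  by apply: ler_wpM2l.
have -> : 720 * T ^+ 4 * C * P * Y * (3 * T * (2 * C / q%:R)) = 720 * 6 * (P * (C ^+ 2 / q%:R) * Y * T ^+ 5).
  ring.
have -> : 4320 * T ^+ 6 * P * (C ^+ 2 / q%:R) * Y = 4320 * (P * (C ^+ 2 / q%:R) * Y * T ^+ 6) by ring.
rewrite (_ : 720 * 6 = 4320) -?natrM //; apply: ler_wpM2l => //.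
apply: ler_wpM2l; last by rewrite ler_weXn2l.
by rewrite !mulr_ge0 ?exprn_ge0 ?invr_ge0 // ltW.
Qed.

Let sum_l2w_kpart (s : seq nat) (g : nat -> R[i]) : {subset s <= I ++ J} ->
  \sum_(1 <= k < X.+1) l2w (kpart R k) s g ^+ 2 <= T ^+ 2 * X%:R * l2norm s g ^+ 2.
Proof.
move=> hs.
have n2 (w : nat -> R) : (forall m, 0 <= w m) -> 0 <= \sum_(m <- s) cabs (g m) ^+ 2 * w m.
  by move=> w0; apply: sumr_ge0 => m _; rewrite mulr_ge0 ?exprn_ge0 ?cabs_ge0.
under eq_bigr => k _ do rewrite (sqr_sqrtr (n2 _ (@kpart_ge0 R k))).
rewrite exchange_big /= /l2norm sqr_sqrtr; last by apply: sumr_ge0 => m _; rewrite exprn_ge0 ?cabs_ge0.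
rewrite mulr_sumr big_seq [X in _ <= X]big_seq; apply: ler_sum => m /hs ms.
rewrite -mulr_sumr mulrC ler_wpM2r ?exprn_ge0 ?cabs_ge0 //.
have m0 : (0 < m)%N by move: ms; rewrite mem_cat !mem_iota; lia.
apply: le_trans (sum_sqrt_partn R X _ (primes_uniq m)) _.
  by apply/allP => p; rewrite mem_primes => /andP[].
apply: ler_wpM2r => //.
have -> : 4 ^+ size (primes m) = (2 ^ size (primes m))%:R ^+ 2 :> R.
  by rewrite natrX -exprM mulnC exprM; congr (_ ^+ _); ring.
rewrite lerXn2r ?nnegrE //; apply: le_trans (hTm ms).
by rewrite ler_nat leq_pow2_tau.
Qed.

Lemma total_bound2 :
  total <= 4320 * T ^+ 6 * (l2norm I al * l2norm J be) * (C ^+ 2 / q%:R) * size2 q d f C M N `^ 6^-1.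
Proof.
set Y := _ `^ _; have Y0 : 0 <= Y by exact: powR_ge0.
apply: (@le_trans _ _ (\sum_(1 <= k < X.+1) 720 * T ^+ 4 * C * Y * (l2w (kpart R k) I al * l2w (kpart R k) J be))).
  rewrite totalE big_nat_cond [X in _ <= X]big_nat_cond; apply: ler_sum => k; rewrite andbT => /andP[k0 _].
  case: ifP => [hc|_]; last by rewrite !mulr_ge0 ?exprn_ge0 ?l2w_ge0 // ltW.
  have /andP[Cc c2C] := hc.
  apply: le_trans (modulus_bound2 d0 n00 k0 hq erefl hf C0 (ltW Cc) (c_gt1 hc) (nPT hc) _ _ i00 j00 N0 NM (Mc hc)) _.
  rewrite -/I -/J -/Y.
  have hP : l2w (kpart R k) I (alc (q * k)) * l2w (kpart R k) J (bec (q * k)) <= l2w (kpart R k) I al * l2w (kpart R k) J be.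
    apply: ler_pM; rewrite ?l2w_ge0 //.
      by apply: l2w_le => [m|m mI]; [exact: kpart_ge0|exact: hal].
    by apply: l2w_le => [m|m mI]; [exact: kpart_ge0|exact: hbe].
  set Q := l2w _ _ al * _ in hP *.
  have -> : 720 * T ^+ 4 * C * Y * Q = 360 * T ^+ 4 * (2 * C) * Q * Y by ring.
  apply: ler_wpM2r => //.
  apply: ler_pM; rewrite ?mulr_ge0 ?exprn_ge0 ?l2w_ge0 //.
  by apply: ler_wpM2l; rewrite ?mulr_ge0 ?exprn_ge0.
rewrite -mulr_sumr.
apply: (@le_trans _ _ (720 * T ^+ 4 * C * Y * (T ^+ 2 * (2 * C / q%:R) * (l2norm I al * l2norm J be)))).
  apply: ler_wpM2l; first by rewrite !mulr_ge0 ?exprn_ge0 // ltW.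
  apply: le_trans (cauchy_schwarz_sqrt _ _ _ _) _.
  apply: (@le_trans _ _ (Num.sqrt (T ^+ 2 * X%:R * l2norm I al ^+ 2) * Num.sqrt (T ^+ 2 * X%:R * l2norm J be ^+ 2))).
    apply: ler_pM; rewrite ?sqrtr_ge0 // ler_wsqrtr // sum_l2w_kpart // => m; rewrite mem_cat => ->; rewrite ?orbT //.
  have sE (l : R) : 0 <= l -> Num.sqrt (T ^+ 2 * X%:R * l ^+ 2) = T * Num.sqrt X%:R * l.
    move=> l0; have -> : T ^+ 2 * X%:R * l ^+ 2 = (T * Num.sqrt X%:R * l) ^+ 2.
      by rewrite !exprMn sqr_sqrtr.
    by rewrite sqrtr_sqr ger0_norm // !mulr_ge0 ?sqrtr_ge0.
  rewrite !sE ?sqrtr_ge0 //.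
  have -> : T * Num.sqrt X%:R * l2norm I al * (T * Num.sqrt X%:R * l2norm J be) =
    T ^+ 2 * Num.sqrt X%:R ^+ 2 * (l2norm I al * l2norm J be) by ring.
  rewrite sqr_sqrtr //; apply: ler_wpM2r => //; apply: ler_wpM2l => //; exact: exprn_ge0.
move: (nab_ge0); move: (l2norm I al * l2norm J be) => P P0.
have -> : 720 * T ^+ 4 * C * Y * (T ^+ 2 * (2 * C / q%:R) * P) = 1440 * (T ^+ 6 * P * (C ^+ 2 / q%:R) * Y).
  ring.
have -> : 4320 * T ^+ 6 * P * (C ^+ 2 / q%:R) * Y = 4320 * (T ^+ 6 * P * (C ^+ 2 / q%:R) * Y) by ring.
rewrite ler_wpM2r ?ler_nat // !mulr_ge0 ?exprn_ge0 ?invr_ge0 // ltW //.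
Qed.
End Totals.

Theorem corollary7p9 (R : realType) (eps B : R) (heps : 0 < eps) :
  exists K : R,
  forall (q d d' e f : nat)
    (hd : (0 < d)%N) (hd' : (0 < d')%N) (he : (0 < e)%N)
    (hq : q = (d * d' * e)%N) (hd'd : (d' %| d)%N) (hde : coprime d e)
    (hf_le : f%:R <= Num.sqrt (q * d)%:R :> R)
    (hf : largest_square_root_divisor f (q * d))
    (C : R) (hC : 2^-1 <= C)
    (I J : seq nat) (M N : nat)
    (hI : pos_interval I) (hJ : pos_interval J)
    (hIM : size I = M) (hJN : size J = N)
    (hN : (1 <= N)%N) (hNM : (N <= M)%N) (hMC : M%:R <= C)
    (hmax : (\max_(m <- I ++ J) m)%:R <= B * C `^ B)
    (alpha beta : nat -> R[i])
    (alphac betac : nat -> nat -> R[i])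
    (halpha : forall c m : nat, C < c%:R <= 2 * C -> m \in I ->
      cabs (alphac c m) <= cabs (alpha m))
    (hbeta : forall c n : nat, C < c%:R <= 2 * C -> n \in J ->
      cabs (betac c n) <= cabs (beta n)),
  \sum_(0 <= c < (Num.truncn (2 * C)).+1 | (C < c%:R <= 2 * C) && (q %| c)%N)
    cabs (\sum_(m <- I) \sum_(n <- J | gcdn (gcdn m n) q == 1%N)
            alphac c m * betac c n * kloosterman R m n c)
  <= K * (l2norm I alpha * l2norm J beta * (C `^ (2 + eps) / q%:R) *
     Num.min
      ((d%:R * M%:R ^+ 3 * N%:R / C ^+ 3
        + f%:R * M%:R ^+ 2 / C ^+ 2
        + f%:R / d%:R ^+ 2) `^ 6^-1)
      ((d%:R * M%:R ^+ 3 * N%:R / (q%:R * C ^+ 2)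
        + f%:R * M%:R ^+ 2 / (q%:R * C)
        + f%:R * q%:R / (d%:R ^+ 2 * C)) `^ 6^-1)).
Proof.
pose P : R := Num.max 2 B; pose L : R := Num.max 4 B.
have P2 : 2 <= P by rewrite le_max lexx.
have L4 : 4 <= L by rewrite le_max lexx.
have P0 : 0 < P by lra. have L0 : 0 < L by lra.
pose eps' := eps / (6 * P).
have eps'0 : 0 < eps' by rewrite divr_gt0 // mulr_gt0.
have [Kd Kd1 hKd] := divisor_bound eps'0.
have Kd0 : 0 <= Kd by exact: le_trans ler01 Kd1.
exists (4320 * (Kd * L `^ eps') ^+ 6).
move=> q d d' e f d0 d'0 e0 hq _ _ _ [_ hf] C _ I J M N hI hJ hIM hJN N0 NM MC hmax al be alc bec hal hbe.
have [i0 i00 IE] := hI; have [j0 j00 JE] := hJ; rewrite hIM in IE; rewrite hJN in JE.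
move: hmax hal hbe; rewrite {}IE {}JE {hI hJ hIM hJN I J} => hmax hal hbe.
set I := iota i0 M in hmax hal *; set J := iota j0 N in hmax hbe *.
have C1 : 1 <= C by apply: le_trans MC; rewrite ler1n (leq_trans N0).
have C0 : 0 < C by exact: lt_le_trans ltr01 C1.
pose T := Kd * (L * C `^ P) `^ eps'.
have LC0 : 0 <= L * C `^ P by rewrite mulr_ge0 ?powR_ge0 // ltW.
have hT n : (0 < n)%N -> n%:R <= L * C `^ P -> (tau n)%:R <= T.
  move=> n0 nL; apply: le_trans (hKd n n0) _; apply: ler_wpM2l => //.
  by apply: ge0_ler_powR; rewrite ?nnegrE // ltW.
have hTc n : (0 < n)%N -> n%:R <= 4 * C ^+ 2 -> (tau n)%:R <= T.
  move=> n0 nC; apply: hT => //; apply: le_trans nC _.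
  apply: ler_pM; rewrite ?exprn_ge0 ?(ltW C0) //.
  by rewrite -powR_mulrn ?(ltW C0) //; apply: ler_powR.
have hTm m : m \in I ++ J -> (tau m)%:R <= T.
  move=> mIJ; apply: hT; first by move: mIJ; rewrite mem_cat !mem_iota; lia.
  apply: (@le_trans _ _ (B * C `^ B)).
    by apply: le_trans hmax; rewrite ler_nat; apply: leq_bigmax_seq.
  apply: (@le_trans _ _ (L * C `^ B)).
    by apply: ler_wpM2r; rewrite ?powR_ge0 // le_max lexx orbT.
  by apply: ler_wpM2l; [exact: ltW|apply: ler_powR; rewrite // le_max lexx orbT].
have T6 : T ^+ 6 = (Kd * L `^ eps') ^+ 6 * C `^ eps.
  rewrite /T powRM ?powR_ge0 ?(ltW L0) // mulrA [LHS]exprMn; congr (_ * _).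
  rewrite -powR_mulrn ?powR_ge0 // -!powRrM; congr (_ `^ _).
  by rewrite /eps'; field; rewrite lt0r_neq0.
have n00 : (0 < d' * e)%N by rewrite muln_gt0 d'0.
have hqn : q = (d * (d' * e))%N by rewrite hq mulnA.
have b1 := total_bound1 d0 n00 hqn hf N0 NM MC hTc hal hbe.
have b2 := total_bound2 d0 n00 hqn hf i00 j00 N0 NM MC hTc hTm hal hbe.
rewrite /form in b1 b2.
have -> : C `^ (2 + eps) = C ^+ 2 * C `^ eps.
  by rewrite powRD ?powR_mulrn ?(ltW C0) // (gt_eqF C0) implybT.
set mn := Num.min _ _.
have -> : 4320 * (Kd * L `^ eps') ^+ 6 * (l2norm I al * l2norm J be * (C ^+ 2 * C `^ eps / q%:R) * mn) =
  4320 * T ^+ 6 * (l2norm I al * l2norm J be) * (C ^+ 2 / q%:R) * mn by rewrite T6; ring.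
by rewrite /mn minEle; case: ifP.
Qed.
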